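(* Let $K$ be an algebraically closed field of characteristic $p\ge 0$ and let $f\in K[[x,y]]$ be reduced. Then $$\gamma(f)\;\geq\; 2\delta(f)-r(f)+1.$$ Equality holds if and only if $p$ is right intersection multiplicity good (right im-good) for $f$.
   Context: For $f,g\in K[[x,y]]$, $i(f,g):=\dim_K K[[x,y]]/\langle f,g\rangle\in\mathbb{N}\cup\{\infty\}$; $f_x,f_y$ are the partial derivatives. $f$ is reduced if it is nonzero and has no multiple irreducible factor. For reduced $f$: $\delta(f):=\dim_K \bar R/R$, where $R=K[[x,y]]/\langle f\rangle$ and $\bar R$ is its normalization; $r(f)$ is the number of branches (irreducible factors) of $f$. The number $\tilde\gamma(f)=\tilde\gamma_{x,y}(f)$ of a reduced $f$ (with respect to the fixed coordinates $x,y$) is defined by: (1) $\tilde\gamma(x):=0$, $\tilde\gamma(y):=0$; (2) if $f$ is irreducible and convenient (i.e. $i(f,x),i(f,y)<\infty$), then $\tilde\gamma(f):=\min\{i(f,f_x)-i(f,y)+1,\ i(f,f_y)-i(f,x)+1\}$; (3) if $f=f_1\cdots f_r$ with $f_i$ irreducible, then $\tilde\gamma(f):=\sum_{i=1}^r\big(\tilde\gamma(f_i)+\sum_{j\ne i}i(f_i,f_j)\big)-r+1$. One has $\tilde\gamma(u)=1$ and $\tilde\gamma(u f)=\tilde\gamma(f)$ for every unit $u$ (in particular $\tilde\gamma(ux)=\tilde\gamma(uy)=0$). The gamma invariant $\gamma(f)$ is the minimum of $\tilde\gamma_{X,Y}(f)$ over all coordinate systems $X,Y$ of $K[[x,y]]$,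 i.e. the minimum of $\tilde\gamma(g)$ over all $g$ right equivalent to $f$. Here $f$ and $g$ are right equivalent if $f=\Phi(g)$ for some $K$-algebra automorphism $\Phi$ of $K[[x,y]]$. With $f=f_1\cdots f_r$, $f_i$ irreducible, $p$ is intersection multiplicity good (im-good) for $f$ if for all $i$, either $i(f_i,x)\ne 0\pmod p$ or $i(f_i,y)\neq 0\pmod p$; $p$ is right im-good for $f$ if it is im-good for some $g$ right equivalent to $f$. (For $p=0$ both always hold.) *)

(* Defs.v *)
From HB Require Import structures.
From mathcomp Require Import all_boot all_order all_algebra ring.
From mathcomp Require Import boolp classical_sets constructive_ereal.

Set Implicit Arguments.
Unset Strict Implicit.
Unset Printing Implicit Defensive.

Import Order.TTheory GRing.Theory Num.Theory.
Local Open Scope ring_scope.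
Local Open Scope quotient_scope.
Local Open Scope classical_set_scope.

(** * Dimensions of quotients of vector spaces *)

Section QuotientDimension.
Variables (K : fieldType) (V : lmodType K).

(* The classes of [b 0, ..., b (n-1)] form a K-basis of U/W. *)
Definition basis_mod (U W : set V) (n : nat) (b : 'I_n -> V) : Prop :=
  (forall i, U (b i)) /\
  (forall v, U v -> exists! c : 'rV[K]_n, W (v - \sum_(i < n) c 0 i *: b i)).

(* dim_K U/W for subspaces W <= U of V, with value +oo when U/W is not finite
   dimensional.  The type [\bar int] plays the role of N ∪ {oo}, and leaves
   room for the differences that occur in the definition of [gamma_tilde]. *)
Definition quotient_dim (U W : set V) : \bar int :=
  xget +oo%E
    [set n%:Z%:E | n in [set n : nat | exists b : 'I_n -> V, basis_mod U W b]].

End QuotientDimension.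

(** * The power series ring K[[x,y]] *)

(* [coef2 f i j] is the coefficient of x^i y^j in f. *)
Record fps2 (K : Type) := Fps2 { coef2 : nat -> nat -> K }.

HB.instance Definition _ (K : Type) := gen_eqMixin (fps2 K).
HB.instance Definition _ (K : Type) := gen_choiceMixin (fps2 K).

Lemma fps2P (K : Type) (f g : fps2 K) :
  (forall i j, coef2 f i j = coef2 g i j) -> f = g.
Proof.
case: f g => [f] [g] /= fg; congr Fps2.
by apply/funext => i; apply/funext => j.
Qed.

Section PowerSeriesRing.
Variable K : comNzRingType.
Implicit Types (f g h : fps2 K) (c : K).

Definition fps2_zero : fps2 K := Fps2 (fun _ _ => 0).
Definition fps2_opp f : fps2 K := Fps2 (fun i j => - coef2 f i j).
Definition fps2_add f g : fps2 K :=
  Fps2 (fun i j => coef2 f i j + coef2 g i j).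
Definition fps2_one : fps2 K :=
  Fps2 (fun i j => ((i == 0%N) && (j == 0%N))%:R).
Definition fps2_mul f g : fps2 K :=
  Fps2 (fun m n => \sum_(i < m.+1) \sum_(j < n.+1)
                     coef2 f i j * coef2 g (m - i) (n - j)).
Definition fps2_scale c f : fps2 K := Fps2 (fun i j => c * coef2 f i j).

Fact fps2_addA : associative fps2_add.
Proof. by move=> f g h; apply: fps2P => i j /=; rewrite addrA. Qed.
Fact fps2_addC : commutative fps2_add.
Proof. by move=> f g; apply: fps2P => i j /=; rewrite addrC. Qed.
Fact fps2_add0 : left_id fps2_zero fps2_add.
Proof. by move=> f; apply: fps2P => i j /=; rewrite add0r. Qed.
Fact fps2_addN : left_inverse fps2_zero fps2_opp fps2_add.
Proof. by move=> f; apply: fps2P => i j /=; rewrite addNr. Qed.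

HB.instance Definition _ := GRing.isZmodule.Build (fps2 K)
  fps2_addA fps2_addC fps2_add0 fps2_addN.

(* The multiplicative axioms are transported from {poly {poly K}}. *)
Local Definition trunc N f : {poly {poly K}} :=
  \poly_(i < N) \poly_(j < N) coef2 f i j.

Local Lemma coef_trunc N f i j : (i < N)%N -> (j < N)%N ->
  (trunc N f)`_i`_j = coef2 f i j.
Proof. by move=> iN jN; rewrite coef_poly iN coef_poly jN. Qed.

Local Lemma coef_polyM (p q : {poly {poly K}}) m n : (p * q)`_m`_n =
  \sum_(i < m.+1) \sum_(j < n.+1) p`_i`_j * q`_(m - i)`_(n - j).
Proof.
by rewrite coefM coef_sum; apply: eq_bigr => i _; rewrite coefM.
Qed.

Local Lemma eq_coef_polyM (p p' q q' : {poly {poly K}}) m n :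
  (forall i j, (i <= m)%N -> (j <= n)%N -> p`_i`_j = p'`_i`_j) ->
  (forall i j, (i <= m)%N -> (j <= n)%N -> q`_i`_j = q'`_i`_j) ->
  (p * q)`_m`_n = (p' * q')`_m`_n.
Proof.
move=> pp' qq'; rewrite !coef_polyM; apply: eq_bigr => i _.
apply: eq_bigr => j _.
by rewrite pp' ?qq' ?leq_subr // -ltnS; apply: ltn_ord.
Qed.

Local Lemma coef_mul N f g m n : (m < N)%N -> (n < N)%N ->
  coef2 (fps2_mul f g) m n = (trunc N f * trunc N g)`_m`_n.
Proof.
move=> mN nN; rewrite coef_polyM /=; apply: eq_bigr => i _.
apply: eq_bigr => j _.
have iN : (i < N)%N := leq_trans (ltn_ord i) mN.
have jN : (j < N)%N := leq_trans (ltn_ord j) nN.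
have miN : (m - i < N)%N := leq_ltn_trans (leq_subr _ _) mN.
have njN : (n - j < N)%N := leq_ltn_trans (leq_subr _ _) nN.
by rewrite !coef_trunc.
Qed.

Fact fps2_mulA : associative fps2_mul.
Proof.
move=> f g h; apply: fps2P => m n; set N := (m + n).+1.
have mN : (m < N)%N by rewrite ltnS leq_addr.
have nN : (n < N)%N by rewrite ltnS leq_addl.
have E u v : forall i j, (i <= m)%N -> (j <= n)%N ->
    (trunc N (fps2_mul u v))`_i`_j = (trunc N u * trunc N v)`_i`_j.
  move=> i j im jn; have iN := leq_ltn_trans im mN.
  by have jN := leq_ltn_trans jn nN; rewrite coef_trunc // (coef_mul _ _ iN jN).
rewrite !(coef_mul _ _ mN nN).
rewrite (eq_coef_polyM (p' := trunc N f) _ (E g h)) //.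
by rewrite mulrA; apply: eq_coef_polyM => // i j im jn; rewrite E.
Qed.

Fact fps2_mulC : commutative fps2_mul.
Proof.
move=> f g; apply: fps2P => m n.
have mN : (m < (m + n).+1)%N by rewrite ltnS leq_addr.
have nN : (n < (m + n).+1)%N by rewrite ltnS leq_addl.
by rewrite !(coef_mul _ _ mN nN) mulrC.
Qed.

Fact fps2_mul1 : left_id fps2_one fps2_mul.
Proof.
move=> f; apply: fps2P => m n /=.
rewrite big_ord_recl big_ord_recl /= !subn0 mul1r.
rewrite big1 ?addr0; last by move=> j _; rewrite mul0r.
by rewrite big1 ?addr0 // => i _; rewrite big1 // => j _; rewrite mul0r.
Qed.

Fact fps2_mulDl : left_distributive fps2_mul fps2_add.
Proof.
move=> f g h; apply: fps2P => m n /=; rewrite -big_split /=.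
apply: eq_bigr => i _; rewrite -big_split /=.
by apply: eq_bigr => j _; rewrite mulrDl.
Qed.

Fact fps2_one_neq0 : fps2_one != 0.
Proof.
apply/eqP => /(congr1 (fun f => coef2 f 0 0)) /= /eqP.
by rewrite oner_eq0.
Qed.

HB.instance Definition _ := GRing.Zmodule_isComNzRing.Build (fps2 K)
  fps2_mulA fps2_mulC fps2_mul1 fps2_mulDl fps2_one_neq0.

Fact fps2_scaleA a b f :
  fps2_scale a (fps2_scale b f) = fps2_scale (a * b) f.
Proof. by apply: fps2P => i j /=; rewrite mulrA. Qed.
Fact fps2_scale1 : left_id 1 fps2_scale.
Proof. by move=> f; apply: fps2P => i j /=; rewrite mul1r. Qed.
Fact fps2_scaleDr : right_distributive fps2_scale +%R.
Proof. by move=> c f g; apply: fps2P => i j /=; rewrite mulrDr. Qed.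
Fact fps2_scaleDl f : {morph fps2_scale^~ f : a b / a + b}.
Proof. by move=> a b; apply: fps2P => i j /=; rewrite mulrDl. Qed.

HB.instance Definition _ := GRing.Zmodule_isLmodule.Build K (fps2 K)
  fps2_scaleA fps2_scale1 fps2_scaleDr fps2_scaleDl.

Fact fps2_scaleAl c f g : c *: (f * g) = (c *: f) * g.
Proof.
apply: fps2P => m n /=; rewrite mulr_sumr; apply: eq_bigr => i _.
by rewrite mulr_sumr; apply: eq_bigr => j _; rewrite mulrA.
Qed.

HB.instance Definition _ :=
  GRing.Lmodule_isLalgebra.Build K (fps2 K) fps2_scaleAl.
HB.instance Definition _ := GRing.Lalgebra_isComAlgebra.Build K (fps2 K).

Definition fps2_unit : {pred fps2 K} := fun f => `[<exists g, g * f = 1>].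
Definition fps2_inv f : fps2 K :=
  if pselect (exists g, g * f = 1) is left e then projT1 (cid e) else f.

Fact fps2_mulVx : {in fps2_unit, left_inverse 1 fps2_inv *%R}.
Proof.
move=> f /asboolP e; rewrite /fps2_inv.
by case: pselect => // e'; case: cid.
Qed.
Fact fps2_unitP f g : g * f = 1 -> fps2_unit f.
Proof. by move=> e; apply/asboolP; exists g. Qed.
Fact fps2_inv_out : {in [predC fps2_unit], fps2_inv =1 id}.
Proof.
move=> f /negP nu; rewrite /fps2_inv; case: pselect => // e.
by case: nu; apply/asboolP.
Qed.

HB.instance Definition _ := GRing.ComNzRing_hasMulInverse.Build (fps2 K)
  fps2_mulVx fps2_unitP fps2_inv_out.

Definition fps2X : fps2 K :=
  Fps2 (fun i j => ((i == 1%N) && (j == 0%N))%:R).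
Definition fps2Y : fps2 K :=
  Fps2 (fun i j => ((i == 0%N) && (j == 1%N))%:R).

Definition fps2_dx f : fps2 K := Fps2 (fun i j => coef2 f i.+1 j *+ i.+1).
Definition fps2_dy f : fps2 K := Fps2 (fun i j => coef2 f i j.+1 *+ j.+1).

End PowerSeriesRing.

Arguments fps2X {K}.
Arguments fps2Y {K}.

(** * Quotient by a principal ideal *)

(* No properness is assumed: for a unit f the quotient is the zero ring, which
   is why the ring_quotient library, restricted to proper ideals, is only used
   for the additive structure. *)

Section PrincipalQuotient.
Variables (A : comPzRingType) (f : A).

Definition principal_ideal : {pred A} := fun a => `[<exists c, a = c * f>].

Fact principal_ideal_zmod_closed : zmod_closed principal_ideal.
Proof.
split=> [|a b /asboolP[c ->] /asboolP[d ->]]; apply/asboolP.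
  by exists 0; rewrite mul0r.
by exists (c - d); rewrite mulrBl.
Qed.
HB.instance Definition _ :=
  GRing.isZmodClosed.Build A principal_ideal principal_ideal_zmod_closed.

Definition pquot : Type := {ideal_quot principal_ideal}.
HB.instance Definition _ := GRing.Zmodule.on pquot.

Definition to_pquot (a : A) : pquot := \pi_{ideal_quot principal_ideal} a.

Lemma to_pquotP a b : to_pquot a = to_pquot b <-> exists c, a - b = c * f.
Proof.
rewrite /to_pquot; split=> [/eqP|[c ab]]; last first.
  by apply/eqP; rewrite -Quotient.idealrBE; apply/asboolP; exists c.
by rewrite -Quotient.idealrBE => /asboolP.
Qed.

Definition pquot_one : pquot := to_pquot 1.
Definition pquot_mul (u v : pquot) : pquot :=
  to_pquot (repr (u : {ideal_quot principal_ideal}) *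
            repr (v : {ideal_quot principal_ideal})).

Local Lemma pquotW (P : pquot -> Prop) :
  (forall a, P (to_pquot a)) -> forall u, P u.
Proof. by move=> h u; move: u; apply: quotW. Qed.

Local Lemma to_pquotD a b : to_pquot (a + b) = to_pquot a + to_pquot b.
Proof. exact: (raddfD (\pi_{ideal_quot principal_ideal})). Qed.

Local Lemma to_pquotM a b :
  pquot_mul (to_pquot a) (to_pquot b) = to_pquot (a * b).
Proof.
have red a' : exists c,
    repr (to_pquot a' : {ideal_quot principal_ideal}) = a' + c * f.
  have /to_pquotP[c E] :
      to_pquot (repr (to_pquot a' : {ideal_quot principal_ideal})) = to_pquot a'.
    by rewrite {1}/to_pquot reprK.
  by exists c; rewrite -E addrC subrK.
rewrite /pquot_mul; have [c ->] := red a; have [d ->] := red b.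
apply/to_pquotP; exists (a * d + c * b + c * f * d).
rewrite mulrDl !mulrDr !mulrDl addrC !addrA addNr add0r.
by congr (_ + _ + _); [rewrite mulrA | rewrite mulrAC | rewrite mulrA].
Qed.

Fact pquot_mulA : associative pquot_mul.
Proof.
elim/pquotW => a; elim/pquotW => b; elim/pquotW => c.
by rewrite !to_pquotM mulrA.
Qed.
Fact pquot_mulC : commutative pquot_mul.
Proof. by elim/pquotW => a; elim/pquotW => b; rewrite !to_pquotM mulrC. Qed.
Fact pquot_mul1 : left_id pquot_one pquot_mul.
Proof. by elim/pquotW => a; rewrite to_pquotM mul1r. Qed.
Fact pquot_mulDl : left_distributive pquot_mul +%R.
Proof.
elim/pquotW => a; elim/pquotW => b; elim/pquotW => c.
by rewrite -to_pquotD !to_pquotM -to_pquotD mulrDl.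
Qed.

HB.instance Definition _ := GRing.Zmodule_isComPzRing.Build pquot
  pquot_mulA pquot_mulC pquot_mul1 pquot_mulDl.

Fact to_pquot_is_zmod_morphism : zmod_morphism to_pquot.
Proof. exact: (raddfB (\pi_{ideal_quot principal_ideal})). Qed.
HB.instance Definition _ :=
  GRing.isZmodMorphism.Build A pquot to_pquot to_pquot_is_zmod_morphism.
Fact to_pquot_is_monoid_morphism : monoid_morphism to_pquot.
Proof. by split=> // a b; rewrite -to_pquotM. Qed.
HB.instance Definition _ :=
  GRing.isMonoidMorphism.Build A pquot to_pquot to_pquot_is_monoid_morphism.

End PrincipalQuotient.

(** * Total ring of fractions *)

Section TotalFractions.
Variable R : comPzRingType.

(* b is not a zero divisor; in the zero ring this allows b = 0. *)
Definition nzd (b : R) : bool := `[<GRing.lreg b>].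

Record tfrac := TFrac { tnum : R; tden : R; tden_nzd : nzd tden }.

HB.instance Definition _ := gen_eqMixin tfrac.
HB.instance Definition _ := gen_choiceMixin tfrac.

Implicit Types s t u : tfrac.

Definition tfrac_equiv s t : bool := tnum s * tden t == tnum t * tden s.

Local Lemma lreg_den s : GRing.lreg (tden s).
Proof. exact/asboolP/tden_nzd. Qed.

Fact tfrac_equiv_refl : reflexive tfrac_equiv.
Proof. by move=> s; apply/eqP. Qed.
Fact tfrac_equiv_sym : symmetric tfrac_equiv.
Proof. by move=> s t; rewrite /tfrac_equiv eq_sym. Qed.
Fact tfrac_equiv_trans : transitive tfrac_equiv.
Proof.
move=> t s u /eqP st /eqP tu; apply/eqP/(lreg_den (s := t)).
transitivity (tnum s * tden t * tden u); first by ring.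
by rewrite st; transitivity (tnum t * tden u * tden s); [ring | rewrite tu; ring].
Qed.

Canonical tfrac_equiv_equiv :=
  EquivRel tfrac_equiv tfrac_equiv_refl tfrac_equiv_sym tfrac_equiv_trans.

Definition totfrac : Type := {eq_quot tfrac_equiv}.
HB.instance Definition _ := Choice.on totfrac.

Definition tfrac_class s : totfrac := \pi_{eq_quot tfrac_equiv} s.

Lemma tfrac_classP s t :
  tfrac_class s = tfrac_class t <-> tnum s * tden t = tnum t * tden s.
Proof. by split=> [/eqmodP/eqP|/eqP st]; last exact/eqmodP. Qed.

Fact nzd1 : nzd 1.
Proof. exact/asboolP/lreg1. Qed.
Fact nzdM b c : nzd b -> nzd c -> nzd (b * c).
Proof. by move=> /asboolP rb /asboolP rc; apply/asboolP/lregM. Qed.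

Definition tfrac_of (a : R) : tfrac := TFrac a nzd1.
Definition tfrac_add s t : tfrac :=
  TFrac (tnum s * tden t + tnum t * tden s)
        (nzdM (tden_nzd s) (tden_nzd t)).
Definition tfrac_opp s : tfrac := TFrac (- tnum s) (tden_nzd s).
Definition tfrac_mul s t : tfrac :=
  TFrac (tnum s * tnum t) (nzdM (tden_nzd s) (tden_nzd t)).

Local Definition trepr (q : totfrac) : tfrac :=
  repr (q : {eq_quot tfrac_equiv}).

Definition totfrac_add (q r : totfrac) : totfrac :=
  tfrac_class (tfrac_add (trepr q) (trepr r)).
Definition totfrac_opp (q : totfrac) : totfrac :=
  tfrac_class (tfrac_opp (trepr q)).
Definition totfrac_mul (q r : totfrac) : totfrac :=
  tfrac_class (tfrac_mul (trepr q) (trepr r)).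

Definition to_totfrac (a : R) : totfrac := tfrac_class (tfrac_of a).

Local Lemma totfracW (P : totfrac -> Prop) :
  (forall s, P (tfrac_class s)) -> forall q, P q.
Proof. by move=> h q; move: q; apply: quotW. Qed.

Local Lemma treprP s : tnum (trepr (tfrac_class s)) * tden s =
               tnum s * tden (trepr (tfrac_class s)).
Proof. by apply/tfrac_classP; rewrite /trepr /tfrac_class reprK. Qed.

Local Lemma addE s t : totfrac_add (tfrac_class s) (tfrac_class t) =
               tfrac_class (tfrac_add s t).
Proof.
apply/tfrac_classP => /=; move: (treprP s) (treprP t).
set s' := trepr _; set t' := trepr _ => es et.
transitivity (tnum s' * tden s * (tden t' * tden t) +
              tnum t' * tden t * (tden s' * tden s)); first by ring.
by rewrite es et; ring.
Qed.

Local Lemma oppE s : totfrac_opp (tfrac_class s) = tfrac_class (tfrac_opp s).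
Proof. by apply/tfrac_classP; rewrite /= !mulNr treprP. Qed.

Local Lemma mulE s t : totfrac_mul (tfrac_class s) (tfrac_class t) =
               tfrac_class (tfrac_mul s t).
Proof. by apply/tfrac_classP; rewrite /= mulrACA !treprP mulrACA. Qed.

Fact totfrac_addA : associative totfrac_add.
Proof.
elim/totfracW => s; elim/totfracW => t; elim/totfracW => u.
by rewrite !addE; apply/tfrac_classP => /=; ring.
Qed.
Fact totfrac_addC : commutative totfrac_add.
Proof.
elim/totfracW => s; elim/totfracW => t; rewrite !addE.
by apply/tfrac_classP; rewrite /= addrC [tden t * _]mulrC.
Qed.
Fact totfrac_add0 : left_id (to_totfrac 0) totfrac_add.
Proof.
elim/totfracW => s; rewrite addE; apply/tfrac_classP => /=.
by rewrite mul0r add0r mulr1 mul1r.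
Qed.
Fact totfrac_addN : left_inverse (to_totfrac 0) totfrac_opp totfrac_add.
Proof.
elim/totfracW => s; rewrite oppE addE; apply/tfrac_classP => /=.
by rewrite mulNr addNr !mul0r.
Qed.

HB.instance Definition _ := GRing.isZmodule.Build totfrac
  totfrac_addA totfrac_addC totfrac_add0 totfrac_addN.

Fact totfrac_mulA : associative totfrac_mul.
Proof.
elim/totfracW => s; elim/totfracW => t; elim/totfracW => u.
by rewrite !mulE; apply/tfrac_classP; rewrite /= !mulrA.
Qed.
Fact totfrac_mulC : commutative totfrac_mul.
Proof.
elim/totfracW => s; elim/totfracW => t; rewrite !mulE.
by apply/tfrac_classP; rewrite /= mulrC [tden t * _]mulrC [tnum t * _]mulrC mulrC.
Qed.
Fact totfrac_mul1 : left_id (to_totfrac 1) totfrac_mul.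
Proof.
by elim/totfracW => s; rewrite mulE; apply/tfrac_classP; rewrite /= !mul1r.
Qed.
Fact totfrac_mulDl : left_distributive totfrac_mul totfrac_add.
Proof.
elim/totfracW => s; elim/totfracW => t; elim/totfracW => u.
by rewrite !(mulE, addE); apply/tfrac_classP => /=; ring.
Qed.

HB.instance Definition _ := GRing.Zmodule_isComPzRing.Build totfrac
  totfrac_mulA totfrac_mulC totfrac_mul1 totfrac_mulDl.

Fact to_totfrac_is_zmod_morphism : zmod_morphism to_totfrac.
Proof.
move=> a b.
change (to_totfrac (a - b) =
        totfrac_add (to_totfrac a) (totfrac_opp (to_totfrac b))).
rewrite oppE addE.
by apply/tfrac_classP; rewrite /= !mulr1.
Qed.
HB.instance Definition _ := GRing.isZmodMorphism.Build R totfrac to_totfrac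
  to_totfrac_is_zmod_morphism.
Fact to_totfrac_is_monoid_morphism : monoid_morphism to_totfrac.
Proof.
split=> // a b; rewrite [RHS]mulE.
by apply/tfrac_classP; rewrite /= !mulr1.
Qed.
HB.instance Definition _ := GRing.isMonoidMorphism.Build R totfrac to_totfrac
  to_totfrac_is_monoid_morphism.

End TotalFractions.

(** * Factorization in a commutative ring *)

Section Factorization.
Variable A : comUnitRingType.
Implicit Types (f g : A) (s : seq A).

Definition irreducible_elt f : Prop :=
  [/\ f != 0, f \isn't a GRing.unit &
      forall a b, f = a * b -> a \is a GRing.unit \/ b \is a GRing.unit].

Definition reduced f : Prop :=
  f != 0 /\ (forall g, irreducible_elt g -> ~ exists h, f = h * g ^+ 2).

Definition factorization f s : Prop :=
  (forall g, g \in s -> irreducible_elt g) /\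
  (exists2 u, u \is a GRing.unit & f = u * \prod_(g <- s) g).

(* The irreducible factors f_1, ..., f_r of f.  They are determined up to order
   and units, and all the notions below are insensitive to both.  The explicit
   unit in [factorization] lets a unit f have the empty list of factors. *)
Definition factors f : seq A := xget [::] [set s | factorization f s].

End Factorization.

(** * Invariants of plane curve singularities *)

(* The K-vector space structure of the total ring of fractions Q(R) of
   R = K[[x,y]]/<f>. *)
Section CurveFractionRing.
Variables (K : fieldType) (f : fps2 K).

Definition curve_ring : Type := pquot f.
HB.instance Definition _ := GRing.ComPzRing.on curve_ring.

Definition curve_frac : Type := totfrac curve_ring.
HB.instance Definition _ := GRing.ComPzRing.on curve_frac.

Definition curve_to_frac (a : curve_ring) : curve_frac := to_totfrac a.

Local Definition scalar (c : K) : curve_frac :=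
  curve_to_frac (to_pquot f c%:A).

Local Lemma scalarD a b : scalar (a + b) = scalar a + scalar b.
Proof. by rewrite /scalar /curve_to_frac scalerDl !raddfD. Qed.
Local Lemma scalarM a b : scalar (a * b) = scalar a * scalar b.
Proof.
have E : (a * b)%:A = a%:A * b%:A :> fps2 K.
  by rewrite -scalerAl mul1r scalerA.
by rewrite /scalar /curve_to_frac E !rmorphM.
Qed.
Local Lemma scalar1 : scalar 1 = 1.
Proof. by rewrite /scalar /curve_to_frac scale1r !rmorph1. Qed.

Definition curve_frac_scale (c : K) (z : curve_frac) : curve_frac :=
  curve_to_frac (to_pquot f c%:A) * z.

Fact curve_frac_scaleA a b z :
  curve_frac_scale a (curve_frac_scale b z) = curve_frac_scale (a * b) z.
Proof. by rewrite /curve_frac_scale mulrA -[in RHS]/(scalar _) scalarM. Qed.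
Fact curve_frac_scale1 : left_id 1 curve_frac_scale.
Proof. by move=> z; rewrite /curve_frac_scale -/(scalar _) scalar1 mul1r. Qed.
Fact curve_frac_scaleDr : right_distributive curve_frac_scale +%R.
Proof. by move=> c z w; rewrite /curve_frac_scale mulrDr. Qed.
Fact curve_frac_scaleDl z : {morph curve_frac_scale^~ z : a b / a + b}.
Proof.
by move=> a b; rewrite /curve_frac_scale -!/(scalar _) scalarD mulrDl.
Qed.

HB.instance Definition _ := GRing.Zmodule_isLmodule.Build K curve_frac
  curve_frac_scaleA curve_frac_scale1 curve_frac_scaleDr curve_frac_scaleDl.

(* The integral closure of R in Q(R).  The library's [integralOver] requires
   nonzero rings, whereas R = 0 when f is a unit. *)
Definition normalization : set curve_frac :=
  [set z | exists n (c : 'I_n -> curve_ring),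
     z ^+ n + \sum_(i < n) curve_to_frac (c i) * z ^+ i = 0].

Definition delta : \bar int :=
  quotient_dim normalization (range curve_to_frac).

End CurveFractionRing.

Section Invariants.
Variable K : fieldType.
Implicit Types f g : fps2 K.

Definition num_branches f : nat := size (factors f).

Definition ideal2 f g : set (fps2 K) :=
  [set h | exists a b, h = a * f + b * g].

(* The intersection multiplicity i(f,g). *)
Definition imult f g : \bar int := quotient_dim setT (ideal2 f g).

Definition convenient f : bool :=
  (imult f fps2X < +oo)%E && (imult f fps2Y < +oo)%E.

(* [gamma_tilde] of an irreducible f.  An irreducible f that is not convenient
   is a unit times x or a unit times y, so that the second case is the
   convention gamma_tilde(x) = gamma_tilde(y) = 0. *)
Definition gamma_tilde_irr f : \bar int :=
  if convenient f then
    mine (imult f (fps2_dx f) - imult f fps2Y + 1)%E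
         (imult f (fps2_dy f) - imult f fps2X + 1)%E
  else 0%E.

Definition gamma_tilde f : \bar int :=
  let s := factors f in
  (\sum_(i < size s)
     (gamma_tilde_irr s`_i + \sum_(j < size s | j != i) imult s`_i s`_j)
   - (size s)%:Z%:E + 1)%E.

Definition right_equiv f g : Prop :=
  exists Phi : {lrmorphism fps2 K -> fps2 K}, bijective Phi /\ f = Phi g.

(* The minimum of [gamma_tilde g] over all g right equivalent to f.  A nonempty
   subset of Z ∪ {+oo} without minimum is unbounded below, so that the default
   value -oo makes this the infimum in all cases. *)
Definition gamma f : \bar int :=
  xget -oo%E
    [set m | (exists2 g, right_equiv f g & m = gamma_tilde g) /\
             (forall g, right_equiv f g -> (m <= gamma_tilde g)%E)].

(* [n <> 0 mod p]; with p = 0 this says n <> 0.  The value n = oo, excluded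
   here, is irrelevant in [im_good]: if i(g,x) = oo with g irreducible, then g is
   a unit times x and i(g,y) = 1, and symmetrically. *)
Definition neq0_mod (p : nat) (n : \bar int) : Prop :=
  exists2 m : nat, n = m%:Z%:E & ~~ (p %| m)%N.

Definition im_good (p : nat) f : Prop :=
  forall g, g \in factors f ->
    neq0_mod p (imult g fps2X) \/ neq0_mod p (imult g fps2Y).

Definition right_im_good (p : nat) f : Prop :=
  exists2 g, right_equiv f g & im_good p g.

End Invariants.

Definition has_characteristic (K : fieldType) (p : nat) : Prop :=
  (p = 0%N /\ [pchar K] =i pred0) \/ p \in [pchar K].

(* Main.v *)
Require Import Defs.
From HB Require Import structures.
From mathcomp Require Import all_boot all_order all_algebra ring zify.
From mathcomp Require Import boolp classical_sets constructive_ereal.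

Set Implicit Arguments.
Unset Strict Implicit.
Unset Printing Implicit Defensive.

Import Order.TTheory GRing.Theory Num.Theory.
Local Open Scope ring_scope.
Local Open Scope classical_set_scope.

(* A branch f is parametrized by x(t), y(t), and f_y / x'(t) = - f_x / y'(t) has
   order 2 delta(f).  Hence i(f, f_y) - i(f, x) + 1 is 2 delta(f) plus the excess
   of ord x'(t) over ord x(t) - 1, which is nonnegative and vanishes exactly when
   the characteristic does not divide ord x(t) = i(f, x); the same holds with x
   and y exchanged, so that the minimum defining gamma_tilde(f) is at least
   2 delta(f), with equality iff p is im-good for the branch.  The parametrization
   and the order formula are obtained together by blowing up: f(x, x(y + c)) =
   x^m f1 lowers delta by m(m - 1)/2 and multiplies the quotient above by x^(m-1),
   where ord x(t) = m.  For several branches, both sides grow by the intersection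
   numbers, as delta(fg) = delta(f) + delta(g) + i(f, g).  Finally delta and the
   number of branches are invariant under right equivalence, so that the bound on
   gamma_tilde passes to the minimum gamma. *)

(** * Dimensions of quotients *)

(** In characteristic p there are no Puiseux series, and x'(t) may vanish identically, so that
    neither an explicit parametrization nor the quotient f_y / x'(t) can be taken for granted.
    [is_param] therefore bundles properties of a branch that a blow up transports: a map to K[[t]]
    with kernel (f), the codimension d of its image, a nonzero conductor, and a series of order 2d
    that stands for the quotient. The conductor puts K[[t]] into the fraction field; with the finite
    codimension this makes K[[t]] the normalization, so that d is delta. As K[[t]] is a domain, the
    kernel condition also shows that irreducible elements are prime, and unique factorization need
    not be presupposed. The multiplicity does not always drop under a blow up, but it cannot stay
    constant forever when it exceeds 1, and this is what makes the resolution end. For unions of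
    branches the derivative condition is dropped: what remains is stable under every automorphism,
    which makes delta a right invariant although [gamma_tilde] depends on the coordinates. *)

Section Subspaces.
Variables (K : fieldType) (V : lmodType K).

Definition subspace (W : set V) : Prop :=
  W 0 /\ forall c u v, W u -> W v -> W (c *: u + v).

Definition dimq (U W : set V) (n : nat) : Prop :=
  exists b : 'I_n -> V, basis_mod U W b.

Definition indep_mod (W : set V) n (b : 'I_n -> V) : Prop :=
  forall c : 'rV[K]_n, W (\sum_i c 0 i *: b i) -> c = 0.

Lemma subspaceT : subspace setT.
Proof. by []. Qed.

Section Closure.
Variable W : set V.
Hypothesis sW : subspace W.

Lemma subspaceD u v : W u -> W v -> W (u + v).
Proof. by move=> Wu Wv; rewrite -[u]scale1r; apply: sW.2. Qed.

Lemma subspaceZ c u : W u -> W (c *: u).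
Proof. by move=> Wu; rewrite -[_ *: _]addr0; apply: sW.2 => //; apply: sW.1. Qed.

Lemma subspaceN u : W u -> W (- u).
Proof. by move=> Wu; rewrite -scaleN1r; apply: subspaceZ. Qed.

Lemma subspaceB u v : W u -> W v -> W (u - v).
Proof. by move=> Wu Wv; apply/subspaceD => //; apply: subspaceN. Qed.

Lemma subspace_sum (I : finType) (F : I -> V) :
  (forall i, W (F i)) -> W (\sum_i F i).
Proof.
by move=> WF; apply: big_ind => //; [apply: sW.1 | apply: subspaceD].
Qed.

Lemma subspace_lin n (c : 'rV[K]_n) (b : 'I_n -> V) :
  (forall i, W (b i)) -> W (\sum_i c 0 i *: b i).
Proof. by move=> Wb; apply: subspace_sum => i; apply: subspaceZ. Qed.

Lemma subspaceBC u v : W (u - v) -> W (v - u).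
Proof. by move=> /subspaceN; rewrite opprB. Qed.

Lemma subspaceB_trans v u w : W (u - v) -> W (v - w) -> W (u - w).
Proof. by move=> Wuv /(subspaceD Wuv); rewrite addrA subrK. Qed.

End Closure.

Lemma lincombB n (c d : 'rV[K]_n) (b : 'I_n -> V) :
  \sum_i (c - d) 0 i *: b i = \sum_i c 0 i *: b i - \sum_i d 0 i *: b i.
Proof. by rewrite -sumrB; apply: eq_bigr => i _; rewrite !mxE scalerBl. Qed.

Lemma lincomb_mulmx n k (c : 'rV[K]_n) (M : 'M[K]_(n, k)) (b : 'I_k -> V) :
  \sum_j (c *m M) 0 j *: b j = \sum_i c 0 i *: \sum_j M i j *: b j.
Proof.
under [RHS]eq_bigr do rewrite scaler_sumr.
rewrite exchange_big; apply: eq_bigr => j _; rewrite mxE scaler_suml.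
by apply: eq_bigr => i _; rewrite scalerA.
Qed.

Lemma lincomb_row_mx n k (c : 'rV[K]_n) (d : 'rV[K]_k) (b : 'I_n -> V)
    (b' : 'I_k -> V) :
  \sum_i (row_mx c d) 0 i *:
    (match split i with inl j => b j | inr j => b' j end) =
  \sum_i c 0 i *: b i + \sum_i d 0 i *: b' i.
Proof.
rewrite big_split_ord; congr (_ + _); apply: eq_bigr => i _.
  by rewrite row_mxEl (unsplitK (inl i)).
by rewrite row_mxEr (unsplitK (inr i)).
Qed.

Lemma basis_modP (U W : set V) n (b : 'I_n -> V) :
    subspace U -> subspace W ->
  basis_mod U W b <->
  [/\ forall i, U (b i), indep_mod W b &
      forall v, U v -> exists c : 'rV[K]_n, W (v - \sum_i c 0 i *: b i)].
Proof.
move=> sU sW; split=> [[Ub ex1]|[Ub ind span]].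
  split=> // [c Wc|v /ex1[c [Wc _]]]; last by exists c.
  have [d [_ d1]] := ex1 0 sU.1.
  have <- : d = c by apply: d1; rewrite sub0r; apply: subspaceN.
  apply: d1; rewrite sub0r; apply: subspaceN => //.
  by rewrite big1 => [|i _]; [apply: sW.1 | rewrite mxE scale0r].
split=> // v /span[c Wc]; exists c; split=> // d Wd.
apply/eqP; rewrite -subr_eq0; apply/eqP/ind; rewrite lincombB.
by apply: (subspaceB_trans sW _ Wd); apply: subspaceBC.
Qed.

(** The coordinates of the [b i] modulo W in a basis of U/W form a k by n matrix; for k > n its left
    kernel contains a nonzero row, which is a linear relation among the [b i] modulo W. *)
Lemma indep_mod_le (U W : set V) n k (b : 'I_k -> V) :
    subspace U -> subspace W -> dimq U W n ->
  (forall i, U (b i)) -> indep_mod W b -> (k <= n)%N.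
Proof.
move=> sU sW [e /(basis_modP _ sU sW)[Ue _ span]] Ub ind.
have /choice[M WM] i := span _ (Ub i).
set A := \matrix_i M i; have [lekn|ltnk] := leqP k n => //.
have /rowV0Pn[c /sub_kermxP cA] : kermx A != 0.
  rewrite kermx_eq0 -row_leq_rank -ltnNge.
  exact: leq_ltn_trans (rank_leq_col A) ltnk.
case/negP; apply/eqP/ind.
have := lincomb_mulmx c A e; rewrite cA.
rewrite big1 => [E0|j _]; last by rewrite mxE scale0r.
rewrite -[X in W X]subr0 [X in _ - X]E0 -sumrB; apply: subspace_sum => // i.
rewrite -scalerBr; apply: subspaceZ => //.
by under eq_bigr do rewrite mxE.
Qed.

Lemma dimq_uniq (U W : set V) n k :
  subspace U -> subspace W -> dimq U W n -> dimq U W k -> n = k.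
Proof.
move=> sU sW dn dk; apply/eqP; rewrite eqn_leq; apply/andP; split.
  have [b /(basis_modP _ sU sW)[Ub ind _]] := dn; exact: (indep_mod_le sU sW dk Ub).
have [b /(basis_modP _ sU sW)[Ub ind _]] := dk; exact: (indep_mod_le sU sW dn Ub).
Qed.

Lemma dimq_trans (U W Z : set V) n k :
    subspace U -> subspace W -> subspace Z ->
    (forall v, W v -> U v) -> (forall v, Z v -> W v) ->
  dimq U W n -> dimq W Z k -> dimq U Z (n + k).
Proof.
move=> sU sW sZ WU ZW [b /(basis_modP _ sU sW)[Ub indb spanb]].
move=> [b' /(basis_modP _ sW sZ)[Wb' indb' spanb']].
exists (fun i => match split i with inl j => b j | inr j => b' j end).
apply/(basis_modP _ sU sZ); split=> [i|c|v Uv].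
- by case: split => j; [apply: Ub | apply/WU/Wb'].
- rewrite -[c]hsubmxK lincomb_row_mx => Zc.
  have l0 : lsubmx c = 0.
    by apply: indb; move/ZW: Zc => /(subspaceB sW)/(_ (subspace_lin sW (rsubmx c) Wb')); rewrite addrK.
  rewrite l0; move: Zc; rewrite l0 big1 ?add0r => [|i _]; last by rewrite mxE scale0r.
  by move/indb' => ->; rewrite row_mx0.
- have [c Wc] := spanb v Uv; have [d Zd] := spanb' _ Wc.
  by exists (row_mx c d); rewrite lincomb_row_mx opprD addrA.
Qed.

(** The basis of W/Z is an independent family of maximal size, which exists because n bounds these
    sizes; a vector outside its span would enlarge it. *)
Lemma dimq_sub (U W Z : set V) n :
    subspace U -> subspace W -> subspace Z ->
    (forall v, W v -> U v) -> (forall v, Z v -> W v) ->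
  dimq U Z n -> exists k, dimq W Z k.
Proof.
move=> sU sW sZ WU ZW dn.
pose P k := `[< exists b : 'I_k -> V, (forall i, W (b i)) /\ indep_mod Z b >].
have P0 : exists k, P k.
  exists 0%N; apply/asboolP; exists (fun _ => 0); split=> [[]//|c _].
  by apply/rowP => -[].
have Pn k : P k -> (k <= n)%N.
  move=> /asboolP[b [Wb ind]].
  by apply: (indep_mod_le sU sZ dn _ ind) => i; apply: WU.
case: (ex_maxnP P0 Pn) => k /asboolP[b [Wb ind]] kmax.
exists k, b; apply/(basis_modP _ sW sZ); split=> // v Wv.
apply: contrapT => nex.
suff /kmax : P (k + 1)%N by rewrite addn1 ltnn.
apply/asboolP; exists (fun i => match split i with inl j => b j | inr j => v end).
split=> [i|c]; first by case: split.
rewrite -[c]hsubmxK lincomb_row_mx big_ord_recl big_ord0 addr0.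
set d := lsubmx c; set e := rsubmx c => Zc.
have e0 : e 0 0 = 0.
  apply/eqP/negPn/negP => e0; case: nex; exists (- (e 0 0)^-1 *: d).
  under eq_bigr do rewrite mxE -scalerA; rewrite -scaler_sumr.
  rewrite scaleNr opprK addrC -[v in _ + v]scale1r -(mulVf e0) -scalerA -scalerDr.
  exact: subspaceZ.
have -> : e = 0 by apply/rowP => i; rewrite ord1 e0 mxE.
move: Zc; rewrite e0 scale0r addr0 => /ind->.
by rewrite row_mx0.
Qed.

(** Vectors of U dual to the coordinates L form the basis. Dimensions that are counts of monomials
    are obtained in this way. *)
Lemma dimq_map (U W : set V) (I : finType) (L : V -> I -> K) :
    subspace U -> subspace W ->
    (forall c u v, U u -> U v -> L (c *: u + v) =1 fun i => c * L u i + L v i) ->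
    (forall v, U v -> W v <-> L v =1 fun=> 0) ->
    (forall a : I -> K, exists2 v, U v & L v =1 a) ->
  dimq U W #|I|.
Proof.
move=> sU sW linL kerL surjL.
have LB u v : U u -> U v -> L (u - v) =1 fun i => L u i - L v i.
  by move=> Uu Uv i; rewrite addrC -scaleN1r linL // mulN1r addrC.
have exb (j : 'I_#|I|) : exists v, U v /\ L v =1 fun i => (i == enum_val j)%:R.
  by case: (surjL (fun i => (i == enum_val j)%:R)) => v Uv Lv; exists v.
have [b bP] := choice exb; have Ub i := (bP i).1.
have Lsum (c : 'rV_#|I|) i : L (\sum_j c 0 j *: b j) i = c 0 (enum_rank i).
  have L0 k : L 0 k = 0.
    by have /(_ k)-> := (kerL 0 sU.1).1 sW.1.
  have E (r : seq 'I_#|I|) : U (\sum_(j <- r) c 0 j *: b j) /\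
      L (\sum_(j <- r) c 0 j *: b j) i =
      \sum_(j <- r) c 0 j * (i == enum_val j)%:R.
    elim: r => [|j r [IH1 IH2]]; first by rewrite !big_nil; split; [exact: sU.1|].
    rewrite !big_cons; split; first by apply: sU.2.
    by rewrite linL // IH2 (bP j).2.
  rewrite (E _).2 (bigD1 (enum_rank i)) //= enum_rankK eqxx mulr1 big1 ?addr0 //.
  move=> j; case: (i =P enum_val j) => [->|_ _]; last by rewrite mulr0.
  by rewrite enum_valK eqxx.
exists b; apply/(basis_modP _ sU sW); split=> // [c /kerL|v Uv].
  move=> /(_ (subspace_lin sU c Ub)) c0; apply/rowP => j.
  by rewrite mxE -[j]enum_valK -Lsum.
exists (\row_j L v (enum_val j)); apply/kerL => [|i].
  by apply: subspaceB => //; apply: subspace_lin.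
by rewrite LB ?Lsum ?mxE ?enum_rankK ?subrr //; apply: subspace_lin.
Qed.

Lemma quotient_dimE (U W : set V) n :
  subspace U -> subspace W -> dimq U W n -> quotient_dim U W = n%:Z%:E.
Proof.
move=> sU sW dn; apply: xget_unique => [|x [k dk <-]].
  by exists n.
by rewrite (dimq_uniq sU sW dn dk).
Qed.

Lemma quotient_dimPn (U W : set V) :
  (forall n, ~ dimq U W n) -> quotient_dim U W = +oo%E.
Proof.
by move=> nd; apply: xgetPN => x [k /nd].
Qed.

End Subspaces.
Arguments subspaceT {K V}.

(** The linear correspondence [rho] need not be a map in either direction, so that it can be a
    morphism, its inverse relation, or the relation between a fraction and its values along the
    branches. *)
Lemma dimq_rel (K : fieldType) (V V' : lmodType K) (U W : set V)
    (U' W' : set V') (rho : V -> V' -> Prop) n :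
    subspace U -> subspace W -> subspace U' -> subspace W' ->
    rho 0 0 ->
    (forall c u u' v v', rho u u' -> rho v v' -> rho (c *: u + v) (c *: u' + v')) ->
    (forall u, U u -> exists2 u', U' u' & rho u u') ->
    (forall u', U' u' -> exists2 u, U u & rho u u') ->
    (forall u u', rho u u' -> W u <-> W' u') ->
  dimq U W n -> dimq U' W' n.
Proof.
move=> sU sW sU' sW' rho0 rhoL totl totr rhoW [b /(basis_modP _ sU sW)[Ub ind span]].
have exb' i : exists u', U' u' /\ rho (b i) u'.
  by case: (totl _ (Ub i)) => u'; exists u'.
have [b' b'P] := choice exb'.
have rho_lin (c : 'rV_n) : rho (\sum_i c 0 i *: b i) (\sum_i c 0 i *: b' i).
  apply: (big_ind2 (fun u u' => rho u u')) => // [u u' v v' uu' vv'|i _].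
    by rewrite -[u]scale1r -[u']scale1r; apply: rhoL.
  by rewrite -[_ *: b i]addr0 -[_ *: b' i]addr0; apply: rhoL => //; case: (b'P i).
exists b'; apply/(basis_modP _ sU' sW'); split=> [i|c|v' /totr[v Uv vv']].
- by case: (b'P i).
- by move/(rhoW _ _ (rho_lin c)).2/ind.
- have [c Wc] := span v Uv; exists c; apply/(rhoW (v - \sum_i c 0 i *: b i)) => //.
  rewrite addrC -scaleN1r [X in rho _ X]addrC -[in X in rho _ X]scaleN1r.
  exact: rhoL.
Qed.

(** * Power series in two variables *)

(** The coefficients may lie in any ring: this covers the order in t, the order of f(0, y) and, with
    polynomials as coefficients, the multiplicity of f. *)
Definition lead (D : nzRingType) (a : nat -> D) (n : nat) : Prop :=
  (forall k, (k < n)%N -> a k = 0) /\ a n != 0.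

Lemma lead_exists (D : nzRingType) (a : nat -> D) k :
  a k != 0 -> exists2 n, lead a n & (n <= k)%N.
Proof.
move=> ak; have ex : exists n, a n != 0 by exists k.
case: (ex_minnP ex) => n an min; exists n; last exact: min.
by split=> // j; apply: contraTeq => /min; rewrite leqNgt.
Qed.

Lemma lead_uniq (D : nzRingType) (a : nat -> D) n k : lead a n -> lead a k -> n = k.
Proof.
move=> [an0 an] [ak0 ak]; case: (ltngtP n k) => // [/ak0|/an0] E.
  by rewrite E eqxx in an.
by rewrite E eqxx in ak.
Qed.

Lemma lead_conv (D : idomainType) (a b : nat -> D) n k :
    lead a n -> lead b k ->
  lead (fun m => \sum_(i < m.+1) a i * b (m - i)%N) (n + k).
Proof.
move=> [an0 an] [bk0 bk]; split=> [m ltm|].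
  rewrite big1 // => i _; have [/an0->|lei] := ltnP i n; first by rewrite mul0r.
  by rewrite bk0 ?mulr0 //; have := ltn_ord i; lia.
have ltn : (n < (n + k).+1)%N by rewrite ltnS leq_addr.
rewrite (bigD1 (Ordinal ltn)) //= addKn big1 ?addr0 ?mulf_neq0 // => i ni.
have [/an0->|lei] := ltnP i n; first by rewrite mul0r.
rewrite bk0 ?mulr0 //; have := ltn_ord i; have : i != n :> nat by []; lia.
Qed.

Section Monomials.
Variable K : comNzRingType.
Implicit Types f g h : fps2 K.

Lemma coef2M f g m n : coef2 (f * g) m n =
  \sum_(i < m.+1) \sum_(j < n.+1) coef2 f i j * coef2 g (m - i) (n - j).
Proof. by []. Qed.
Lemma coef2D f g m n : coef2 (f + g) m n = coef2 f m n + coef2 g m n.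
Proof. by []. Qed.
Lemma coef2N f m n : coef2 (- f) m n = - coef2 f m n.
Proof. by []. Qed.
Lemma coef2B f g m n : coef2 (f - g) m n = coef2 f m n - coef2 g m n.
Proof. by []. Qed.
Lemma coef2Z c f m n : coef2 (c *: f) m n = c * coef2 f m n.
Proof. by []. Qed.
Lemma coef21 m n : coef2 (1 : fps2 K) m n = ((m == 0%N) && (n == 0%N))%:R.
Proof. by []. Qed.

Definition mono2 a b : fps2 K := Fps2 (fun i j => ((i == a) && (j == b))%:R).

Lemma coef2_mono2M a b h i j : coef2 (mono2 a b * h) i j =
  if (a <= i)%N && (b <= j)%N then coef2 h (i - a) (j - b) else 0.
Proof.
rewrite coef2M /=; case: (leqP a i) => [lea|lta] /=; last first.
  rewrite big1 // => k _; rewrite big1 // => l _.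
  by rewrite (_ : _ == a = false) ?mul0r //; have := ltn_ord k; lia.
have lai : (a < i.+1)%N by [].
rewrite (bigD1 (Ordinal lai)) //= [X in _ + X]big1 => [|k nk]; last first.
  by rewrite big1 // => l _; rewrite (_ : _ == a = false) ?mul0r //; apply: negPf.
rewrite addr0 eqxx /=; case: (leqP b j) => [leb|ltb]; last first.
  rewrite big1 // => l _.
  by rewrite (_ : _ == b = false) ?mul0r //; have := ltn_ord l; lia.
have lbj : (b < j.+1)%N by [].
rewrite (bigD1 (Ordinal lbj)) //= eqxx mul1r big1 ?addr0 // => l nl.
by rewrite (_ : _ == b = false) ?mul0r //; apply: negPf.
Qed.

Lemma mono2X a : mono2 a 0 = fps2X ^+ a.
Proof.
elim: a => [|a IH]; first exact: fps2P.
rewrite exprS -IH; apply: fps2P => i j; rewrite -[fps2X]/(mono2 1 0) coef2_mono2M.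
by rewrite /= subn0 andbT; case: i => [|i] //=; rewrite subSS subn0.
Qed.

Lemma mono2Y b : mono2 0 b = fps2Y ^+ b.
Proof.
elim: b => [|b IH]; first exact: fps2P.
rewrite exprS -IH; apply: fps2P => i j; rewrite -[fps2Y]/(mono2 0 1) coef2_mono2M.
by rewrite /= subn0; case: j => [|j] //=; rewrite ?andbF ?subSS ?subn0.
Qed.

Lemma coef2_XnM a h i j : coef2 (fps2X ^+ a * h) i j =
  if (a <= i)%N then coef2 h (i - a) j else 0.
Proof. by rewrite -mono2X coef2_mono2M andbT subn0. Qed.

Lemma coef2_YnM b h i j : coef2 (fps2Y ^+ b * h) i j =
  if (b <= j)%N then coef2 h i (j - b) else 0.
Proof. by rewrite -mono2Y coef2_mono2M subn0. Qed.

Lemma coef2_XM h i j : coef2 (fps2X * h) i j =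
  if i is i'.+1 then coef2 h i' j else 0.
Proof.
by rewrite -[fps2X]expr1 coef2_XnM; case: i => // i; rewrite subSS subn0.
Qed.

Lemma coef2_YM h i j : coef2 (fps2Y * h) i j =
  if j is j'.+1 then coef2 h i j' else 0.
Proof.
by rewrite -[fps2Y]expr1 coef2_YnM; case: j => // j; rewrite subSS subn0.
Qed.

Lemma coef2_alg c i j : coef2 (c%:A : fps2 K) i j = c *+ ((i == 0%N) && (j == 0%N)).
Proof. by rewrite coef2Z coef21 mulr_natr. Qed.

Lemma coef2M_00 f g : coef2 (f * g) 0 0 = coef2 f 0 0 * coef2 g 0 0.
Proof. by rewrite coef2M !big_ord1. Qed.

End Monomials.

(** * Fixed points of contractions, and units *)

Section Contraction.
Variables (K : comNzRingType) (w : nat -> nat -> nat).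
Implicit Types f g h : fps2 K.

(** The weight [w] selects the adic topology: total degree for inverses, degree in x for Weierstrass
    division. *)
Definition agree n f g : Prop :=
  forall i j, (w i j < n)%N -> coef2 f i j = coef2 g i j.

(** Any two series agree to order 0, so the n-th iterate of T at 0 is final below weight n; each
    coefficient of the limit is read off from the first iterate where it is final. *)
Lemma contraction_fixpoint (T : fps2 K -> fps2 K) :
    (forall n f g, agree n f g -> agree n.+1 (T f) (T g)) ->
  exists f, T f = f.
Proof.
move=> Tc; pose f := Fps2 (fun i j => coef2 (iter (w i j).+1 T 0) i j).
have Tit n k : agree n (iter n T 0) (iter (n + k) T 0).
  by elim: n => [|n IH] //; rewrite addSn !iterS; apply: Tc.
have fit n : agree n f (iter n T 0).
  by move=> i j wn /=; rewrite -iterS -(subnKC wn); apply: (Tit (w i j).+1).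
exists f; apply: fps2P => i j.
by rewrite (Tc _ _ _ (fit (w i j))).
Qed.

Lemma contraction_uniq (T : fps2 K -> fps2 K) f g :
    (forall n f g, agree n f g -> agree n.+1 (T f) (T g)) ->
  T f = f -> T g = g -> f = g.
Proof.
move=> Tc fE gE; have E n : agree n f g.
  by elim: n => [|n IH] //; rewrite -fE -gE; apply: Tc.
by apply: fps2P => i j; apply: (E (w i j).+1).
Qed.

End Contraction.

Section Units.
Variable K : fieldType.
Implicit Types f g h : fps2 K.

Lemma fps2_unitE f : (f \is a GRing.unit) = (coef2 f 0 0 != 0).
Proof.
apply/idP/idP => [uf|f0].
  apply/negP => /eqP f0; have := divrr uf => /(congr1 (fun g => coef2 g 0 0)).
  by rewrite coef2M_00 f0 mul0r coef21 => /esym/eqP; rewrite oner_eq0.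
set c := coef2 f 0 0 in f0.
(* The equation f g = 1 solved for g: as f - c has no constant term, multiplying by it gains one
   total degree. *)
pose T g := c^-1 *: (1 - (f - c%:A) * g).
have [|g gE] := @contraction_fixpoint K (fun i j => i + j)%N T.
  move=> n g h gh i j; rewrite ltnS => ijn; rewrite !coef2Z !coef2B; congr (_ * (_ - _)).
  rewrite !coef2M; apply: eq_bigr => a _; apply: eq_bigr => b _.
  have [/eqP|ab0] := eqVneq (a + b)%N 0%N.
    rewrite addn_eq0 => /andP[/eqP-> /eqP->].
    by rewrite coef2B coef2_alg /= subrr !mul0r.
  by rewrite gh //; have := ltn_ord a; have := ltn_ord b; lia.
apply/unitrP; exists g; suff gf : g * f = 1 by split=> //; rewrite mulrC.
have : c *: g = 1 - (f - c%:A) * g by rewrite -{1}gE scalerA divff ?scale1r.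
rewrite mulrBl mulr_algl opprB addrCA -[LHS]addr0 => /addrI/esym/subr0_eq.
by rewrite mulrC.
Qed.

End Units.

(** * Weierstrass division *)

Section Weierstrass.
Variable K : fieldType.
Implicit Types f g h q r u : fps2 K.

(** Weierstrass regularity in y: the order m of f(0, y) is also i(f, x), by [dimq_ideal2_X]. *)
Definition regular (m : nat) f : Prop := lead (coef2 f 0) m.

Definition ydeg_lt (m : nat) r : Prop :=
  forall i j, (m <= j)%N -> coef2 r i j = 0.

Lemma regularM f g m n : regular m f -> regular n g -> regular (m + n) (f * g).
Proof.
move=> rf rg; rewrite /regular.
have -> // : coef2 (f * g) 0 = fun k => \sum_(i < k.+1) coef2 f 0 i * coef2 g 0 (k - i).
  by apply/funext => k; rewrite coef2M big_ord1.
exact: lead_conv.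
Qed.

Lemma regular0_unit f : regular 0 f <-> f \is a GRing.unit.
Proof. by rewrite fps2_unitE; split=> [[_ f0]|f0] //; split. Qed.

Lemma regularM_inv f g m : regular m (f * g) ->
  exists a b, [/\ (a + b = m)%N, regular a f & regular b g].
Proof.
move=> rfg.
have row0 h k : (coef2 (f * g) 0 k != 0) -> (forall j, coef2 h 0 j = 0) -> h = f \/ h = g -> False.
  move=> /eqP nz h0 [E|E]; apply: nz; rewrite coef2M big_ord1 big1 // => j _.
    by rewrite -E h0 mul0r.
  by rewrite -E h0 mulr0.
have [k fk] : exists k, coef2 f 0 k != 0.
  apply: contrapT => nex; apply: (row0 f m rfg.2) => [j|]; last by left.
  by apply/eqP; apply: contrapT => /negP fj; apply: nex; exists j.
have [l gl] : exists k, coef2 g 0 k != 0.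
  apply: contrapT => nex; apply: (row0 g m rfg.2) => [j|]; last by right.
  by apply/eqP; apply: contrapT => /negP fj; apply: nex; exists j.
have [a ra _] := lead_exists fk; have [b rb _] := lead_exists gl.
exists a, b; split=> //; exact: lead_uniq (regularM ra rb) rfg.
Qed.

Definition yhi (m : nat) h : fps2 K := Fps2 (fun i j => coef2 h i (j + m)).
Definition ylo (m : nat) h : fps2 K :=
  Fps2 (fun i j => if (j < m)%N then coef2 h i j else 0).

Lemma coef2_yhi m h i j : coef2 (yhi m h) i j = coef2 h i (j + m).
Proof. by []. Qed.
Lemma coef2_ylo m h i j : coef2 (ylo m h) i j = if (j < m)%N then coef2 h i j else 0.
Proof. by []. Qed.

Lemma ylohi m h : h = ylo m h + fps2Y ^+ m * yhi m h.
Proof.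
apply: fps2P => i j; rewrite coef2D coef2_YnM coef2_ylo coef2_yhi.
by case: leqP => [le|lt]; rewrite ?subnK ?add0r ?addr0.
Qed.

Lemma yhi_YnM m h : yhi m (fps2Y ^+ m * h) = h.
Proof. by apply: fps2P => i j; rewrite coef2_yhi coef2_YnM leq_addl addnK. Qed.

Lemma yhiB m g h : yhi m (g - h) = yhi m g - yhi m h.
Proof. exact: fps2P. Qed.

Lemma yhi_eq0 m h : yhi m h = 0 <-> ydeg_lt m h.
Proof.
split=> [h0 i j le|h0]; last by apply: fps2P => i j /=; rewrite h0 ?leq_addl.
by rewrite -(subnK le) -[LHS]/(coef2 (yhi m h) i (j - m)) h0.
Qed.

(** A series v that vanishes at x = 0 is divisible by x, so that multiplying by it gains one degree
    in x. *)
Lemma yhi_contraction m v g n f h : (forall j, coef2 v 0 j = 0) ->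
    agree (fun i _ => i) n f h ->
  agree (fun i _ => i) n.+1 (yhi m (g - v * f)) (yhi m (g - v * h)).
Proof.
move=> v0 fh i j lti; rewrite !yhiB !coef2B; congr (_ - _).
rewrite !coef2_yhi !coef2M; apply: eq_bigr => a _; apply: eq_bigr => b _.
case: a => -[|a] lta /=; first by rewrite v0 !mul0r.
by rewrite fh //; lia.
Qed.

(** Write f = l + y^m u with u a unit and l divisible by x. Then q is a quotient of g exactly if Q =
    q u satisfies Q = [yhi m (g - u^-1 * l * Q)], whose right side is a contraction for the degree
    in x. *)
Lemma Weierstrass_division m f g : regular m f ->
  exists q r, ydeg_lt m r /\ g = q * f + r.
Proof.
move=> [f0 fm]; set u := yhi m f; set l := ylo m f.
have uu : u \is a GRing.unit by rewrite fps2_unitE.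
have ul0 j : coef2 (u^-1 * l) 0 j = 0.
  rewrite coef2M big_ord1 big1 // => b _; rewrite coef2_ylo subn0.
  by case: ltnP => [/f0->|_]; rewrite mulr0.
have [Q QE] := contraction_fixpoint (fun n _ _ => @yhi_contraction m _ g n _ _ ul0).
exists (Q * u^-1), (g - Q * u^-1 * f); split; last by rewrite addrC subrK.
apply/yhi_eq0; rewrite {1}(ylohi m f) -/u -/l.
have -> : Q * u^-1 * (l + fps2Y ^+ m * u) = u^-1 * l * Q + fps2Y ^+ m * (Q * (u^-1 * u)).
  by ring.
by rewrite mulVr // mulr1 opprD addrA yhiB yhi_YnM QE subrr.
Qed.

(** Both [q * u] and 0 are fixed points of the contraction used for existence, taken with g = 0. *)
Lemma Weierstrass_uniq0 m f q r : regular m f -> ydeg_lt m r -> q * f + r = 0 ->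
  q = 0 /\ r = 0.
Proof.
move=> [f0 fm] rm E; set u := yhi m f; set l := ylo m f.
have uu : u \is a GRing.unit by rewrite fps2_unitE.
have ul0 j : coef2 (u^-1 * l) 0 j = 0.
  rewrite coef2M big_ord1 big1 // => b _; rewrite coef2_ylo subn0.
  by case: ltnP => [/f0->|_]; rewrite mulr0.
suff qu : q * u = 0.
  have q0 : q = 0 by rewrite -[q](mulrK uu) qu mul0r.
  by split=> //; move: E; rewrite q0 mul0r add0r.
apply: (contraction_uniq (fun n _ _ => @yhi_contraction m _ 0 n _ _ ul0)); last first.
  by rewrite mulr0 subr0; apply/yhi_eq0.
have -> : u^-1 * l * (q * u) = q * l * (u^-1 * u) by ring.
rewrite mulVr // mulr1.
have -> : 0 - q * l = fps2Y ^+ m * (q * u) - (q * f + r) + r.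
  by rewrite [in RHS](ylohi m f) -/u -/l; ring.
rewrite E subr0 -[r]opprK yhiB yhi_YnM (_ : yhi m (- r) = 0) ?subr0 //.
by apply/yhi_eq0 => i j le; rewrite coef2N rm // oppr0.
Qed.

Lemma Weierstrass_uniq m f q r q' r' :
    regular m f -> ydeg_lt m r -> ydeg_lt m r' -> q * f + r = q' * f + r' ->
  q = q' /\ r = r'.
Proof.
move=> rf rm rm' E.
have [] := @Weierstrass_uniq0 m f (q - q') (r - r') rf.
- by move=> i j le; rewrite coef2B rm ?rm' ?subrr.
- by rewrite mulrBl addrACA E -opprD subrr.
by move=> /subr0_eq-> /subr0_eq->.
Qed.

Lemma ydeg_dvd_eq0 m f r : regular m f -> ydeg_lt m r ->
  (exists c, r = c * f) -> r = 0.
Proof.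
move=> rf rm [c rE].
have [] := @Weierstrass_uniq m f 0 r c 0 rf => //.
by rewrite mul0r add0r addr0.
Qed.

(** The factor q is the quotient of y^a by g; it is a unit because the coefficient of y^a in q g at
    x = 0 is 1 and equals q(0, 0) times that of g. *)
Lemma Weierstrass_preparation a g : regular a g ->
  exists q, [/\ q \is a GRing.unit, regular a (q * g) & ydeg_lt a.+1 (q * g)].
Proof.
move=> rg; have [q [r [ra E]]] := Weierstrass_division (fps2Y ^+ a) rg.
have qgE : q * g = fps2Y ^+ a - r by rewrite E addrK.
have uq : q \is a GRing.unit.
  rewrite fps2_unitE; apply/negP => /eqP q0.
  have : coef2 (q * g) 0 a = coef2 (fps2Y ^+ a * 1 - r) 0 a by rewrite mulr1 qgE.
  rewrite coef2B ra // subr0 coef2_YnM leqnn subnn coef21 coef2M big_ord1.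
  rewrite big_ord_recl big1 => [/esym/eqP|j _].
    by rewrite subn0 q0 mul0r addr0 oner_eq0.
  by rewrite rg.1 ?mulr0 //= /bump /=; have := ltn_ord j; lia.
exists q; split=> //; first by rewrite -[a]add0n; apply: regularM => //;
  apply/regular0_unit.
move=> i j lt; have -> : q * g = fps2Y ^+ a * 1 - r by rewrite mulr1.
rewrite coef2B coef2_YnM (ra i j (ltnW lt)) subr0 (ltnW lt) coef21.
by rewrite subn_eq0 (leqNgt j) lt andbF.
Qed.

End Weierstrass.

(** * Homogeneous forms and blowing up *)

#[global] Arguments coef2 : simpl never.

Section Forms.
Variable K : fieldType.
Implicit Types f g h : fps2 K.

(* The homogeneous part of degree n of f, dehomogenized by x = 1. *)
Definition form (n : nat) f : {poly K} := \poly_(j < n.+1) coef2 f (n - j) j.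

Lemma coef_form n f j : (form n f)`_j = if (j <= n)%N then coef2 f (n - j) j else 0.
Proof. by rewrite coef_poly ltnS. Qed.

Lemma coef2_form f i j : coef2 f i j = (form (i + j) f)`_j.
Proof. by rewrite coef_form leq_addl addnK. Qed.

Lemma size_form n f : (size (form n f) <= n.+1)%N.
Proof. exact: size_poly. Qed.

Lemma formP f g : (forall n, form n f = form n g) -> f = g.
Proof. by move=> fg; apply: fps2P => i j; rewrite !coef2_form fg. Qed.

Lemma formD n f g : form n (f + g) = form n f + form n g.
Proof.
by apply/polyP => j; rewrite coefD !coef_form; case: leqP; rewrite ?addr0.
Qed.

Lemma formZ n c f : form n (c *: f) = c *: form n f.
Proof.
by apply/polyP => j; rewrite coefZ !coef_form; case: leqP; rewrite ?mulr0.
Qed.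

Lemma form0 n : form n 0 = 0.
Proof. by rewrite -(scale0r 0) formZ scale0r. Qed.

Lemma form1 n : form n 1 = (n == 0%N)%:R.
Proof.
apply/polyP => j; rewrite coef_form coef21 mulrb.
case: n => [|n]; case: j => [|j]; rewrite ?coef1 ?coef0 ?subn0 ?andbF //=.
by rewrite if_same.
Qed.

Lemma formM n f g : form n (f * g) = \sum_(i < n.+1) form i f * form (n - i) g.
Proof.
apply/polyP => j; rewrite coef_form coef_sum.
under eq_bigr do rewrite coefM.
rewrite exchange_big /=; case: leqP => [lejn|ltnj]; last first.
  rewrite big1 // => b _; rewrite big1 // => i _; rewrite !coef_form.
  case: leqP => [lebi|]; rewrite ?mul0r //; case: leqP; rewrite ?mulr0 //.
  by have := ltn_ord b; have := ltn_ord i; lia.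
rewrite coef2M exchange_big; apply: eq_bigr => -[b /=]; rewrite ltnS => lebj _.
pose F i := coef2 f (i - b) b * coef2 g (n - j - (i - b)) (j - b).
(* For fixed b only b <= i <= n - j + b contributes; i - b is then the exponent of x taken from
   f. *)
have -> : \sum_(i < n.+1) (form i f)`_b * (form (n - i) g)`_(j - b) =
    \sum_(i < n.+1 | (b <= i < n - j + b + 1)%N) F i.
  rewrite [RHS]big_mkcond; apply: eq_bigr => i _; rewrite !coef_form /F.
  have lti := ltn_ord i; case: (leqP b i) => lebi; rewrite ?mul0r //=.
  rewrite (_ : (j - b <= n - i)%N = (i < n - j + b + 1)%N); last by lia.
  by case: ifP => lt; rewrite ?mulr0 // (_ : (n - i - (j - b) = n - j - (i - b))%N) //;
    lia.
rewrite -(big_mkord (fun i => (b <= i < n - j + b + 1)%N) F).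
rewrite (@big_cat_nat _ _ _ b) //=; last by lia.
rewrite [X in _ = X + _]big_nat_cond [X in _ = X + _]big1 ?add0r; last by move=> i ?;
  exfalso; lia.
rewrite (@big_cat_nat _ _ _ (n - j + b + 1)) //=; try lia.
rewrite [X in _ = _ + X]big_nat_cond [X in _ = _ + X]big1 ?addr0; last by move=> i ?;
  exfalso; lia.
rewrite big_nat_cond (eq_bigl (fun i => (b <= i < n - j + b + 1)%N && true));
  last by move=> i; lia.
rewrite -big_nat_cond -[X in index_iota X]add0n big_addn (_ : (n - j + b + 1 - b = (n - j).+1)%N); last by lia.
by rewrite big_mkord; apply: eq_bigr => i _; rewrite /F addnK.
Qed.

Definition mult (m : nat) f : Prop := lead (form^~ f) m.

Lemma multM f g m n : mult m f -> mult n g -> mult (m + n) (f * g).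
Proof.
move=> mf mg; rewrite /mult.
have -> : form^~ (f * g) = fun k => \sum_(i < k.+1) form i f * form (k - i) g.
  by apply/funext => k; rewrite formM.
exact: (lead_conv (D := {poly K}) mf mg).
Qed.

Lemma mult_exists f : f != 0 -> exists m, mult m f.
Proof.
move=> f0; apply: contrapT => nm; case/negP: f0; apply/eqP/formP => n.
rewrite form0; apply/eqP; apply: contrapT => /negP fn; apply: nm.
by case: (lead_exists (a := form^~ f) fn) => m mf _; exists m.
Qed.

Lemma mult_neq0 f m : mult m f -> f != 0.
Proof. by move=> [_]; apply: contra => /eqP->; rewrite form0. Qed.

Lemma mult0_unit f : mult 0 f <-> f \is a GRing.unit.
Proof.
have E : (form 0 f == 0) = (coef2 f 0 0 == 0).
  apply/eqP/eqP => [E|f0]; first by rewrite coef2_form E coef0.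
  by apply/polyP => -[|j]; rewrite coef_form coef0.
by rewrite fps2_unitE /mult /lead E; split=> [[]|].
Qed.

Lemma fps2_mul_eq0 f g : f * g = 0 -> f = 0 \/ g = 0.
Proof.
have [->|f0] := eqVneq f 0; first by left.
have [->|g0] := eqVneq g 0; first by right.
have [m mf] := mult_exists f0; have [n mg] := mult_exists g0.
by move/eqP: (mult_neq0 (multM mf mg)) => /[swap].
Qed.

Lemma fps2_mulfI f : f != 0 -> injective ( *%R f).
Proof.
move=> f0 g h E; apply/subr0_eq.
have /fps2_mul_eq0[fE|//] : f * (g - h) = 0 by rewrite mulrBr E subrr.
by rewrite fE eqxx in f0.
Qed.

Lemma mult_le_regular f m a : mult m f -> regular a f -> (m <= a)%N.
Proof.
move=> [fm _] [_ fa]; rewrite leqNgt; apply: contra fa => /fm E.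
by rewrite coef2_form add0n E coef0.
Qed.

End Forms.

Section BlowUp.
Variables (K : fieldType) (c : K).
Implicit Types f g h : fps2 K.

(* The substitution f(x, x(y + c)). *)
Definition blowup f : fps2 K :=
  Fps2 (fun n k => (form n f \Po ('X + c%:P))`_k).

Lemma coef2_blowup f n k : coef2 (blowup f) n k = (form n f \Po ('X + c%:P))`_k.
Proof. by []. Qed.

Fact blowup_is_linear : linear blowup.
Proof.
move=> a f g; apply: fps2P => n k.
by rewrite coef2D coef2Z !coef2_blowup formD formZ comp_polyD comp_polyZ coefD coefZ.
Qed.
HB.instance Definition _ :=
  GRing.isLinear.Build K (fps2 K) (fps2 K) _ blowup blowup_is_linear.

Fact blowup_is_monoid_morphism : monoid_morphism blowup.
Proof.
split=> [|f g]; apply: fps2P => n k.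
  by rewrite coef2_blowup form1 coef21; case: n => [|n];
    rewrite ?comp_polyC ?comp_poly0 ?coef0 // ?coef1.
rewrite coef2_blowup coef2M formM raddf_sum coef_sum; apply: eq_bigr => i _.
by rewrite /= comp_polyM coefM.
Qed.
HB.instance Definition _ :=
  GRing.isMonoidMorphism.Build (fps2 K) (fps2 K) blowup blowup_is_monoid_morphism.

Lemma comp_shiftK (p : {poly K}) : p \Po ('X + c%:P) \Po ('X - c%:P) = p.
Proof. by rewrite -comp_polyA comp_polyD comp_polyX comp_polyC subrK comp_polyXr. Qed.

Lemma comp_shiftK' (p : {poly K}) : p \Po ('X - c%:P) \Po ('X + c%:P) = p.
Proof. by rewrite -comp_polyA comp_polyB comp_polyX comp_polyC addrK comp_polyXr. Qed.

Lemma size_shift (p : {poly K}) : size (p \Po ('X + c%:P)) = size p.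
Proof. by rewrite size_comp_poly2 // size_XaddC. Qed.

Lemma size_shift' (p : {poly K}) : size (p \Po ('X - c%:P)) = size p.
Proof. by rewrite size_comp_poly2 // size_XsubC. Qed.

Lemma blowup_eq0 f : blowup f = 0 -> f = 0.
Proof.
move=> f0; apply/formP => n.
have E : form n f \Po ('X + c%:P) = 0.
  by apply/polyP => k; rewrite -coef2_blowup f0 coef0.
by rewrite form0 -[LHS]comp_shiftK E comp_poly0.
Qed.

(** The coefficient of x^n in f(x, x(y + c)) is the form of degree n shifted by c. The shift is
    bijective on polynomials of degree at most n, so this degree bound is the only constraint. *)
Lemma blowup_image h :
  (exists g, h = blowup g) <-> forall n j, (n < j)%N -> coef2 h n j = 0.
Proof.
split=> [[g ->] n j ltnj|h0].
  by rewrite coef2_blowup nth_default // size_shift (leq_trans (size_form _ _)).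
pose p n := \poly_(k < n.+1) coef2 h n k.
exists (Fps2 (fun i j => (p (i + j)%N \Po ('X - c%:P))`_j)).
apply: fps2P => n k; rewrite coef2_blowup.
set g := Fps2 _; have -> : form n g = p n \Po ('X - c%:P).
  apply/polyP => j; rewrite coef_form; case: leqP => [lejn|ltnj].
    by rewrite -[LHS]/((p (n - j + j)%N \Po ('X - c%:P))`_j) subnK.
  by rewrite nth_default // size_shift' (leq_trans (size_poly _ _)).
by rewrite comp_shiftK' coef_poly ltnS; case: leqP => // /h0.
Qed.

Lemma blowup_ydeg m r : ydeg_lt m r -> ydeg_lt m (blowup r).
Proof.
move=> rm n k lemk; rewrite coef2_blowup nth_default // size_shift.
apply: leq_trans lemk; apply/leq_sizeP => j lemj.
by rewrite coef_form rm // if_same.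
Qed.

Lemma blowup_coef00 f : coef2 (blowup f) 0 0 = coef2 f 0 0.
Proof.
rewrite coef2_blowup (_ : form 0 f = (coef2 f 0 0)%:P) ?comp_polyC ?coefC //.
by apply/polyP => -[|j]; rewrite coef_form coefC.
Qed.

Lemma blowupX : blowup fps2X = fps2X.
Proof.
apply: fps2P => n k; rewrite coef2_blowup.
have -> : form n fps2X = (n == 1%N)%:R :> {poly K}.
  apply/polyP => j; rewrite coef_form -[coef2 _ _ _]/(((n - j == 1)%N && (j == 0%N))%:R).
  rewrite mulrb; case: j => [|j]; rewrite ?andbF ?if_same ?subn0 ?andbT;
  by case: eqP => _; rewrite ?coef1 ?coef0.
rewrite rmorph_nat -[RHS]/(((n == 1)%N && (k == 0%N))%:R).
by case: (n == 1)%N; rewrite ?coef1 ?coef0.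
Qed.

Lemma blowupY : blowup fps2Y = fps2X * (fps2Y + c%:A).
Proof.
apply: fps2P => n k; rewrite coef2_blowup coef2_XM.
have -> : form n fps2Y = 'X *+ (n == 1%N) :> {poly K}.
  apply/polyP => j; rewrite coef_form -[coef2 _ _ _]/(((n - j == 0)%N && (j == 1%N))%:R).
  rewrite coefMn coefX; case: j => [|[|j]]; rewrite ?andbF ?if_same ?mul0rn //.
  by case: n => [|[|n]] //=.
case: n => [|n]; rewrite ?mulr0n ?comp_poly0 ?coef0 //.
rewrite coef2D coef2_alg; case: n => [|n] /=;
  last by rewrite mulr0n comp_poly0 coef0 addr0.
by rewrite mulr1n comp_polyX coefD coefX coefC; case: k => [|k] //=; rewrite mulrb.
Qed.

Lemma form_dy n f : form n (fps2_dy f) = (form n.+1 f)^`().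
Proof.
apply/polyP => j; rewrite coef_form coef_deriv coef_form ltnS subSS.
by case: leqP => _; rewrite ?mul0rn.
Qed.

(** Euler's relation for the homogeneous part of degree n + 1, at x = 1. *)
Lemma form_dx n f : form n (fps2_dx f) = form n.+1 f *+ n.+1 - 'X * (form n.+1 f)^`().
Proof.
apply/polyP => j; rewrite coefB coefMn coefXM coef_deriv !coef_form.
case: j => [|j] /=.
  by rewrite ?subn0 subr0 -[coef2 (fps2_dx f) _ _]/(coef2 f n.+1 0 *+ n.+1).
rewrite -[coef2 (fps2_dx f) _ _]/(coef2 f (n - j.+1).+1 j.+1 *+ (n - j.+1).+1).
case: (leqP j.+1 n) => [lejn|ltnj].
  have -> : (j < n.+1)%N by lia.
  have -> : (n.+1 - j.+1 = (n - j.+1).+1)%N by lia.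
  by rewrite -mulrnBr; [congr (_ *+ _); lia | lia].
case: (leqP j.+1 n.+1) => [lejn|]; rewrite ?mul0rn ?subr0 //.
by have -> : j = n by [lia]; rewrite subrr.
Qed.

Lemma coef2_dx f i j : coef2 (fps2_dx f) i j = coef2 f i.+1 j *+ i.+1.
Proof. by []. Qed.
Lemma coef2_dy f i j : coef2 (fps2_dy f) i j = coef2 f i j.+1 *+ j.+1.
Proof. by []. Qed.

(** Chain rule for the substitution of (x, x(y + c)), here and in [blowup_dx]. *)
Lemma blowup_dy f : fps2_dy (blowup f) = fps2X * blowup (fps2_dy f).
Proof.
apply: fps2P => n k; rewrite coef2_XM coef2_dy coef2_blowup -coef_deriv deriv_comp.
rewrite derivD derivX derivC addr0 mulr1; case: n => [|n].
  rewrite (_ : form 0 f = (coef2 f 0 0)%:P) ?derivC ?comp_poly0 ?coef0 //.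
  by apply/polyP => -[|j]; rewrite coef_form coefC.
by rewrite coef2_blowup form_dy.
Qed.

Lemma blowup_dx f : fps2_dx (blowup f) =
  blowup (fps2_dx f) + (fps2Y + c%:A) * blowup (fps2_dy f).
Proof.
apply: fps2P => n k; rewrite coef2_dx coef2D mulrDl coef2D mulr_algl coef2Z coef2_YM.
rewrite !coef2_blowup form_dx form_dy comp_polyB raddfMn /= comp_polyM comp_polyX.
set p := _^`() \Po _; rewrite coefB mulrDl coefD coefXM coefCM coefMn.
case: k => [|k] /=; first by rewrite add0r subrK.
by rewrite coef2_blowup form_dy -/p subrK.
Qed.

End BlowUp.

(** * Derivations and the exchange of the variables *)

(** Leibniz rule for a Cauchy product: in each term n + 1 is split as a + (n + 1 - a). Abstracting
    the products of coefficients into G lets it serve in one and in two variables. *)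
Lemma convolution_deriv (V : zmodType) (G : nat -> nat -> V) n :
  (\sum_(a < n.+2) G a (n.+1 - a)%N) *+ n.+1 =
  \sum_(a < n.+1) G a.+1 (n - a)%N *+ a.+1 +
  \sum_(a < n.+1) G a (n - a).+1 *+ (n - a).+1.
Proof.
have -> : (\sum_(a < n.+2) G a (n.+1 - a)%N) *+ n.+1 =
    \sum_(a < n.+2) G a (n.+1 - a)%N *+ a + \sum_(a < n.+2) G a (n.+1 - a)%N *+ (n.+1 - a).
  rewrite -big_split /= -sumrMnl; apply: eq_bigr => a _.
  by rewrite -mulrnDr; congr (_ *+ _); have := ltn_ord a; lia.
congr (_ + _).
  by rewrite big_ord_recl mulr0n add0r; apply: eq_bigr => a _.
rewrite big_ord_recr /= subnn mulr0n addr0; apply: eq_bigr => a _.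
by rewrite subSn // -ltnS.
Qed.

Section Swap.
Variable K : fieldType.
Implicit Types f g h : fps2 K.

(** Blowing up by f(x, x(y + c)) misses the tangent x = 0; exchanging the variables brings it into
    reach. *)
Definition swap f : fps2 K := Fps2 (fun i j => coef2 f j i).

Lemma coef2_swap f i j : coef2 (swap f) i j = coef2 f j i.
Proof. by []. Qed.

Lemma swapK : involutive swap.
Proof. by move=> f; apply: fps2P. Qed.

Fact swap_is_linear : linear swap.
Proof. by move=> a f g; apply: fps2P. Qed.
HB.instance Definition _ :=
  GRing.isLinear.Build K (fps2 K) (fps2 K) _ swap swap_is_linear.
Fact swap_is_monoid_morphism : monoid_morphism swap.
Proof.
split=> [|f g]; apply: fps2P => i j; first by rewrite coef2_swap !coef21 andbC.
by rewrite coef2_swap !coef2M exchange_big.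
Qed.
HB.instance Definition _ :=
  GRing.isMonoidMorphism.Build (fps2 K) (fps2 K) swap swap_is_monoid_morphism.

Lemma swapX : swap fps2X = fps2Y.
Proof.
by apply: fps2P => i j; rewrite coef2_swap; rewrite /coef2 /= andbC.
Qed.

Lemma swapY : swap fps2Y = fps2X.
Proof. by rewrite -swapX swapK. Qed.

Lemma swap_dx f : swap (fps2_dx f) = fps2_dy (swap f).
Proof. exact: fps2P. Qed.

Lemma swap_dy f : swap (fps2_dy f) = fps2_dx (swap f).
Proof. exact: fps2P. Qed.

Lemma fps2_dxM f g : fps2_dx (f * g) = fps2_dx f * g + f * fps2_dx g.
Proof.
apply: fps2P => i j; rewrite coef2_dx coef2D !coef2M.
pose G a b := \sum_(k < j.+1) coef2 f a k * coef2 g b (j - k).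
rewrite -[LHS]/((\sum_(a < i.+2) G a (i.+1 - a)%N) *+ i.+1) convolution_deriv.
congr (_ + _); apply: eq_bigr => a _; rewrite -sumrMnl; apply: eq_bigr => k _.
  by rewrite coef2_dx mulrnAl.
by rewrite coef2_dx mulrnAr.
Qed.

Lemma fps2_dyM f g : fps2_dy (f * g) = fps2_dy f * g + f * fps2_dy g.
Proof.
by apply: (can_inj swapK); rewrite swap_dy rmorphM fps2_dxM rmorphD !rmorphM /= !swap_dy.
Qed.

Lemma fps2_dxD f g : fps2_dx (f + g) = fps2_dx f + fps2_dx g.
Proof. by apply: fps2P => i j; rewrite coef2D !coef2_dx coef2D mulrnDl. Qed.

Lemma fps2_dyD f g : fps2_dy (f + g) = fps2_dy f + fps2_dy g.
Proof. by apply: fps2P => i j; rewrite coef2D !coef2_dy coef2D mulrnDl. Qed.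

Lemma fps2_dyXn n : fps2_dy (fps2X ^+ n : fps2 K) = 0.
Proof.
apply: fps2P => i j; rewrite -mono2X coef2_dy.
by rewrite -[coef2 _ _ _]/(((i == n) && (j.+1 == 0%N))%:R) andbF mul0rn.
Qed.

Lemma fps2_dxX : fps2_dx (fps2X : fps2 K) = 1.
Proof.
apply: fps2P => i j; rewrite coef2_dx coef21.
rewrite -[coef2 _ _ _]/(((i.+1 == 1%N) && (j == 0%N))%:R).
by case: i => [|i]; rewrite ?mulr1n ?mul0rn.
Qed.

Lemma fps2_dyY : fps2_dy (fps2Y : fps2 K) = 1.
Proof. by apply: (can_inj swapK); rewrite swap_dy swapY fps2_dxX rmorph1. Qed.

Lemma fps2_dxY : fps2_dx (fps2Y : fps2 K) = 0.
Proof. apply: fps2P => i j; rewrite coef2_dx.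
by rewrite -[coef2 _ _ _]/(((i.+1 == 0%N) && (j == 1%N))%:R) mul0rn. Qed.

End Swap.

(** * Power series in one variable *)

Record fps1 (K : Type) := Fps1 { tcoef : nat -> K }.
#[global] Arguments tcoef : simpl never.

HB.instance Definition _ (K : Type) := gen_eqMixin (fps1 K).
HB.instance Definition _ (K : Type) := gen_choiceMixin (fps1 K).

Lemma fps1P (K : Type) (a b : fps1 K) : tcoef a =1 tcoef b -> a = b.
Proof. by case: a b => [a] [b] /= ab; congr Fps1; apply/funext. Qed.

Section PowerSeries1.
Variable K : fieldType.
Implicit Types a b : fps1 K.

Definition fps1_add a b : fps1 K := Fps1 (fun n => tcoef a n + tcoef b n).
Definition fps1_opp a : fps1 K := Fps1 (fun n => - tcoef a n).
Definition fps1_scale (c : K) a : fps1 K := Fps1 (fun n => c * tcoef a n).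
Definition fps1_mul a b : fps1 K :=
  Fps1 (fun n => \sum_(i < n.+1) tcoef a i * tcoef b (n - i)).

Fact fps1_addA : associative fps1_add.
Proof. by move=> a b c; apply: fps1P => n; apply: addrA. Qed.
Fact fps1_addC : commutative fps1_add.
Proof. by move=> a b; apply: fps1P => n; apply: addrC. Qed.
Fact fps1_add0 : left_id (Fps1 (fun _ => 0)) fps1_add.
Proof. by move=> a; apply: fps1P => n; apply: add0r. Qed.
Fact fps1_addN : left_inverse (Fps1 (fun _ => 0)) fps1_opp fps1_add.
Proof. by move=> a; apply: fps1P => n; apply: addNr. Qed.
HB.instance Definition _ := GRing.isZmodule.Build (fps1 K)
  fps1_addA fps1_addC fps1_add0 fps1_addN.

Fact fps1_scaleA c d a : fps1_scale c (fps1_scale d a) = fps1_scale (c * d) a.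
Proof. by apply: fps1P => n; apply: mulrA. Qed.
Fact fps1_scale1 : left_id 1 fps1_scale.
Proof. by move=> a; apply: fps1P => n; apply: mul1r. Qed.
Fact fps1_scaleDr : right_distributive fps1_scale +%R.
Proof. by move=> c a b; apply: fps1P => n; apply: mulrDr. Qed.
Fact fps1_scaleDl a : {morph fps1_scale^~ a : c d / c + d}.
Proof. by move=> c d; apply: fps1P => n; apply: mulrDl. Qed.
HB.instance Definition _ := GRing.Zmodule_isLmodule.Build K (fps1 K)
  fps1_scaleA fps1_scale1 fps1_scaleDr fps1_scaleDl.

(* K[[x]] as the subring of K[[x,y]] of the series without y; the ring axioms
   are inherited from K[[x,y]]. *)
Definition xseries a : fps2 K := Fps2 (fun i j => if j == 0%N then tcoef a i else 0).

Definition at_y0 (f : fps2 K) : fps1 K := Fps1 (fun i => coef2 f i 0).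

Lemma xseriesK : cancel xseries at_y0.
Proof. by move=> a; apply: fps1P. Qed.

Lemma coef2_xseries a i j : coef2 (xseries a) i j = if j == 0%N then tcoef a i else 0.
Proof. by []. Qed.

Lemma xseries_mul a b : xseries (fps1_mul a b) = xseries a * xseries b.
Proof.
apply: fps2P => i j; rewrite coef2M coef2_xseries.
case: j => [|j] /=.
  by apply: eq_bigr => k _; rewrite big_ord1.
rewrite big1 // => k _; rewrite big1 // => -[[|l] lt] _ /=.
  by rewrite !coef2_xseries mulr0.
by rewrite !coef2_xseries mul0r.
Qed.

Lemma xseries_add a b : xseries (a + b) = xseries a + xseries b.
Proof.
by apply: fps2P => i j; rewrite coef2D !coef2_xseries; case: eqP; rewrite ?addr0.
Qed.

Lemma xseries_one : xseries (at_y0 1) = 1.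
Proof.
apply: fps2P => i j; rewrite coef2_xseries coef21.
by case: eqP => _; rewrite ?andbF // andbT /tcoef /= coef21 andbT.
Qed.

Fact fps1_mulA : associative fps1_mul.
Proof. by move=> a b c; apply: (can_inj xseriesK); rewrite !xseries_mul mulrA. Qed.
Fact fps1_mulC : commutative fps1_mul.
Proof. by move=> a b; apply: (can_inj xseriesK); rewrite !xseries_mul mulrC. Qed.
Fact fps1_mul1 : left_id (at_y0 1) fps1_mul.
Proof. by move=> a; apply: (can_inj xseriesK); rewrite xseries_mul xseries_one mul1r. Qed.
Fact fps1_mulDl : left_distributive fps1_mul +%R.
Proof.
by move=> a b c; apply: (can_inj xseriesK);
  rewrite xseries_mul !xseries_add !xseries_mul mulrDl.
Qed.
Fact fps1_one_neq0 : at_y0 1 != 0.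
Proof.
apply/eqP => /(congr1 (fun a => tcoef a 0)); rewrite /tcoef /= coef21.
by move/eqP; rewrite oner_eq0.
Qed.
HB.instance Definition _ := GRing.Zmodule_isComNzRing.Build (fps1 K)
  fps1_mulA fps1_mulC fps1_mul1 fps1_mulDl fps1_one_neq0.

Fact fps1_scaleAl (c : K) a b : c *: (a * b) = (c *: a) * b.
Proof.
apply: fps1P => n; rewrite /tcoef /= mulr_sumr; apply: eq_bigr => i _.
exact: mulrA.
Qed.
HB.instance Definition _ :=
  GRing.Lmodule_isLalgebra.Build K (fps1 K) fps1_scaleAl.
HB.instance Definition _ := GRing.Lalgebra_isComAlgebra.Build K (fps1 K).

Lemma tcoefM a b n : tcoef (a * b) n = \sum_(i < n.+1) tcoef a i * tcoef b (n - i).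
Proof. by []. Qed.
Lemma tcoefD a b n : tcoef (a + b) n = tcoef a n + tcoef b n.
Proof. by []. Qed.
Lemma tcoefN a n : tcoef (- a) n = - tcoef a n.
Proof. by []. Qed.
Lemma tcoefZ c a n : tcoef (c *: a) n = c * tcoef a n.
Proof. by []. Qed.
Lemma tcoef0 n : tcoef (0 : fps1 K) n = 0.
Proof. by []. Qed.
Lemma tcoef1 n : tcoef (1 : fps1 K) n = (n == 0%N)%:R.
Proof. by rewrite -[LHS]/(coef2 1 n 0) coef21 andbT. Qed.

Lemma tcoefM_0 a b : tcoef (a * b) 0 = tcoef a 0 * tcoef b 0.
Proof. by rewrite tcoefM big_ord1. Qed.

Lemma xseriesM a b : xseries (a * b) = xseries a * xseries b.
Proof. exact: xseries_mul. Qed.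

Lemma fps1_inv a : tcoef a 0 != 0 -> exists b, a * b = 1.
Proof.
move=> a0; have ua : xseries a \is a GRing.unit by rewrite fps2_unitE.
exists (at_y0 (xseries a)^-1); apply: fps1P => n; rewrite tcoef1.
have <- : coef2 (xseries a * (xseries a)^-1) n 0 = (n == 0%N)%:R.
  by rewrite divrr // coef21 andbT.
by rewrite coef2M; apply: eq_bigr => i _; rewrite big_ord1.
Qed.

Definition fps1X : fps1 K := Fps1 (fun n => (n == 1%N)%:R).

Lemma tcoef_XM a n : tcoef (fps1X * a) n = if n is k.+1 then tcoef a k else 0.
Proof.
rewrite tcoefM; case: n => [|n]; first by rewrite big_ord1 mul0r.
rewrite big_ord_recl mul0r add0r big_ord_recl big1 ?addr0 => [|i _].
  by rewrite /= /bump /= subSS subn0 [tcoef _ _]/(1) mul1r.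
by rewrite [tcoef _ _]/(0) mul0r.
Qed.

Lemma tcoef_XnM m a n : tcoef (fps1X ^+ m * a) n =
  if (m <= n)%N then tcoef a (n - m) else 0.
Proof.
elim: m n => [|m IH] n; first by rewrite mul1r subn0.
by rewrite exprS -mulrA tcoef_XM; case: n => [|n] //; rewrite IH ltnS subSS.
Qed.

Definition ordt a n := lead (tcoef a) n.

Lemma ordt_exists a : a != 0 -> exists n, ordt a n.
Proof.
move=> a0; apply: contrapT => nex; case/negP: a0; apply/eqP/fps1P => n.
apply/eqP; apply: contrapT => /negP an; apply: nex.
by have [m am _] := lead_exists an; exists m.
Qed.

Lemma ordt_neq0 a n : ordt a n -> a != 0.
Proof. by move=> [_]; apply: contra => /eqP->. Qed.

Lemma ordt_uniq a n k : ordt a n -> ordt a k -> n = k.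
Proof. exact: lead_uniq. Qed.

Lemma ordtM a b n k : ordt a n -> ordt b k -> ordt (a * b) (n + k).
Proof. exact: lead_conv. Qed.

Lemma ordt1 : ordt 1 0.
Proof. by split=> //; rewrite tcoef1 oner_neq0. Qed.

Lemma ordtXn a n m : ordt a n -> ordt (a ^+ m) (m * n).
Proof.
move=> an; elim: m => [|m IH]; first exact: ordt1.
by rewrite exprS mulSn; apply: ordtM.
Qed.

Lemma ordtN a n : ordt a n -> ordt (- a) n.
Proof.
by move=> [a0 an]; split=> [k /a0|]; rewrite tcoefN ?oppr_eq0 // => ->; rewrite oppr0.
Qed.

Lemma fps1_mul_eq0 a b : a * b = 0 -> a = 0 \/ b = 0.
Proof.
have [->|a0] := eqVneq a 0; first by left.
have [->|b0] := eqVneq b 0; first by right.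
have [m am] := ordt_exists a0; have [n bn] := ordt_exists b0.
by move/eqP: (ordt_neq0 (ordtM am bn)).
Qed.

Lemma fps1_mulfI a : a != 0 -> injective ( *%R a).
Proof.
move=> a0 b c E; apply/subr0_eq.
have /fps1_mul_eq0[aE|//] : a * (b - c) = 0 by rewrite mulrBr E subrr.
by rewrite aE eqxx in a0.
Qed.

Lemma ordt_factor a n : (forall k, (k < n)%N -> tcoef a k = 0) ->
  exists u, a = fps1X ^+ n * u /\ tcoef u 0 = tcoef a n.
Proof.
move=> a0; exists (Fps1 (fun k => tcoef a (k + n))); split; last by rewrite /tcoef.
apply: fps1P => k; rewrite tcoef_XnM; case: leqP => [le|/a0//].
by rewrite -[RHS]/(tcoef a (k - n + n)) subnK.
Qed.

Lemma ordt_dvd a n h : ordt a n ->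
  (exists b, h = a * b) <-> (forall k, (k < n)%N -> tcoef h k = 0).
Proof.
move=> [a0 an]; have [u [aE u0]] := ordt_factor a0.
split=> [[b ->] k ltkn|/ordt_factor[v [-> _]]].
  by rewrite aE -mulrA tcoef_XnM leqNgt ltkn.
have [w uw] : exists w, u * w = 1 by apply: fps1_inv; rewrite u0.
by exists (w * v); rewrite aE -mulrA [u * _]mulrA uw mul1r.
Qed.

Definition deriv1 a : fps1 K := Fps1 (fun n => tcoef a n.+1 *+ n.+1).

Lemma tcoef_deriv a n : tcoef (deriv1 a) n = tcoef a n.+1 *+ n.+1.
Proof. by []. Qed.

Lemma deriv1M a b : deriv1 (a * b) = deriv1 a * b + a * deriv1 b.
Proof.
apply: fps1P => n; rewrite tcoef_deriv tcoefD !tcoefM.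
rewrite (convolution_deriv (fun i j => tcoef a i * tcoef b j)).
congr (_ + _); apply: eq_bigr => i _; rewrite tcoef_deriv.
  by rewrite mulrnAl.
by rewrite mulrnAr.
Qed.

Lemma deriv1D a b : deriv1 (a + b) = deriv1 a + deriv1 b.
Proof. by apply: fps1P => n; rewrite tcoefD !tcoef_deriv tcoefD mulrnDl. Qed.

Lemma deriv1_alg c : deriv1 c%:A = 0.
Proof.
by apply: fps1P => n; rewrite tcoef_deriv tcoefZ tcoef1 mulr0 mul0rn.
Qed.

Lemma deriv1X : deriv1 fps1X = 1.
Proof.
apply: fps1P => n; rewrite tcoef_deriv tcoef1 -[tcoef _ _]/((n.+1 == 1%N)%:R).
by case: n => [|n]; rewrite ?mul0rn.
Qed.

Lemma deriv1_low a n k : ordt a n.+1 -> (k < n)%N -> tcoef (deriv1 a) k = 0.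
Proof. by move=> [a0 _] lt; rewrite tcoef_deriv a0 ?mul0rn. Qed.

(** The order of a'(t) is one less than that of a(t) unless the characteristic divides the latter;
    the im-good condition originates here. *)
Lemma deriv1_coef_eq0 a n : ordt a n.+1 ->
  (tcoef (deriv1 a) n == 0) = (n.+1%:R == 0 :> K).
Proof.
move=> [_ an]; rewrite tcoef_deriv -[X in X == _]mulr_natr mulf_eq0.
by rewrite (_ : (tcoef a n.+1 == 0) = false) //; apply: negPf an.
Qed.

Lemma subspace_ideal1 a : subspace [set h | exists b, h = a * b].
Proof.
split=> [|c u v [b ->] [b' ->]]; first by exists 0; rewrite mulr0.
by exists (c *: b + b'); rewrite mulrDr -scalerAr.
Qed.

Lemma dimq_ideal1 a n : ordt a n -> dimq setT [set h | exists b, h = a * b] n.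
Proof.
move=> an; rewrite -[n]card_ord.
have := @dimq_map K (fps1 K) setT [set h | exists b, h = a * b] 'I_n (fun h i => tcoef h i) subspaceT (subspace_ideal1 a).
apply => //.
- by move=> h _; split=> [/(ordt_dvd _ an) h0 i|h0];
  [exact: h0 | apply/(ordt_dvd _ an) => k lt; apply: (h0 (Ordinal lt))].
- move=> v; exists (Fps1 (fun k => if insub k is Some i then v i else 0)) => // i.
  by rewrite /tcoef valK.
Qed.

Lemma infinite_dim1 n : ~ dimq (setT : set (fps1 K)) [set 0] n.
Proof.
move=> dn.
have s0 : subspace [set (0 : fps1 K)].
  by split=> // c u v -> ->; rewrite /= scaler0 addr0.
suff ind : indep_mod [set (0 : fps1 K)] (fun i : 'I_n.+1 => Fps1 (fun k => (k == i)%:R)).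
  by have := indep_mod_le subspaceT s0 dn (fun=> I) ind; rewrite ltnn.
move=> c cE; apply/rowP => i; rewrite mxE.
have := congr1 (fun a => tcoef a i) cE; rewrite tcoef0 => <-.
have coef_sum (r : seq 'I_n.+1) : tcoef (\sum_(j <- r) c 0 j *: Fps1 (fun k => (k == j)%:R)) i =
    \sum_(j <- r) c 0 j * (i == j :> nat)%:R.
  by elim: r => [|j r IH]; rewrite ?big_nil ?big_cons // tcoefD tcoefZ IH.
rewrite coef_sum (bigD1 i) //= eqxx mulr1 big1 ?addr0 // => j ji.
by rewrite (_ : (i == j :> nat) = false) ?mulr0 //; apply/negP => /eqP/val_inj E;
  rewrite E eqxx in ji.
Qed.

End PowerSeries1.
Arguments fps1X {K}.

(** * Parametrizations *)

Section Parametrization.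
Variable K : fieldType.
Implicit Types (f g h : fps2 K) (phi : {lrmorphism fps2 K -> fps1 K}).

Definition im phi : set (fps1 K) := [set s | exists a, s = phi a].

(* In [param_deriv], [la] is f_y / x'(t) = - f_x / y'(t); that its order is
   2 delta is Dedekind's formula.  Unlike i(f, f_y) = 2 delta + ord x'(t), this
   form survives x'(t) = 0 and is transported by blowing up. *)
Record is_param f phi (d : nat) : Prop := IsParam {
  param_ker : forall a, phi a = 0 <-> exists c, a = c * f;
  param_coef0 : forall a, tcoef (phi a) 0 = coef2 a 0 0;
  param_conductor : exists2 b, phi b != 0 & forall s, exists a, phi a = phi b * s;
  param_dim : dimq setT (im phi) d;
  param_deriv : exists2 la, ordt la d.*2 &
    phi (fps2_dy f) = la * deriv1 (phi fps2X) /\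
    phi (fps2_dx f) = - la * deriv1 (phi fps2Y) }.

Lemma subspace_im phi : subspace (im phi).
Proof.
split=> [|c u v [a ->] [b ->]]; first by exists 0; rewrite raddf0.
by exists (c *: a + b); rewrite linearP.
Qed.

Lemma subspace_ideal2 f g : subspace (ideal2 f g).
Proof.
split=> [|c u v [a [b ->]] [a' [b' ->]]]; first by exists 0, 0; rewrite !mul0r addr0.
by exists (c *: a + a'), (c *: b + b'); rewrite scalerDr !mulrDl !scalerAl addrACA.
Qed.

Lemma param_self f phi d : is_param f phi d -> phi f = 0.
Proof. by move=> P; apply/(param_ker P); exists 1; rewrite mul1r. Qed.

Lemma param_eq f phi d a b : is_param f phi d ->
  phi a = phi b <-> exists c, a = b + c * f.
Proof.
move=> P; split=> [E|[c ->]]; last first.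
  by rewrite rmorphD rmorphM /= (param_self P) mulr0 addr0.
have /(param_ker P)[c cE] : phi (a - b) = 0 by rewrite rmorphB /= E subrr.
by exists c; rewrite -cE addrC subrK.
Qed.

(** Let O be the image of [phi]. The codimension of g O in K[[t]] is n + d through g K[[t]], and d +
    dim O/gO through O; hence dim O/gO = n. *)
Lemma param_imult f phi d g n : is_param f phi d -> ordt (phi g) n ->
  dimq setT (ideal2 f g) n.
Proof.
move=> P gn; have g0 := ordt_neq0 gn.
pose G : set (fps1 K) := [set h | exists s, h = phi g * s].
pose W : set (fps1 K) := [set h | exists b, h = phi g * phi b].
have sG : subspace G := subspace_ideal1 (phi g).
have sW : subspace W.
  split=> [|c u v [a ->] [b ->]]; first by exists 0; rewrite raddf0 mulr0.
  by exists (c *: a + b); rewrite linearP mulrDr scalerAr.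
have dG : dimq setT G n := dimq_ideal1 gn.
have dGW : dimq G W d.
  apply: (dimq_rel (rho := fun s s' : fps1 K => s' = phi g * s)
    subspaceT (subspace_im phi) sG sW _ _ _ _ _ (param_dim P)).
  - by rewrite mulr0.
  - by move=> c u u' v v' -> ->; rewrite mulrDr scalerAr.
  - by move=> u _; exists (phi g * u) => //; exists u.
  - by move=> u' [s ->]; exists s.
  - move=> u u' ->; split=> [[a ->]|[b /(fps1_mulfI g0)->]]; [by exists a | by exists b].
have dW : dimq setT W (n + d).
  by apply: (dimq_trans subspaceT sG sW _ _ dG dGW) => // v [b ->]; exists (phi b).
have Wim v : W v -> im phi v by move=> [b ->]; exists (g * b); rewrite rmorphM.
have [k dk] := dimq_sub subspaceT (subspace_im phi) sW (fun _ _ => I) Wim dW.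
have := dimq_trans subspaceT (subspace_im phi) sW (fun _ _ => I) Wim (param_dim P) dk.
move/(dimq_uniq subspaceT sW dW); rewrite addnC => /addnI kn.
rewrite -kn in dk.
apply: (dimq_rel (rho := fun (s : fps1 K) (a : fps2 K) => s = phi a)
  (subspace_im phi) sW subspaceT (subspace_ideal2 f g) _ _ _ _ _ dk).
- by rewrite raddf0.
- by move=> c u u' v v' -> ->; rewrite linearP.
- by move=> u [a ->]; exists a.
- by move=> a _; exists (phi a) => //; exists a.
- move=> u a ->; split=> [[b]|[b [c ->]]].
    rewrite -rmorphM => /(param_eq _ _ P)[c ->].
    by exists c, b; rewrite addrC mulrC; congr (_ + _); rewrite mulrC.
  by exists c; rewrite rmorphD !rmorphM /= (param_self P) mulr0 add0r mulrC.
Qed.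

(** If g is a multiple of f, the quotient by (f, g) is the image of [phi], which has finite
    codimension in the infinite dimensional K[[t]]. *)
Lemma param_imult_infty f phi d g n : is_param f phi d -> phi g = 0 ->
  ~ dimq setT (ideal2 f g) n.
Proof.
move=> P /(param_ker P)[e gE] dn.
have s0 : subspace [set (0 : fps1 K)].
  by split=> // c u v -> ->; rewrite /= scaler0 addr0.
have d0 : dimq (im phi) [set 0] n.
  apply: (dimq_rel (rho := fun (a : fps2 K) (s : fps1 K) => s = phi a)
    subspaceT (subspace_ideal2 f g) (subspace_im phi) s0 _ _ _ _ _ dn).
  - by rewrite raddf0.
  - by move=> c u u' v v' -> ->; rewrite linearP.
  - by move=> a _; exists (phi a) => //; exists a.
  - by move=> s [a ->]; exists a.
  - move=> a s ->; split=> [[b [c ->]]|/(param_ker P)[c ->]].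
      by rewrite /= rmorphD !rmorphM /= gE rmorphM /= (param_self P) !mulr0 addr0.
    by exists c, 0; rewrite mul0r addr0.
apply: (@infinite_dim1 K (d + n)).
apply: (dimq_trans subspaceT (subspace_im phi) s0 _ _ (param_dim P) d0) => // v ->.
by exists 0; rewrite raddf0.
Qed.

Lemma lrmorphism_of (phi : fps2 K -> fps1 K) : linear phi -> monoid_morphism phi ->
  exists psi : {lrmorphism fps2 K -> fps1 K}, psi =1 phi.
Proof.
move=> lphi mphi.
pose L := GRing.isLinear.Build _ _ _ _ phi lphi.
pose M := GRing.isMonoidMorphism.Build _ _ phi mphi.
pose psi : {lrmorphism fps2 K -> fps1 K} := HB.pack phi L M.
by exists psi.
Qed.

Lemma param_swap f phi d : is_param (swap f) phi d ->
  exists psi, is_param f psi d.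
Proof.
move=> P; exists (phi \o @swap K : {lrmorphism fps2 K -> fps1 K}); split=> /=.
- move=> a; rewrite (param_ker P); split=> [[c cE]|[c ->]].
    by exists (swap c); rewrite -[LHS]swapK cE rmorphM /= swapK.
  by exists (swap c); rewrite rmorphM.
- by move=> a; rewrite (param_coef0 P).
- have [b b0 bP] := param_conductor P; exists (swap b); rewrite /= ?swapK // => s.
  by have [a aE] := bP s; exists (swap a); rewrite /= swapK.
- rewrite (_ : im _ = im phi); first exact: param_dim P.
  apply/seteqP; split=> s [a ->]; first by exists (swap a).
  by exists (swap a); rewrite /= swapK.
- have [la lad [Ey Ex]] := param_deriv P; exists (- la); first exact: ordtN.
  by rewrite /= swap_dx swap_dy swapX swapY Ey Ex opprK; split.
Qed.

(** The remainder modulo f is a series in x alone, the value of g at t = x. The branch ring is all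
    of K[[t]] and f_y is a unit on it, so d = 0 and f_y itself serves as [la]. *)
Lemma param_smooth f : regular 1 f ->
  exists phi, is_param f phi 0 /\ forall g, exists q, g = q * f + xseries (phi g).
Proof.
move=> rf; have xs1 (s : fps1 K) : ydeg_lt 1 (xseries s) by move=> i [|j].
have xsE (r : fps2 K) : ydeg_lt 1 r -> xseries (at_y0 r) = r.
  by move=> r1; apply: fps2P => i [|j] //; rewrite coef2_xseries r1.
have /choice[phi0 phi0P] g : exists s, exists q, g = q * f + xseries s.
  by have [q [r [r1 ->]]] := Weierstrass_division g rf; exists (at_y0 r), q; rewrite xsE.
have phi0E q s : phi0 (q * f + xseries s) = s.
  have [q' E] := phi0P (q * f + xseries s).
  have [_ /(can_inj (@xseriesK K))-> //] := Weierstrass_uniq rf (xs1 _) (xs1 _) (esym E).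
have lphi : linear phi0.
  move=> c g h; have [q qE] := phi0P g; have [q' qE'] := phi0P h.
  rewrite -(phi0E (c *: q + q') (c *: phi0 g + phi0 h)) {1}qE {1}qE'; congr phi0.
  rewrite xseries_add (_ : xseries (c *: _) = c *: xseries (phi0 g)); last first.
    by apply: fps2P => i j; rewrite coef2Z !coef2_xseries; case: eqP; rewrite ?mulr0.
  by rewrite mulrDl scalerDr scalerAl addrACA.
have mphi : monoid_morphism phi0.
  split=> [|g h]; first by rewrite -(phi0E 0 1) mul0r add0r xseries_one.
  have [q qE] := phi0P g; have [q' qE'] := phi0P h.
  rewrite -(phi0E (q * q' * f + q * xseries (phi0 h) + xseries (phi0 g) * q') (phi0 g * phi0 h)).
  by rewrite {1}qE {1}qE' xseriesM; congr phi0; ring.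
have [phi phiE] := lrmorphism_of lphi mphi.
have phiP g : exists q, g = q * f + xseries (phi g) by rewrite phiE.
have phi_eq q s : phi (q * f + xseries s) = s by rewrite phiE.
have xs0 : xseries (0 : fps1 K) = 0.
  by apply: fps2P => i j; rewrite coef2_xseries tcoef0 if_same.
have phif0 : phi f = 0.
  by rewrite -[f in phi f]mul1r -[1 * f]addr0 -xs0 phi_eq.
have phixs s : phi (xseries s) = s by rewrite -[xseries s]add0r -(mul0r f) phi_eq.
have phiX : phi fps2X = fps1X.
  by rewrite -[RHS]phixs; congr (phi _); apply: fps2P => i [|j];
    rewrite coef2_xseries /= [LHS]/(_%:R) ?andbT ?andbF.
exists phi; split=> //; split.
- move=> a; split=> [a0|[c ->]]; last by rewrite rmorphM /= phif0 mulr0.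
  by have [q qE] := phiP a; exists q; rewrite {1}qE a0 xs0 addr0.
- move=> a; have [q qE] := phiP a.
  by rewrite {2}qE coef2D coef2M_00 rf.1 // mulr0 add0r coef2_xseries.
- exists 1; first by rewrite rmorph1 oner_neq0.
  by move=> s; exists (xseries s); rewrite phixs rmorph1 mul1r.
- exists (fun _ => 0); apply/(basis_modP _ subspaceT (subspace_im phi)); split=> //.
    by move=> c _; apply/rowP => -[].
  by move=> v _; exists 0; exists (xseries v); rewrite phixs big_ord0 subr0.
- exists (phi (fps2_dy f)).
    have [q qE] := phiP (fps2_dy f); split=> //.
    have : coef2 (fps2_dy f) 0 0 != 0 by rewrite coef2_dy mulr1n; case: rf.
    by rewrite qE coef2D coef2M_00 rf.1 // mulr0 add0r phi_eq.
  rewrite phiX deriv1X mulr1; split=> //.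
  (* Differentiating y = q f + y(x) gives 0 = q f_x + y'(t) and 1 = q f_y along the branch, hence
     f_x = - f_y y'(t). *)
  have [q qE] := phiP fps2Y.
  have dxs (s : fps1 K) : fps2_dx (xseries s) = xseries (deriv1 s).
    by apply: fps2P => i j; rewrite coef2_dx !coef2_xseries; case: eqP; rewrite ?mul0rn.
  have dys (s : fps1 K) : fps2_dy (xseries s) = 0.
    by apply: fps2P => i j; rewrite coef2_dy !coef2_xseries mul0rn.
  have := congr1 (@fps2_dx K) qE; rewrite fps2_dxY fps2_dxD fps2_dxM dxs.
  move/(congr1 phi); rewrite raddf0 !rmorphD !rmorphM /= phif0 mulr0 add0r phixs.
  move=> Ex; have := congr1 (@fps2_dy K) qE; rewrite fps2_dyY fps2_dyD fps2_dyM dys.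
  move/(congr1 phi); rewrite rmorph1 !rmorphD !rmorphM /= phif0 mulr0 add0r raddf0 addr0.
  move=> Ey; have -> : deriv1 (phi fps2Y) = - (phi q * phi (fps2_dx f)).
    by apply/eqP; rewrite -addr_eq0 addrC -Ex.
  by rewrite mulrN mulNr opprK mulrA [phi (fps2_dy f) * _]mulrC -Ey mul1r.
Qed.

End Parametrization.

(** * Transport of a parametrization from the strict transform *)

Section BlowUpStep.
Variables (K : fieldType) (c : K).
Implicit Types (f g h q r : fps2 K) (phi : {lrmorphism fps2 K -> fps1 K}).
Local Notation B := (blowup c).

(** Uniqueness makes the remainder linear in g, so that its coefficients can serve as coordinates in
    [dimq_map]. *)
Lemma remainder_exists m f : regular m f ->
  exists rem : fps2 K -> fps2 K,
    [/\ linear rem, forall g, ydeg_lt m (rem g),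
        forall g, exists q, g = q * f + rem g &
        forall q r, ydeg_lt m r -> rem (q * f + r) = r].
Proof.
move=> rf; have ex g : exists r, ydeg_lt m r /\ exists q, g = q * f + r.
  by have [q [r [rm E]]] := Weierstrass_division g rf; exists r; split=> //; exists q.
have [rem remP] := choice ex.
have remE q r : ydeg_lt m r -> rem (q * f + r) = r.
  move=> rm; have [rm' [q' E]] := remP (q * f + r).
  by have [_ <-] := Weierstrass_uniq rf rm rm' E.
exists rem; split=> [a g h|g|g|//]; [|by case: (remP g)..].
have [gm [q qE]] := remP g; have [hm [q' qE']] := remP h.
rewrite {1}qE {1}qE' -[in RHS](remE (a *: q + q') (a *: rem g + rem h)); last first.
  by move=> i j le; rewrite coef2D coef2Z gm ?hm // mulr0 addr0.
by rewrite mulrDl scalerDr scalerAl addrACA.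
Qed.

Lemma dimq_ideal2_X m f : regular m f -> dimq setT (ideal2 f fps2X) m.
Proof.
move=> rf; have [rem [lrem rem_deg remq remE]] := remainder_exists rf.
rewrite -[m]card_ord.
have := @dimq_map K (fps2 K) setT (ideal2 f fps2X) 'I_m
  (fun h i => coef2 (rem h) 0 i) subspaceT (subspace_ideal2 f fps2X).
apply => //.
- by move=> a g h _ _ i; rewrite lrem coef2D coef2Z.
- move=> h _; split=> [[a [b ->]] i|h0].
    have [q qE] := remq b.
    have -> : a * f + b * fps2X = (a + q * fps2X) * f + fps2X * rem b.
      by rewrite {1}qE; ring.
    rewrite remE ?coef2_XM // => k j le; rewrite coef2_XM.
    by case: k => // k; rewrite rem_deg.
  have [q qE] := remq h; exists q, (Fps2 (fun i j => coef2 (rem h) i.+1 j)).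
  rewrite {1}qE; congr (_ + _); apply: fps2P => i j; rewrite mulrC coef2_XM.
  case: i => // ; case: (ltnP j m) => [lt|/rem_deg//].
  exact: (h0 (Ordinal lt)).
- move=> v; exists (Fps2 (fun i j => if i == 0%N then
    (if insub j is Some k then v k else 0) else 0)) => // i.
  set h := Fps2 _; have hm : ydeg_lt m h.
    move=> k j le; rewrite /h /coef2; case: eqP => // _.
    by rewrite insubF // ltnNge le.
  by rewrite -[h]add0r -(mul0r f) remE // /coef2 /h /= valK.
Qed.

Section Step.
Variables (m : nat) (f f1 : fps2 K).
Hypotheses (m_gt0 : (0 < m)%N) (rf : regular m f) (rf1 : regular m f1)
  (Bf : B f = fps2X ^+ m * f1).

(* The preimage in K[[x,y]] of the subring O/f of O/f1. *)
Definition blowup_subalg : set (fps2 K) :=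
  [set h | exists g q, h = B g + q * f1].

Lemma subspace_blowup_subalg : subspace blowup_subalg.
Proof.
split=> [|a u v [g [q ->]] [g' [q' ->]]]; first by exists 0, 0;
  rewrite raddf0 mul0r addr0.
exists (a *: g + g'), (a *: q + q').
by rewrite linearP mulrDl scalerDr scalerAl addrACA.
Qed.

Lemma blowup_remainder g : exists q r, ydeg_lt m r /\ B g = q * f1 + B r.
Proof.
have [q [r [rm E]]] := Weierstrass_division g rf.
exists (B q * fps2X ^+ m), r; split=> //.
by rewrite {1}E rmorphD rmorphM /= Bf mulrA.
Qed.

(* The remainder modulo f1 of an element of the subring is the blowup of a
   remainder modulo f, so that exactly the coefficients of x^i y^j with
   i < j < m have to vanish. *)
Lemma dimq_blowup_subalg : dimq setT blowup_subalg 'C(m, 2).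
Proof.
have [rem [lrem rem_deg remq remE]] := remainder_exists rf1.
have -> : 'C(m, 2) = #|{: {j : 'I_m & 'I_j}}|.
  rewrite card_tagged sumnE big_map big_enum /= -bin2_sum big_mkord.
  by apply: eq_bigr => i _; rewrite card_ord.
have := @dimq_map K (fps2 K) setT blowup_subalg {j : 'I_m & 'I_j}
  (fun h k => coef2 (rem h) (tagged k) (tag k)) subspaceT subspace_blowup_subalg.
apply => //.
- by move=> a g h _ _ i; rewrite lrem coef2D coef2Z.
- move=> h _; split=> [[g [q ->]] [j i] /=|h0].
    have [q' [r [rm ->]]] := blowup_remainder g.
    rewrite addrAC -mulrDl remE; last exact: blowup_ydeg.
    by have /blowup_image-> := ex_intro (fun g => B r = B g) r erefl.
  have [q qE] := remq h.
  have /(blowup_image c)[g gE] : forall i j, (i < j)%N -> coef2 (rem h) i j = 0.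
    move=> i j lt; case: (ltnP j m) => [ltj|/rem_deg//].
    exact: (h0 (@Tagged 'I_m (Ordinal ltj) (fun j : 'I_m => 'I_j) (Ordinal lt))).
  by exists g, q; rewrite -gE addrC.
- move=> v; exists (Fps2 (fun i j => if insub j is Some j' then
    (if insub i is Some i' then v (@Tagged 'I_m j' (fun j : 'I_m => 'I_j) i') else 0) else 0)) => //.
  move=> [j i] /=; set h := Fps2 _; have hm : ydeg_lt m h.
    by move=> k l le; rewrite /h /coef2 insubF // ltnNge le.
  by rewrite -[h]add0r -(mul0r f1) remE // /coef2 /h /= !valK.
Qed.

(** A remainder r modulo f1 has degree at most m - 1 in y, so that x^(m-1) r meets the degree bound
    of [blowup_image]. Hence x^(m-1) carries conductors of f1 to conductors of f. *)
Lemma blowup_conductor h : blowup_subalg (fps2X ^+ m.-1 * h).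
Proof.
have [q [r [rm E]]] := Weierstrass_division h rf1.
have /(blowup_image c)[g gE] : forall i j, (i < j)%N -> coef2 (fps2X ^+ m.-1 * r) i j = 0.
  by move=> i j lt; rewrite coef2_XnM; case: leqP => // le; rewrite rm //; lia.
by exists g, (fps2X ^+ m.-1 * q); rewrite {1}E mulrDr -gE addrC mulrA.
Qed.

Lemma param_blowup phi1 d1 : is_param f1 phi1 d1 ->
  exists phi d, is_param f phi d.
Proof.
move=> P; pose phi : {lrmorphism fps2 K -> fps1 K} := (phi1 \o B).
exists phi, (d1 + 'C(m, 2))%N.
have phiX : phi fps2X = phi1 fps2X by rewrite /= blowupX.
have im_sub v : im phi v -> im phi1 v by move=> [a ->]; exists (B a).
have ker0 g q : phi1 (B g + q * f1) = phi g.
  by rewrite rmorphD rmorphM /= (param_self P) mulr0 addr0.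
(* Two computations of i(f1, x): by Weierstrass division, and as the order of x(t). *)
have ordX : ordt (phi1 fps2X) m.
  have dX := dimq_ideal2_X rf1.
  have [X0|/ordt_exists[n Xn]] := eqVneq (phi1 fps2X) 0.
    by case: (param_imult_infty P X0 dX).
  rewrite (_ : m = n) //.
  exact: dimq_uniq subspaceT (subspace_ideal2 _ _) dX (param_imult P Xn).
split.
- move=> a; split=> [/(param_ker P)[e aE]|[e ->]]; last first.
    by rewrite /= rmorphM rmorphM /= Bf rmorphM /= (param_self P) !mulr0.
  (* The blow up of the remainder r is divisible by f1 but has degree less than m in y, so it
     vanishes. *)
  have [q [r [rm E]]] := Weierstrass_division a rf.
  suff r0 : r = 0 by exists q; rewrite E r0 addr0.
  apply: (@blowup_eq0 _ c); apply: (ydeg_dvd_eq0 rf1); first exact: blowup_ydeg.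
  exists (e - B q * fps2X ^+ m); rewrite mulrBl -aE E rmorphD rmorphM /= Bf.
  by rewrite mulrA addrC addKr.
- by move=> a; rewrite /= (param_coef0 P) blowup_coef00.
- have [b1 b0 b1P] := param_conductor P.
  have [b [q bE]] := blowup_conductor b1.
  have phib : phi b = phi1 fps2X ^+ m.-1 * phi1 b1.
    by rewrite -(ker0 b q) -bE rmorphM rmorphXn.
  exists b => [|s].
    rewrite phib; apply/eqP => /fps1_mul_eq0[E|E]; last by rewrite E eqxx in b0.
    by have := ordt_neq0 (ordtXn m.-1 ordX); rewrite E eqxx.
  have [a1 aE1] := b1P s; have [a [q' aE]] := blowup_conductor a1.
  by exists a; rewrite phib -mulrA -aE1 -(ker0 a q') -aE rmorphM rmorphXn.
(* The codimension of the image of [phi] is counted through the image of [phi1]. *)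
- apply: (dimq_trans subspaceT (subspace_im phi1) (subspace_im phi) _ im_sub (param_dim P)) => //.
  apply: (dimq_rel (rho := fun (h : fps2 K) (s : fps1 K) => s = phi1 h) subspaceT
    subspace_blowup_subalg (subspace_im phi1) (subspace_im phi) _ _ _ _ _ dimq_blowup_subalg).
  + by rewrite raddf0.
  + by move=> a u u' v v' -> ->; rewrite linearP.
  + by move=> h _; exists (phi1 h) => //; exists h.
  + by move=> s [h ->]; exists h.
  + move=> h s ->; split=> [[g [q ->]]|[g /(param_eq _ _ P)[q ->]]].
      by exists g; rewrite ker0.
    by exists g, q.
- have [la lad [Ey Ex]] := param_deriv P.
  (* Along the branch x^(m-1) has order (m - 1) m, twice the increase of d. *)
  exists (phi1 fps2X ^+ m.-1 * la).
    rewrite (_ : _.*2 = m.-1 * m + d1.*2)%N; first by apply: ordtM => //; apply: ordtXn.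
    rewrite doubleD addnC; congr (_ + _)%N.
    by rewrite -mul2n -mul_bin_diag bin1 mulnC.
  have X0 : phi1 fps2X != 0 := ordt_neq0 ordX.
  (* By the chain rule x B(f_y) is the y-derivative of x^m f1; one factor x is cancelled. *)
  have EBy : phi1 (B (fps2_dy f)) = phi1 fps2X ^+ m.-1 * phi1 (fps2_dy f1).
    apply: (fps1_mulfI X0); rewrite mulrA -exprS prednK // -rmorphM -blowup_dy Bf.
    by rewrite fps2_dyM fps2_dyXn mul0r add0r rmorphM rmorphXn.
  (* The derivative of x^m comes with the factor f1, which vanishes along the branch. *)
  have EBx : phi1 (B (fps2_dx f)) = phi1 fps2X ^+ m * phi1 (fps2_dx f1) -
      phi1 (fps2Y + c%:A) * (phi1 fps2X ^+ m.-1 * phi1 (fps2_dy f1)).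
    have /(congr1 phi1) := blowup_dx c f; rewrite Bf fps2_dxM.
    rewrite rmorphD rmorphM /= (param_self P) mulr0 add0r rmorphM rmorphXn /=.
    by rewrite rmorphD rmorphM /= EBy => ->; rewrite addrK.
  have YE : phi fps2Y = phi1 fps2X * phi1 (fps2Y + c%:A) by rewrite /= blowupY rmorphM.
  have dY : deriv1 (phi1 (fps2Y + c%:A)) = deriv1 (phi1 fps2Y).
    by rewrite rmorphD /= linearZ /= rmorph1 deriv1D deriv1_alg addr0.
  rewrite YE phiX deriv1M dY; split; first by rewrite /= EBy Ey mulrA.
  have Xm : phi1 fps2X ^+ m = phi1 fps2X * phi1 fps2X ^+ m.-1.
    by rewrite -exprS prednK.
  by rewrite /= EBx Ey Ex Xm; ring.
Qed.

End Step.
End BlowUpStep.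

(** * Tangents and strict transforms of irreducible series *)

Section Tangent.
Variable K : fieldType.
Implicit Types (f g h q r : fps2 K).

Lemma form_eq0 n f : form n f = 0 <-> forall i j, (i + j)%N = n -> coef2 f i j = 0.
Proof.
split=> [f0 i j ij|f0]; first by rewrite coef2_form ij f0 coef0.
by apply/polyP => j; rewrite coef_form coef0; case: leqP => // le; rewrite f0 ?subnK.
Qed.

Lemma mult_swap m f : mult m f -> mult m (swap f).
Proof.
have E n : form n f = 0 -> form n (swap f) = 0.
  move=> /form_eq0 f0; apply/form_eq0 => i j ij.
  by rewrite coef2_swap f0 // addnC.
move=> [f0 fm]; split=> [k /f0 /E //|].
apply: contra fm => /eqP /form_eq0 f0'; apply/eqP/form_eq0 => i j ij.
by rewrite -[f]swapK coef2_swap f0' // addnC.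
Qed.

Lemma irreducible_bij (Phi : {rmorphism fps2 K -> fps2 K}) f :
  bijective Phi -> irreducible_elt f -> irreducible_elt (Phi f).
Proof.
move=> bij [f0 fu firr]; have [Psi PsiK PhiK] := bij.
have Phi_inj := bij_inj bij.
split=> [||a b E].
- by apply: contra f0 => /eqP E; apply/eqP/Phi_inj; rewrite E rmorph0.
- apply: contra fu => /unitrP[v [vf fv]]; apply/unitrP; exists (Psi v).
  by split; apply: Phi_inj; rewrite rmorphM /= PhiK rmorph1.
- have : f = Psi a * Psi b by apply: Phi_inj; rewrite rmorphM /= !PhiK.
  by move/firr => [u|u]; [left | right]; rewrite -[X in X \is a _]PhiK rmorph_unit.
Qed.

Lemma irreducible_swap f : irreducible_elt f -> irreducible_elt (swap f).
Proof. by apply: irreducible_bij; exists (@swap K); apply: swapK. Qed.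

Lemma irreducible_dvd_regular f q g a : irreducible_elt f -> f = q * g ->
  regular a g -> (0 < a)%N -> regular a f.
Proof.
move=> [_ _ firr] fE rg a0; case: (firr _ _ fE) => [/regular0_unit uq|].
  by rewrite fE -[a]add0n; apply: regularM.
by rewrite fps2_unitE rg.1 ?eqxx.
Qed.

Variable c : K.
Local Notation B := (blowup c).

(* G is x^a g(x, y/x - c), for g normalized as a Weierstrass polynomial of degree
   a; it divides f because the remainder does so after blowing up.  This replaces
   Hensel's lemma: it shows that an irreducible f has a single tangent and that
   its strict transform is again irreducible. *)
Lemma blow_down f e g h a : B f = fps2X ^+ e * (g * h) -> regular a g ->
  exists q G, regular a G /\ f = q * G.
Proof.
move=> Bf /Weierstrass_preparation[u [uu rG0 degG0]].
set G0 := u * g in rG0 degG0.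
have /(blowup_image c)[G GE] : forall n j, (n < j)%N -> coef2 (fps2X ^+ a * G0) n j = 0.
  by move=> n j lt; rewrite coef2_XnM; case: leqP => // le; rewrite degG0 //; lia.
have coefG n k : (form n G \Po ('X + c%:P))`_k = if (a <= n)%N then coef2 G0 (n - a) k else 0.
  by rewrite -coef2_blowup -GE coef2_XnM.
have rG : regular a G.
  split=> [j lt|].
    rewrite coef2_form add0n -(comp_shiftK c (form j G)) (_ : form j G \Po _ = 0).
      by rewrite comp_poly0 coef0.
    by apply/polyP => k; rewrite coefG leqNgt lt coef0.
  (* Up to the shift by c, this form is the polynomial [G0] at x = 0, of exact degree a; its leading
     coefficient is the coefficient of y^a in G. *)
  have sz : size (form a G) = a.+1.
    rewrite -(size_shift c); apply/eqP; rewrite eqn_leq; apply/andP; split.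
      apply/leq_sizeP => k lt; rewrite coefG leqnn subnn.
      exact: degG0.
    by rewrite ltnNge; apply/negP => /leq_sizeP/(_ a (leqnn a));
      rewrite coefG leqnn subnn => /eqP; apply/negP; case: rG0.
  rewrite coef2_form add0n -[X in _`_X]/(a.+1.-1) -sz -/(lead_coef _) lead_coef_eq0.
  by rewrite -size_poly_eq0 sz.
have [q [r [ra fE]]] := Weierstrass_division f rG.
exists q, G; split=> //.
suff r0 : r = 0 by rewrite fE r0 addr0.
apply: (@blowup_eq0 _ c); apply: (ydeg_dvd_eq0 rG0); first exact: blowup_ydeg.
exists (fps2X ^+ e * h * u^-1 - B q * fps2X ^+ a).
have -> : B r = fps2X ^+ e * (g * h) - B q * (fps2X ^+ a * G0).
  by rewrite GE -Bf fE rmorphD rmorphM /= addrC addKr.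
rewrite mulrBl; congr (_ - _); last by rewrite mulrA.
have -> : fps2X ^+ e * h * u^-1 * G0 = fps2X ^+ e * (g * h) * (u^-1 * u) by rewrite /G0; ring.
by rewrite mulVr // mulr1.
Qed.

(** The order a of f1(0, y) is positive because c is a root, and at most m because the form has
    degree at most m. A factor of f1 that is regular of order b > 0 gives by [blow_down] a divisor
    of f of the same order, so f itself is regular of order b and m <= b <= a <= m. Thus every
    nonunit factor of f1 takes up the whole order, and its cofactor is a unit. *)
Lemma irreducible_blowup f m : irreducible_elt f -> mult m f -> root (form m f) c ->
  exists f1, [/\ B f = fps2X ^+ m * f1, regular m f, regular m f1 & irreducible_elt f1].
Proof.
move=> firr mf rc; pose f1 := Fps2 (fun n k => coef2 (B f) (n + m) k).
have Bf : B f = fps2X ^+ m * f1.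
  apply: fps2P => n k; rewrite coef2_XnM; case: leqP => [le|lt].
    by rewrite -[RHS]/(coef2 (B f) (n - m + m) k) subnK.
  by rewrite coef2_blowup mf.1 // comp_poly0 coef0.
set p := form m f \Po ('X + c%:P).
have f10 k : coef2 f1 0 k = p`_k by rewrite -[LHS]/(coef2 (B f) m k) coef2_blowup.
have p0 : p != 0 by rewrite -size_poly_eq0 size_shift size_poly_eq0; case: mf.
have [a ra lea] : exists2 a, regular a f1 & (a <= m)%N.
  have lp : coef2 f1 0 (size p).-1 != 0 by rewrite f10 -/(lead_coef p) lead_coef_eq0.
  have [a ra lea] := lead_exists lp; exists a => //; apply: leq_trans lea _.
  by rewrite /p size_shift -ltnS; case: size (size_form m f).
have a_gt0 : (0 < a)%N.
  rewrite lt0n; apply/eqP => a0; move: ra.2; rewrite a0 f10 -horner_coef0 horner_comp.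
  by rewrite !hornerE (eqP rc) eqxx.
have reg b g h : f1 = g * h -> regular b g -> (0 < b)%N -> b = m /\ regular b f.
  move=> f1E rg b0; have [q [G [rG fE]]] : exists q G, regular b G /\ f = q * G.
    by apply: (@blow_down f m g h) => //; rewrite -f1E.
  have rf := irreducible_dvd_regular firr fE rG b0; split=> //.
  apply/eqP; rewrite eqn_leq (mult_le_regular mf rf) andbT.
  move: ra; rewrite f1E => /regularM_inv[a' [b' [ab' ra' _]]].
  by rewrite (lead_uniq rg ra') (leq_trans _ lea) // -ab' leq_addr.
have [am rf] : a = m /\ regular a f by apply: (reg a f1 1) => //; rewrite mulr1.
rewrite am in ra rf a_gt0; exists f1; split=> //; split.
- by apply/negP => /eqP f10'; move: ra.2; rewrite f10' eqxx.
- by rewrite fps2_unitE ra.1 ?eqxx.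
- move=> g h f1E; move: (ra); rewrite f1E => /regularM_inv[a' [b' [ab' ra' rb']]].
  have [a'0|a'_gt0] := posnP a'; first by left; apply/regular0_unit; rewrite -a'0.
  right; have [a'm _] := reg a' g h f1E ra' a'_gt0.
  by apply/regular0_unit; rewrite (_ : 0%N = b') //; lia.
Qed.
End Tangent.

(** * Existence of parametrizations *)

Section Resolution.
Variable K : closedFieldType.
Implicit Types (f g h q r : fps2 K).

Definition tail_series (C : nat -> K) : fps1 K :=
  Fps1 (fun n => if n is k.+1 then C k else 0).

Lemma blowup_xseries c (s : fps1 K) : blowup c (xseries s) = xseries s.
Proof.
apply: fps2P => n k; rewrite coef2_blowup (_ : form n _ = (tcoef s n)%:P).
  by rewrite comp_polyC coefC coef2_xseries.
apply/polyP => j; rewrite coef_form coefC coef2_xseries.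
by case: j => [|j]; rewrite ?subn0 // if_same.
Qed.

(** Blowing up the curve y = c_0 x + c_1 x^2 + ... in the direction of its tangent gives y = c_1 x +
    c_2 x^2 + .... *)
Lemma blowup_smooth C : blowup (C 0%N) (fps2Y - xseries (tail_series C)) =
  fps2X * (fps2Y - xseries (tail_series (C \o S))).
Proof.
rewrite rmorphB /= blowupY blowup_xseries.
suff -> : xseries (tail_series C) =
    fps2X * ((C 0%N)%:A + xseries (tail_series (C \o S))) by ring.
apply: fps2P => i j; rewrite coef2_XM coef2_xseries.
case: i => [|i]; first by rewrite if_same.
rewrite coef2D coef2_alg coef2_xseries; case: j => [|j]; rewrite ?andbF ?addr0 //=.
by case: i => [|i] /=; rewrite ?mulr1n ?mulr0n ?addr0 ?add0r.
Qed.

Lemma regular_smooth C : regular 1 (fps2Y - xseries (tail_series C)).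
Proof.
have E j : coef2 (fps2Y - xseries (tail_series C)) 0 j = (j == 1%N)%:R.
  rewrite coef2B coef2_xseries -[coef2 fps2Y 0 j]/((j == 1%N)%:R).
  by case: j => [|j] /=; rewrite subr0.
by split=> [[|//] _|]; rewrite E ?oner_neq0.
Qed.

(* If the multiplicity never dropped, the tangents c_k would define a smooth curve
   y = sum_k c_k x^(k+1) contained in f: the value of f on it is x^m times the
   value of the strict transform on the blown up curve, hence divisible by every
   power of x. *)
Lemma not_all_blowups_tangent (m : nat) (F : nat -> fps2 K) (C : nat -> K) :
    (1 < m)%N -> (forall k, regular m (F k)) ->
    (forall k, blowup (C k) (F k) = fps2X ^+ m * F k.+1) ->
  ~ irreducible_elt (F 0%N).
Proof.
move=> m1 rF BF firr.
pose W k : fps2 K := fps2Y - xseries (tail_series (fun i => C (k + i)%N)).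
have rW k : regular 1 (W k) by apply: regular_smooth.
have xs1 (s : fps1 K) : ydeg_lt 1 (xseries s) by move=> i [|j].
have BW k : blowup (C k) (W k) = fps2X * W k.+1.
  rewrite -[C k](congr1 C (addn0 k)) (blowup_smooth (fun i => C (k + i)%N)).
  congr (_ * (_ - xseries (tail_series _))).
  by apply/funext => i /=; rewrite addnS addSn.
have val k : exists q s, F k = q * W k + xseries s.
  have [q [r [r1 ->]]] := Weierstrass_division (F k) (rW k).
  exists q, (at_y0 r); congr (_ + _).
  by apply: fps2P => i [|j] //; rewrite coef2_xseries r1.
have xsX : xseries (fps1X : fps1 K) = fps2X.
  by apply: fps2P => i j; rewrite coef2_xseries -[RHS]/(((i == 1%N) && (j == 0%N))%:R);
    case: j => [|j]; rewrite ?andbT ?andbF.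
(* Uniqueness of the remainder modulo [W k.+1] compares the values of consecutive strict transforms
   on their curves. *)
have val_step k q s q' s' : F k = q * W k + xseries s ->
    F k.+1 = q' * W k.+1 + xseries s' -> s = fps1X ^+ m * s'.
  move=> E E'; have := BF k; rewrite E E' rmorphD rmorphM /= BW blowup_xseries.
  have -> : fps2X ^+ m * (q' * W k.+1 + xseries s') =
      fps2X ^+ m * q' * W k.+1 + xseries (fps1X ^+ m * s').
    rewrite xseriesM (_ : xseries (fps1X ^+ m) = fps2X ^+ m); first by ring.
    elim: (m) => [|n IH]; first exact: xseries_one.
    by rewrite !exprS xseriesM xsX IH.
  rewrite mulrA => /(Weierstrass_uniq (rW k.+1) (xs1 _) (xs1 _)) [_].
  exact: (can_inj (@xseriesK K)).
(* The induction on n is for all k at once, as each step passes to the next strict transform. *)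
have low n : forall k q s, F k = q * W k + xseries s ->
    forall i, (i < n)%N -> tcoef s i = 0.
  elim: n => // n IH k q s E i lti; have [q' [s' E']] := val k.+1.
  rewrite (val_step _ _ _ _ _ E E') tcoef_XnM; case: leqP => // lemi.
  by apply: (IH _ _ _ E'); lia.
have [q [s E]] := val 0%N.
have s0 : s = 0 by apply: fps1P => i; apply: (low i.+1 _ _ _ E).
have xs0 : xseries (0 : fps1 K) = 0.
  by apply: fps2P => i j; rewrite coef2_xseries tcoef0 if_same.
have FE : F 0%N = q * W 0%N by rewrite E s0 xs0 addr0.
have := irreducible_dvd_regular firr FE (rW 0%N) isT.
by move/(lead_uniq (rF 0%N)) => m1E; rewrite m1E in m1.
Qed.

(** Induction on the multiplicity m. A counterexample of multiplicity m has a strict transform that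
    is again a counterexample, of the same multiplicity by induction; iterating contradicts
    [not_all_blowups_tangent]. *)
Theorem param_exists f : irreducible_elt f ->
  exists (phi : {lrmorphism fps2 K -> fps1 K}) d, is_param f phi d.
Proof.
move=> firr; have [m mf] : exists m, mult m f by apply: mult_exists; case: firr.
elim/ltn_ind: m f firr mf => m IH f firr mf.
have m_gt0 : (0 < m)%N.
  rewrite lt0n; apply/negP => /eqP m0; rewrite m0 in mf.
  by case: firr => _ /negP + _; apply; apply/mult0_unit.
(* If the lowest form is a constant polynomial, it is a multiple of x^m, and exchanging the
   variables makes the series regular. Otherwise it has a root and [irreducible_blowup] gives
   regularity. *)
suff regP g : irreducible_elt g -> mult m g -> regular m g ->
    exists (phi : {lrmorphism fps2 K -> fps1 K}) d, is_param g phi d.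
  have [sz|sz] := boolP (size (form m f) != 1%N).
    have [c rc] := closed_rootP _ sz.
    by have [f1 [_ rf _ _]] := irreducible_blowup firr mf rc; apply: regP.
  have rsf : regular m (swap f).
    split=> [k lt|]; first by rewrite coef2_form add0n (mult_swap mf).1 // coef0.
    have /size_poly1P[a a0 fE] : size (form m f) == 1%N by rewrite -[_ == _]negbK.
    by rewrite coef2_swap coef2_form addn0 fE coefC.
  have [phi [d P]] := regP _ (irreducible_swap firr) (mult_swap mf) rsf.
  by have [psi] := param_swap P; exists psi, d.
move=> girr mg rg; apply: contrapT => ng.
pose Bad h := [/\ irreducible_elt h, mult m h, regular m h &
   ~ exists (phi : {lrmorphism fps2 K -> fps1 K}) d, is_param h phi d].
have m_gt1 : (1 < m)%N.
  rewrite ltn_neqAle m_gt0 andbT; apply/eqP => m1; apply: ng.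
  by rewrite -m1 in rg; have [phi [P _]] := param_smooth rg; exists phi, 0%N.
have next h : exists ch : K * fps2 K, Bad h ->
    blowup ch.1 h = fps2X ^+ m * ch.2 /\ Bad ch.2.
  case: (pselect (Bad h)) => [[hirr mh rh nh]|nBad]; last by exists (0, 0) => /nBad.
  have sz : size (form m h) != 1%N.
    apply/negP => /size_poly1P[a a0 hE]; move: rh.2.
    by rewrite coef2_form add0n hE coefC gtn_eqF // eqxx.
  have [c rc] := closed_rootP _ sz.
  have [h1 [Bh _ rh1 h1irr]] := irreducible_blowup hirr mh rc.
  exists (c, h1) => _; split=> //.
  have nh1 : ~ exists (phi : {lrmorphism fps2 K -> fps1 K}) d, is_param h1 phi d.
    by move=> [phi [d P]]; apply: nh; apply: (param_blowup m_gt0 rh rh1 Bh P).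
  split=> //; have [m1 mh1] : exists m1, mult m1 h1 by apply: mult_exists; case: h1irr.
  (* Regularity of order m bounds the multiplicity of [h1] by m; below m the induction hypothesis
     applies. *)
  have := mult_le_regular mh1 rh1; rewrite leq_eqVlt => /orP[/eqP<-//|lt].
  by case: nh1; apply: (IH _ lt).
have [nx nxP] := choice next.
pose F k := iter k (fun h => (nx h).2) g.
have FBad k : Bad (F k) by elim: k => [|k IHk] //=; case: (nxP _ IHk).
apply: (@not_all_blowups_tangent m F (fun k => (nx (F k)).1)) => //.
- by move=> k; case: (FBad k).
- by move=> k; case: (nxP _ (FBad k)).
Qed.

End Resolution.

(** * The delta invariant from the branches *)

(** Without a monic relation, induction makes every initial segment of v independent modulo W,
    including the one of length d + 1. *)
Lemma monic_relation_mod (K : fieldType) (V : lmodType K) (U W : set V) d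
    (v : nat -> V) :
    subspace U -> subspace W -> dimq U W d -> (forall k, U (v k)) ->
  exists n (c : 'I_n -> K), W (v n + \sum_(i < n) c i *: v i).
Proof.
move=> sU sW dU Uv; apply: contrapT => nex.
have ind n : indep_mod W (fun i : 'I_n => v i).
  elim: n => [|n IH] c; first by move=> _; apply/rowP => -[].
  rewrite big_ord_recr /= => Wc.
  have cn0 : c 0 ord_max = 0.
    apply/eqP/negPn/negP => cn; apply: nex.
    exists n, (fun i => (c 0 ord_max)^-1 * c 0 (widen_ord (leqnSn n) i)).
    under eq_bigr do rewrite -scalerA; rewrite -scaler_sumr addrC.
    rewrite -[X in _ + X]scale1r -(mulVf cn) -scalerA -scalerDr.
    exact: subspaceZ.
  have c'0 : \row_i c 0 (widen_ord (leqnSn n) i) = 0 :> 'rV_n.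
    apply: IH; under eq_bigr do rewrite mxE.
    by move: Wc; rewrite cn0 scale0r addr0.
  apply/rowP => i; rewrite mxE; have [lti|] := ltnP i n.
    move/rowP/(_ (Ordinal lti)): c'0; rewrite !mxE => <-.
    by congr (c 0 _); apply: val_inj.
  by move=> lein; rewrite -[RHS]cn0; congr (c 0 _); apply: val_inj => /=;
    have := ltn_ord i; lia.
by have := indep_mod_le sU sW dU (fun i => Uv _) (@ind d.+1); rewrite ltnn.
Qed.

(** K[[t]] is integrally closed: if A had smaller order than B, then B = A e with e(0) = 0, and the
    equation would become A^n times a series with constant term 1. *)
Lemma fps1_integral_dvd (K : fieldType) (A B : fps1 K) n (C : 'I_n -> fps1 K) :
    B != 0 -> A ^+ n + \sum_(k < n) C k * A ^+ k * B ^+ (n - k) = 0 ->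
  exists s, A = B * s.
Proof.
move=> B0 E; have [b Bb] := ordt_exists B0.
apply/(ordt_dvd _ Bb) => k ltkb; apply/eqP/negPn/negP => Ak.
have [a Aa leak] := lead_exists Ak.
have ltab : (a < b)%N by apply: leq_ltn_trans ltkb.
have /(ordt_dvd _ Aa)[e BE] : forall j, (j < a)%N -> tcoef B j = 0.
  by move=> j lt; rewrite Bb.1 //; lia.
have e0 : tcoef e 0 = 0.
  apply/eqP/negPn/negP => e0; have ord_e : ordt e 0 by [].
  by have := ordtM Aa ord_e; rewrite -BE addn0 => /(ordt_uniq Bb); lia.
have en j : (0 < j)%N -> tcoef (e ^+ j) 0 = 0.
  by case: j => // j _; rewrite exprS tcoefM_0 e0 mul0r.
have : A ^+ n * (1 + \sum_(k < n) C k * e ^+ (n - k)) = 0.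
  rewrite -[RHS]E mulrDr mulr1 mulr_sumr BE; congr (_ + _); apply: eq_bigr => i _.
  have -> : A ^+ n = A ^+ i * A ^+ (n - i) by rewrite -exprD subnKC // ltnW.
  by rewrite exprMn; ring.
case/fps1_mul_eq0 => [An0|].
  by have := ordt_neq0 (ordtXn n Aa); rewrite An0 eqxx.
move/(congr1 (fun s => tcoef s 0)); rewrite tcoefD tcoef1 tcoef0.
have -> : tcoef (\sum_(k < n) C k * e ^+ (n - k)) 0 = 0.
  apply: (big_ind (fun s => tcoef s 0 = 0)) => // [s t s0 t0|i _].
    by rewrite tcoefD s0 t0 addr0.
  by rewrite tcoefM_0 en ?mulr0 // subn_gt0.
by move/eqP; rewrite addr0 oner_eq0.
Qed.

Section Normalization.
Variables (K : fieldType) (f : fps2 K) (r : nat)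
  (phi : 'I_r -> {lrmorphism fps2 K -> fps1 K}) (d : nat).

Definition im_family : set {ffun 'I_r -> fps1 K} :=
  [set s | exists a, forall i, s i = phi i a].

(** The ring K[[x,y]]/f embeds into K[[t]]^r with codimension d, and the conductor contains an
    element that vanishes on no branch, so that both rings have the same total ring of fractions. *)
Record is_param_family : Prop := IsParamFamily {
  family_ker : forall a, (forall i, phi i a = 0) <-> exists c, a = c * f;
  family_conductor : exists2 b, forall i, phi i b != 0 &
    forall s : 'I_r -> fps1 K, exists a, forall i, phi i a = phi i b * s i;
  family_dim : dimq setT im_family d }.

Lemma subspace_im_family : subspace im_family.
Proof.
split=> [|c u v [a aE] [b bE]]; first by exists 0 => i; rewrite ffunE raddf0.
by exists (c *: a + b) => i; rewrite !ffunE linearP aE bE.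
Qed.

Definition curve_fun (a : fps2 K) : curve_frac f := curve_to_frac (to_pquot f a).

Fact curve_fun_is_zmod_morphism : zmod_morphism curve_fun.
Proof. by move=> a b; rewrite /curve_fun /curve_to_frac !raddfB. Qed.
HB.instance Definition _ := GRing.isZmodMorphism.Build (fps2 K) (curve_frac f)
  curve_fun curve_fun_is_zmod_morphism.
Fact curve_fun_is_monoid_morphism : monoid_morphism curve_fun.
Proof.
split; first by rewrite /curve_fun /curve_to_frac !rmorph1.
by move=> a b; rewrite /curve_fun /curve_to_frac !rmorphM.
Qed.
HB.instance Definition _ := GRing.isMonoidMorphism.Build (fps2 K) (curve_frac f)
  curve_fun curve_fun_is_monoid_morphism.

Lemma curve_fun_eq0 a : curve_fun a = 0 <-> exists c, a = c * f.
Proof.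
rewrite /curve_fun /curve_to_frac -[0](raddf0 (@to_totfrac (pquot f))).
split=> [/tfrac_classP|[c ->]]; last first.
  by congr to_totfrac; rewrite -(raddf0 (to_pquot f)); apply/to_pquotP; exists c;
    rewrite subr0.
rewrite /= !mulr1 -(raddf0 (to_pquot f)) => /to_pquotP[c].
by rewrite subr0; exists c.
Qed.

Lemma curve_scaleE (c : K) (z : curve_frac f) : c *: z = curve_fun c%:A * z.
Proof. by []. Qed.

Hypothesis P : is_param_family.

(** If b vanishes on branch i, the conductor supplies a series that is nonzero on this branch only;
    its class is nonzero and killed by b. *)
Lemma nzd_family b : nzd (to_pquot f b) <-> forall i, phi i b != 0.
Proof.
split=> [/asboolP rb i|b0].
  apply/eqP => bi0; have [b1 b10 b1P] := family_conductor P.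
  have [a aE] := b1P (fun j => (j == i)%:R).
  have : to_pquot f b * to_pquot f a = to_pquot f b * 0.
    rewrite mulr0 -rmorphM -(raddf0 (to_pquot f)); apply/to_pquotP.
    rewrite subr0; apply/(family_ker P) => j; rewrite rmorphM /= aE.
    by case: eqP => [->|_]; rewrite ?bi0 ?mul0r ?mulr0.
  move/rb; rewrite -(raddf0 (to_pquot f)) => /to_pquotP; rewrite subr0.
  move/(family_ker P)/(_ i); rewrite aE eqxx mulr1 => E.
  by have := b10 i; rewrite E eqxx.
apply/asboolP => u v; elim/Defs.pquotW: u => u; elim/Defs.pquotW: v => v.
rewrite -!rmorphM => /to_pquotP; rewrite -mulrBr => /(family_ker P) E.
apply/to_pquotP/(family_ker P) => i; have := E i; rewrite rmorphM /=.
by case/fps1_mul_eq0 => // E'; have := b0 i; rewrite E' eqxx.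
Qed.

Lemma curve_frac_surj (z : curve_frac f) :
  exists a b, (forall i, phi i b != 0) /\ z * curve_fun b = curve_fun a.
Proof.
elim/Defs.totfracW: z => -[]; elim/Defs.pquotW => a; elim/Defs.pquotW => b nb.
exists a, b; split; first exact/nzd_family.
rewrite /curve_fun /curve_to_frac /to_totfrac [LHS]Defs.mulE.
by apply/tfrac_classP; rewrite /= !mulr1.
Qed.

Lemma curve_fun_inv b : (forall i, phi i b != 0) ->
  exists w, curve_fun b * w = 1.
Proof.
move=> /nzd_family nb; exists (tfrac_class (TFrac 1 nb)).
by rewrite /curve_fun [LHS]Defs.mulE; apply/tfrac_classP; rewrite /= !mulr1 !mul1r.
Qed.

(* z = a/b in Q(R), with s the value of a/b along the branches. *)
Definition frac_rel (s : 'I_r -> fps1 K) (z : curve_frac f) : Prop :=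
  exists a b, [/\ forall i, phi i b != 0, z * curve_fun b = curve_fun a &
    forall i, phi i a = phi i b * s i].

Lemma frac_rel_fun e : frac_rel (fun i => phi i e) (curve_fun e).
Proof.
by exists e, 1; split=> [i||i]; rewrite ?rmorph1 ?mulr1 ?mul1r ?oner_neq0.
Qed.

Lemma frac_relM s s' z z' : frac_rel s z -> frac_rel s' z' ->
  frac_rel (fun i => s i * s' i) (z * z').
Proof.
move=> [a [b [b0 zE sE]]] [a' [b' [b0' zE' sE']]].
exists (a * a'), (b * b'); split=> [i||i].
- by rewrite rmorphM; apply/eqP => /fps1_mul_eq0[E|E]; [have := b0 i|have := b0' i];
  rewrite E eqxx.
- by rewrite !rmorphM /= -zE -zE'; ring.
- by rewrite !rmorphM /= sE sE'; ring.
Qed.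

Lemma frac_relP c s s' z z' : frac_rel s z -> frac_rel s' z' ->
  frac_rel (fun i => c *: s i + s' i) (c *: z + z').
Proof.
move=> [a [b [b0 zE sE]]] [a' [b' [b0' zE' sE']]].
exists (c *: a * b' + a' * b), (b * b'); split=> [i||i].
- by rewrite rmorphM; apply/eqP => /fps1_mul_eq0[E|E]; [have := b0 i|have := b0' i];
  rewrite E eqxx.
- by rewrite curve_scaleE -[c *: a]mulr_algl rmorphD !rmorphM /= -zE -zE'; ring.
- by rewrite rmorphD !rmorphM /= linearZ /= sE sE' -[c *: s i]mulr_algl -[c *: (_ * _)]mulr_algl; ring.
Qed.

Lemma frac_relX s z n : frac_rel s z -> frac_rel (fun i => s i ^+ n) (z ^+ n).
Proof.
move=> sz; elim: n => [|n IH].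
  have -> : (fun i : 'I_r => s i ^+ 0) = fun i => phi i 1.
    by apply/funext => i; rewrite rmorph1.
  by rewrite expr0 -(rmorph1 curve_fun); apply: frac_rel_fun.
have -> : (fun i => s i ^+ n.+1) = fun i => s i * s i ^+ n.
  by apply/funext => i; rewrite exprS.
by rewrite exprS; apply: frac_relM.
Qed.

Lemma frac_rel_im s z e : frac_rel s z -> (forall i, s i = phi i e) <-> z = curve_fun e.
Proof.
move=> [a [b [b0 zE sE]]]; have [w bw] := curve_fun_inv b0; split=> [se|ze].
  have /eqP : curve_fun (a - e * b) = 0.
    apply/curve_fun_eq0/(family_ker P) => i.
    by rewrite rmorphB rmorphM /= sE se mulrC subrr.
  rewrite rmorphB rmorphM /= -zE -mulrBl => /eqP E.
  apply/subr0_eq; rewrite -[LHS]mulr1 -bw mulrA E mul0r //.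
move=> i; apply: (fps1_mulfI (b0 i)); rewrite -sE -rmorphM.
have /curve_fun_eq0/(family_ker P)/(_ i) : curve_fun (a - b * e) = 0.
  by rewrite rmorphB rmorphM /= -zE ze mulrC subrr.
by rewrite rmorphB => /subr0_eq.
Qed.

(** Powers of s satisfy a monic relation with coefficients in K modulo the image of K[[x,y]], which
    has finite codimension; the defect e of the relation becomes the constant term of an integral
    equation for z. *)
Lemma frac_rel_integral s z : frac_rel s z -> normalization z.
Proof.
(* The exponents start at 1, which leaves the term of degree 0 free for [- e]. *)
move=> sz; pose v k : {ffun 'I_r -> fps1 K} := [ffun i => s i ^+ k.+1].
have [n [c [e E]]] := monic_relation_mod (v := v) subspaceT subspace_im_family
  (family_dim P) (fun=> I).
exists n.+1, (fun i => to_pquot f (if unlift ord0 i is Some j then (c j)%:A else - e)).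
have sum_rel : frac_rel (fun i => (v n + \sum_(j < n) c j *: v j) i)
    (z ^+ n.+1 + \sum_(j < n) c j *: z ^+ j.+1).
  have vk k : frac_rel (v k) (z ^+ k.+1).
    by have := frac_relX k.+1 sz; congr frac_rel; apply/funext => i; rewrite ffunE.
  rewrite ![_ + \sum_(_ < _) _]addrC.
  elim: (index_enum _) => [|j l IH]; first by rewrite !big_nil !add0r; apply: vk.
  have := frac_relP (c j) (vk j) IH; rewrite !big_cons -!addrA.
  by congr frac_rel; apply/funext => i; rewrite !ffunE.
have := (frac_rel_im e sum_rel).1 E => zE.
rewrite big_ord_recl unlift_none /= expr0 mulr1 addrCA.
under eq_bigr do rewrite liftK; rewrite -[curve_to_frac _]/(curve_fun (- e)) rmorphN /=.
apply/eqP; rewrite addrC subr_eq0; apply/eqP; rewrite -zE; congr (_ + _).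
Qed.

(** For z = a/b, multiply the integral equation by b^n; along each branch [fps1_integral_dvd] then
    makes b divide a. *)
Lemma integral_frac_rel z : normalization z -> exists s : {ffun 'I_r -> fps1 K}, frac_rel s z.
Proof.
move=> [n [c0 E]]; have [a [b [b0 zE]]] := curve_frac_surj z.
have exc k : exists a', c0 k = to_pquot f a'.
  by elim/Defs.pquotW: (c0 k) => a'; exists a'.
have [c cE] := choice exc.
have int_eq : curve_fun (a ^+ n + \sum_(k < n) c k * a ^+ k * b ^+ (n - k)) = 0.
  rewrite rmorphD rmorphXn /= -zE -[RHS](mul0r (curve_fun b ^+ n)) -E mulrDl exprMn.
  congr (_ + _); rewrite raddf_sum mulr_suml; apply: eq_bigr => k _.
  rewrite /= !rmorphM /= !rmorphXn /= -zE exprMn cE -[curve_to_frac _]/(curve_fun (c k)).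
  have -> : curve_fun b ^+ n = curve_fun b ^+ k * curve_fun b ^+ (n - k).
    by rewrite -exprD subnKC // ltnW.
  by ring.
have ex i : exists s, phi i a = phi i b * s.
  have /curve_fun_eq0/(family_ker P)/(_ i) := int_eq.
  rewrite rmorphD rmorphXn raddf_sum /= => Ei.
  apply: (@fps1_integral_dvd _ _ _ n (fun k => phi i (c k))) => //.
  rewrite -[RHS]Ei; congr (_ + _); apply: eq_bigr => k _.
  by rewrite !rmorphM /= !rmorphXn.
have [s sE] := choice ex; exists [ffun i => s i], a, b; split=> // i.
by rewrite ffunE.
Qed.

(** A conductor element b is a common denominator: b s is the value of some series a. *)
Lemma frac_rel_total s : exists z, frac_rel s z.
Proof.
have [b b0 /(_ s)[a aE]] := family_conductor P.
have [w bw] := curve_fun_inv b0.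
exists (curve_fun a * w), a, b; split; [exact: b0 | | exact: aE].
  by rewrite -mulrA [w * _]mulrC bw mulr1.
Qed.

Lemma frac_rel0 : frac_rel (fun=> 0) 0.
Proof. by exists 0, 1; split=> [i||i];
  rewrite ?rmorph1 ?raddf0 ?mulr1 ?mulr0 ?oner_neq0. Qed.

Lemma subspace_normalization : subspace (@normalization K f).
Proof.
split; first exact: frac_rel_integral frac_rel0.
move=> c u v /integral_frac_rel[s su] /integral_frac_rel[t tv].
exact: frac_rel_integral (frac_relP c su tv).
Qed.

Lemma range_curve_to_frac : range (@curve_to_frac K f) = [set z | exists e, z = curve_fun e].
Proof.
apply/seteqP; split=> [z [a _ <-]|z [e ->]]; last by exists (to_pquot f e).
by elim/Defs.pquotW: a => a; exists a.
Qed.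

Lemma subspace_range : subspace (range (@curve_to_frac K f)).
Proof.
rewrite range_curve_to_frac; split=> [|c u v [a ->] [b ->]].
  by exists 0; rewrite raddf0.
by exists (c%:A * a + b); rewrite rmorphD rmorphM.
Qed.

Lemma delta_family : delta f = d%:Z%:E.
Proof.
apply: quotient_dimE; [exact: subspace_normalization | exact: subspace_range |].
apply: (dimq_rel (rho := fun (s : {ffun 'I_r -> fps1 K}) (z : curve_frac f) => frac_rel s z)
  subspaceT subspace_im_family subspace_normalization subspace_range _ _ _ _ _ (family_dim P)).
- by have := frac_rel0; congr frac_rel; apply/funext => i; rewrite ffunE.
- move=> c u u' v v' uu' vv'; have := frac_relP c uu' vv'.
  by congr frac_rel; apply/funext => i; rewrite !ffunE.
- by move=> s _; have [z sz] := frac_rel_total s; exists z => //;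
  apply: frac_rel_integral sz.
- by move=> z /integral_frac_rel[s sz]; exists s.
- move=> s z sz; rewrite range_curve_to_frac; split=> -[e eE]; exists e.
    exact/(frac_rel_im e sz).
  exact/(frac_rel_im e sz).
Qed.

End Normalization.

Lemma all_ord_recl r (P : 'I_r.+1 -> Prop) :
  P ord0 -> (forall j, P (lift ord0 j)) -> forall i, P i.
Proof. by move=> P0 PS i; case: (unliftP ord0 i) => [j|] ->. Qed.

(** * Unions of branches *)

Section ParamFamilies.
Variable K : fieldType.
Implicit Types (f g h : fps2 K) (phi : {lrmorphism fps2 K -> fps1 K}).

Lemma family_unit f (phi : 'I_0 -> {lrmorphism fps2 K -> fps1 K}) :
  f \is a GRing.unit -> is_param_family f phi 0.
Proof.
move=> uf; split.
- by move=> a; split=> [_|_ []//]; exists (a / f); rewrite divrK.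
- by exists 1 => [[]//|s]; exists 1 => -[].
- exists (fun _ => 0); apply/(basis_modP _ subspaceT (subspace_im_family _)).
  split=> // [c _|v _]; first by apply/rowP => -[].
  by exists 0; exists 0 => -[].
Qed.

Lemma family_mul_unit f g u r (phi : 'I_r -> {lrmorphism fps2 K -> fps1 K}) d :
  u \is a GRing.unit -> f = u * g -> is_param_family g phi d -> is_param_family f phi d.
Proof.
move=> uu fE P; split; [|exact: family_conductor P|exact: family_dim P].
move=> a; rewrite (family_ker P); split=> -[c ->]; last by exists (c * u);
  rewrite fE mulrA.
by exists (c / u); rewrite fE mulrA divrK.
Qed.

(* delta(fg) = delta(f) + delta(g) + i(f,g): the image of K[[x,y]] in
   K[[x,y]]/f * K[[x,y]]/g has cokernel K[[x,y]]/(f,g). *)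
Lemma family_cons f g r (phi : 'I_r.+1 -> {lrmorphism fps2 K -> fps1 K}) d0 d n :
    is_param f (phi ord0) d0 -> is_param_family g (fun j => phi (lift ord0 j)) d ->
    ordt (phi ord0 g) n -> (forall j, phi (lift ord0 j) f != 0) ->
  is_param_family (f * g) phi (d0 + d + n).
Proof.
move=> P Q gn fj0; have g0 := ordt_neq0 gn.
have Qg j : phi (lift ord0 j) g = 0.
  by move: j; apply/(family_ker Q); exists 1; rewrite mul1r.
have dn := param_imult P gn.
split.
- move=> a; split=> [a0|[c ->]]; last first.
    apply: all_ord_recl => [|j].
      by rewrite rmorphM rmorphM /= (param_self P) mul0r mulr0.
    by rewrite rmorphM rmorphM /= Qg !mulr0.
  have /(param_ker P)[c aE] := a0 ord0.
  have /(family_ker Q)[c' cE] : forall j, phi (lift ord0 j) c = 0.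
    move=> j; have := a0 (lift ord0 j); rewrite aE rmorphM => /fps1_mul_eq0[//|E].
    by have := fj0 j; rewrite E eqxx.
  by exists c'; rewrite aE cE -mulrA [g * f]mulrC.
- have [b b0 bP] := param_conductor P; have [b' b0' bP'] := family_conductor Q.
  have E0 h h' : phi ord0 (h * g + h' * f) = phi ord0 h * phi ord0 g.
    by rewrite rmorphD !rmorphM /= (param_self P) mulr0 addr0.
  have E1 j h h' : phi (lift ord0 j) (h * g + h' * f) =
      phi (lift ord0 j) h' * phi (lift ord0 j) f.
    by rewrite rmorphD !rmorphM /= Qg mulr0 add0r.
  (* Only b g survives on the branch of f, and only b' f on the others. *)
  exists (b * g + b' * f) => [|s].
    apply: all_ord_recl => [|j].
      by rewrite E0; apply/eqP => /fps1_mul_eq0[]; apply/eqP.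
    by rewrite E1; apply/eqP => /fps1_mul_eq0[]; apply/eqP; [apply: b0'|apply: fj0].
  have [a aE] := bP (s ord0); have [a' aE'] := bP' (fun j => s (lift ord0 j)).
  exists (a * g + a' * f); apply: all_ord_recl => [|j].
    by rewrite !E0 aE; ring.
  by rewrite !E1 aE'; ring.
(* [M1] asks the first component to come from a series, [M] also the others from a common one, and
   the image all of them from the same one; the successive codimensions are d0, d and n. *)
- pose M1 : set {ffun 'I_r.+1 -> fps1 K} := [set s | im (phi ord0) (s ord0)].
  pose M : set {ffun 'I_r.+1 -> fps1 K} :=
    [set s | M1 s /\ exists a, forall j, s (lift ord0 j) = phi (lift ord0 j) a].
  have sM1 : subspace M1.
    split=> [|c u v [a aE] [b bE]]; first by exists 0; rewrite ffunE raddf0.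
    by exists (c *: a + b); rewrite !ffunE linearP aE bE.
  have sM : subspace M.
    split=> [|c u v [u1 [a aE]] [v1 [b bE]]].
      by split; [exact: sM1.1 | exists 0 => j; rewrite ffunE raddf0].
    split; first exact: sM1.2.
    by exists (c *: a + b) => j; rewrite !ffunE linearP aE bE.
  have d01 : dimq setT M1 d0.
    apply: (dimq_rel (rho := fun s (t : {ffun 'I_r.+1 -> fps1 K}) => s = t ord0)
      subspaceT (subspace_im _) subspaceT sM1 _ _ _ _ _ (param_dim P)).
    + by rewrite ffunE.
    + by move=> c u u' v v' -> ->; rewrite !ffunE.
    + by move=> s _; exists [ffun=> s] => //; rewrite ffunE.
    + by move=> t _; exists (t ord0).
    + by move=> s t ->.
  have d1M : dimq M1 M d.
    apply: (dimq_rel (rho := fun (s : {ffun 'I_r -> fps1 K}) (t : {ffun 'I_r.+1 -> fps1 K}) =>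
        (forall j, s j = t (lift ord0 j)) /\ M1 t)
      subspaceT (subspace_im_family _) sM1 sM _ _ _ _ _ (family_dim Q)).
    + by split; [move=> j; rewrite !ffunE | exact: sM1.1].
    + move=> c u u' v v' [uE u1] [vE v1]; split; last exact: sM1.2.
      by move=> j; rewrite !ffunE uE vE.
    + move=> s _; pose t := [ffun i => if unlift ord0 i is Some j then s j else 0].
      have t1 : M1 t by exists 0; rewrite ffunE unlift_none raddf0.
      by exists t => //; split=> // j; rewrite ffunE liftK.
    + by move=> t t1; exists [ffun j => t (lift ord0 j)] => //; split=> // j;
      rewrite ffunE.
    + move=> s t [st t1]; split=> [[a aE]|[_ [a aE]]].
        by split=> //; exists a => j; rewrite -st.
      by exists a => j; rewrite st.
  have NM t : im_family phi t -> M t.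
    by move=> [a aE]; split; [exists a|exists a => j].
  have dMN : dimq M (im_family phi) n.
    (* A pair (a0, a1) of series can be replaced by a single one exactly if a0 - a1 lies in the
       ideal (f, g). *)
    apply: (dimq_rel (rho := fun (a : fps2 K) (t : {ffun 'I_r.+1 -> fps1 K}) =>
        exists a0 a1, [/\ t ord0 = phi ord0 a0,
          forall j, t (lift ord0 j) = phi (lift ord0 j) a1 & a = a0 - a1])
      subspaceT (subspace_ideal2 f g) sM (subspace_im_family _) _ _ _ _ _ dn).
    + by exists 0, 0; split=> [|j|];
      [rewrite ffunE raddf0 | rewrite ffunE raddf0 | rewrite subrr].
    + move=> c u u' v v' [a0 [a1 [E0 E1 ->]]] [b0 [b1 [F0 F1 ->]]].
      exists (c *: a0 + b0), (c *: a1 + b1); split=> [|j|].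
      * by rewrite !ffunE linearP E0 F0.
      * by rewrite !ffunE linearP E1 F1.
      * by rewrite scalerBr opprD addrACA.
    + move=> a _; pose t : {ffun 'I_r.+1 -> fps1 K} :=
        [ffun i => if unlift ord0 i is Some j then 0 else phi ord0 a].
      exists t.
        split; first by exists a; rewrite ffunE unlift_none.
        by exists 0 => j; rewrite ffunE liftK raddf0.
      by exists a, 0; split=> [|j|];
        [rewrite ffunE unlift_none | rewrite ffunE liftK raddf0 | rewrite subr0].
    + by move=> t [[a0 E0] [a1 E1]]; exists (a0 - a1) => //; exists a0, a1.
    + move=> a t [a0 [a1 [E0 E1 ->]]]; split=> [[u [v E]]|[w wE]].
        exists (a0 - u * f); apply: all_ord_recl => [|j].
          by rewrite rmorphB rmorphM /= (param_self P) mulr0 subr0.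
        have -> : a0 - u * f = a1 + v * g.
          by rewrite -[a0](subrK a1) E; ring.
        by rewrite rmorphD rmorphM /= Qg mulr0 addr0.
      have /(param_ker P)[u uE] : phi ord0 (a0 - w) = 0 by rewrite rmorphB /= -E0 wE subrr.
      have /(family_ker Q)[v vE] : forall j, phi (lift ord0 j) (w - a1) = 0.
        by move=> j; rewrite rmorphB /= -E1 wE subrr.
      by exists u, v; rewrite -uE -vE addrA subrK.
  rewrite -addnA; apply: (dimq_trans subspaceT sM1 (subspace_im_family _) _ _ d01).
  + by [].
  + by move=> t /NM[].
  + by apply: (dimq_trans sM1 sM (subspace_im_family _) _ NM d1M dMN) => t [].
Qed.

End ParamFamilies.

(** * Factorization *)

Section Factorization.
Variable K : closedFieldType.
Implicit Types (f g h : fps2 K) (s : seq (fps2 K)).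

(** The ideal of g is the kernel of a morphism to the domain K[[t]]. *)
Lemma irreducible_prime g a b : irreducible_elt g ->
  (exists c, a * b = c * g) -> (exists c, a = c * g) \/ (exists c, b = c * g).
Proof.
move=> /param_exists[phi [d P]] /(param_ker P); rewrite rmorphM.
by move=> /fps1_mul_eq0[/(param_ker P)|/(param_ker P)]; [left|right].
Qed.

Lemma factorization_exists f : f != 0 -> exists s, factorization f s.
Proof.
move=> f0; have [m mf] := mult_exists f0.
elim/ltn_ind: m f f0 mf => m IH f f0 mf.
have [uf|nuf] := boolP (f \is a GRing.unit).
  by exists [::]; split=> //; exists f; rewrite // big_nil mulr1.
case: (pselect (irreducible_elt f)) => [firr|nirr].
  exists [:: f]; split=> [g|]; first by rewrite inE => /eqP->.
  by exists 1; rewrite ?unitr1 // big_seq1 mul1r.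
have [a [b [fE nua nub]]] : exists a b,
    [/\ f = a * b, a \isn't a GRing.unit & b \isn't a GRing.unit].
  apply: contrapT => nex; apply: nirr; split=> // a b fE.
  have [ua|nua] := boolP (a \is a GRing.unit); [by left|right].
  by have [//|nub] := boolP (b \is a GRing.unit); case: nex; exists a, b.
have a0 : a != 0 by apply: contraNneq f0 => a0; rewrite fE a0 mul0r.
have b0 : b != 0 by apply: contraNneq f0 => b0; rewrite fE b0 mulr0.
have [k ka] := mult_exists a0; have [l lb] := mult_exists b0.
have pos h j : h \isn't a GRing.unit -> mult j h -> (0 < j)%N.
  by case: j => // /negP nu /mult0_unit.
have mE : m = (k + l)%N by apply: lead_uniq mf _; rewrite fE; apply: multM.
have k_gt0 := pos _ _ nua ka; have l_gt0 := pos _ _ nub lb.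
have [|sa [sa_irr [u uu aE]]] := IH k _ a a0 ka; first by lia.
have [|sb [sb_irr [v uv bE]]] := IH l _ b b0 lb; first by lia.
exists (sa ++ sb); split=> [g|].
  by rewrite mem_cat => /orP[/sa_irr|/sb_irr].
by exists (u * v); rewrite ?unitrM ?uu // fE aE bE big_cat /= mulrACA.
Qed.

Lemma irreducible_dvd_prod g s : irreducible_elt g ->
  (exists c, \prod_(h <- s) h = c * g) -> exists2 h, h \in s & exists c, h = c * g.
Proof.
move=> girr; elim: s => [|h s IH].
  rewrite big_nil => -[c E]; case: girr => _ /negP + _; case.
  by apply/unitrP; exists c; rewrite [g * c]mulrC -E.
rewrite big_cons => /(irreducible_prime girr)[hg|/IH[h' h's h'g]].
  by exists h; rewrite ?mem_head.
by exists h' => //; rewrite inE h's orbT.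
Qed.

(** Primality matches the first factor on the left with an associate on the right; both are
    cancelled, and the unit between them is absorbed in u. *)
Lemma size_factorization s s' u :
    (forall g, g \in s -> irreducible_elt g) -> (forall g, g \in s' -> irreducible_elt g) ->
    u \is a GRing.unit -> \prod_(g <- s) g = u * \prod_(g <- s') g ->
  size s = size s'.
Proof.
elim: s s' u => [|a s IH] s' u sirr s'irr uu.
  rewrite big_nil; case: s' s'irr => // b s' s'irr; rewrite big_cons => E.
  have : u * (b * \prod_(j <- s') j) \is a GRing.unit by rewrite -E unitr1.
  rewrite !unitrM => /and3P[_ ub _].
  by case: (s'irr b (mem_head _ _)) => _; rewrite ub.
rewrite big_cons => E; have airr := sirr a (mem_head _ _).
have [b bs' [c bE]] : exists2 h, h \in s' & exists c, h = c * a.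
  apply: irreducible_dvd_prod => //; exists (u^-1 * \prod_(g <- s) g).
  by rewrite -mulrA [_ * a]mulrC E mulKr.
have uc : c \is a GRing.unit.
  have [_ _ birr] := s'irr b bs'; have [_ /negP nua _] := airr.
  by case: (birr _ _ bE).
have a0 : a != 0 by case: airr.
have : \prod_(g <- s) g = (u * c) * \prod_(g <- rem b s') g.
  apply: (fps2_mulfI a0); rewrite E (perm_big _ (perm_to_rem bs')) big_cons bE.
  by rewrite /=; ring.
move=> E'; rewrite /= (IH (rem b s') (u * c)) //.
- by rewrite size_rem // prednK //; case: (s') bs'.
- by move=> g gs; apply: sirr; rewrite inE gs orbT.
- by move=> g /mem_rem; apply: s'irr.
- by rewrite unitrM uu.
Qed.

Lemma factors_factorization f : f != 0 -> factorization f (factors f).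
Proof. by move=> /factorization_exists ex; apply: (xgetPex [::] ex). Qed.

Lemma num_branchesE f s : f != 0 -> factorization f s -> num_branches f = size s.
Proof.
move=> f0 [sirr [u uu fE]]; have [firr [v uv fE']] := factors_factorization f0.
apply: (@size_factorization _ _ (v^-1 * u)) => //; first by rewrite unitrM unitrV uv.
by rewrite -mulrA -fE [X in _ = _ * X]fE' mulKr.
Qed.

End Factorization.

(** * The gamma invariant *)

(** The bounds are finite: a sum that attains its bound has no infinite term and no slack in either
    term. *)
Lemma leeD_eq (a a' : \bar int) (b b' : int) : (b%:E <= a)%E -> (b'%:E <= a')%E ->
  ((b + b')%:E <= a + a')%E /\
  ((a + a')%E = (b + b')%:E <-> a = b%:E /\ a' = b'%:E).
Proof.
case: a => [x||] //; case: a' => [y||] //=; rewrite ?lee_fin ?leey //;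
  try by move=> *; split=> //; split=> [|[]].
move=> bx b'y; split; first by rewrite lerD.
split=> [[E]|[[->] [->]] //].
have xb : x = b by lia.
by have y_b' : y = b' by [lia]; rewrite xb y_b'.
Qed.

Lemma lee_sum_eq r (a : 'I_r -> \bar int) (b : 'I_r -> int) :
    (forall i, ((b i)%:E <= a i)%E) ->
  ((\sum_(i < r) b i)%:E <= \sum_(i < r) a i)%E /\
  ((\sum_(i < r) a i)%E = (\sum_(i < r) b i)%:E <-> forall i, a i = (b i)%:E).
Proof.
elim: r a b => [|r IH] a b ba; first by rewrite !big_ord0; split=> //; split=> // _ [].
rewrite !big_ord_recl.
have [le1 eq1] := IH _ _ (fun i => ba (lift ord0 i)).
have [le2 eq2] := leeD_eq (ba ord0) le1; split=> //; rewrite eq2 eq1.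
split=> [[E0 ES]|E]; last by split.
exact: all_ord_recl.
Qed.

Lemma lee_min_eq (a a' : \bar int) (b : int) : (b%:E <= a)%E -> (b%:E <= a')%E ->
  (b%:E <= mine a a')%E /\ (mine a a' = b%:E <-> a = b%:E \/ a' = b%:E).
Proof.
move=> ba ba'; split; first by rewrite le_min ba ba'.
case: (leP a a') => [le|/ltW le]; split=> [E|[E|E]].
- by left.
- exact: E.
- by apply/le_anti; rewrite ba andbT -E.
- by right.
- by apply/le_anti; rewrite ba' andbT -E.
- exact: E.
Qed.

Lemma char_dvdn (K : fieldType) p n : has_characteristic K p ->
  (n%:R == 0 :> K) = (p %| n)%N.
Proof.
case=> [[-> /pcharf0P ->]|pK]; first by rewrite dvd0n.
by rewrite (dvdn_pcharf pK).
Qed.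

Lemma char_ndvd1 (K : fieldType) p : has_characteristic K p -> ~~ (p %| 1)%N.
Proof. by move=> charK; rewrite -(char_dvdn 1 charK) oner_eq0. Qed.

(** * Intersection numbers and the bound for one branch *)

Section IntersectionNumbers.
Variable K : fieldType.
Implicit Types (f g h : fps2 K) (phi : {lrmorphism fps2 K -> fps1 K}).

Lemma imultE f g n : dimq setT (ideal2 f g) n -> imult f g = n%:Z%:E.
Proof. exact: quotient_dimE subspaceT (subspace_ideal2 f g). Qed.

Lemma imult_param f phi d g n : is_param f phi d -> ordt (phi g) n ->
  imult f g = n%:Z%:E.
Proof. by move=> P gn; apply: imultE (param_imult P gn). Qed.

Lemma imult_param_infty f phi d g : is_param f phi d -> phi g = 0 ->
  imult f g = +oo%E.
Proof.
by move=> P g0; apply: quotient_dimPn => n; apply: param_imult_infty P g0.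
Qed.

Lemma ideal2C f g : ideal2 f g = ideal2 g f.
Proof. by apply/seteqP; split=> h [a [b ->]]; exists b, a; rewrite addrC. Qed.

Lemma ordt_gt0 f phi d g n : is_param f phi d -> coef2 g 0 0 = 0 ->
  ordt (phi g) n -> (0 < n)%N.
Proof.
move=> P g0 [_]; rewrite lt0n; apply: contra => /eqP->.
by rewrite (param_coef0 P) g0.
Qed.

(** Here i(f, h) is 2d plus the order of z'(t). It is used for h = f_y with z = x, and for h = f_x
    with z = y and [la] negated. *)
Lemma imult_deriv_bound f phi d h z la n : is_param f phi d ->
    ordt (phi z) n.+1 -> ordt la d.*2 -> phi h = la * deriv1 (phi z) ->
  (d.*2%:Z%:E <= imult f h - (n.+1)%:Z%:E + 1)%E /\
  ((imult f h - (n.+1)%:Z%:E + 1)%E = d.*2%:Z%:E <-> n.+1%:R != 0 :> K).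
Proof.
move=> P zn lad hE; rewrite -(deriv1_coef_eq0 zn).
have [z0|/ordt_exists[k zk]] := eqVneq (deriv1 (phi z)) 0.
  (* If z'(t) = 0, then i(f, h) is infinite and n + 1 is 0 in K, so both sides of the equivalence
     fail. *)
  rewrite (imult_param_infty P) ?hE ?z0 ?mulr0 //=; split; first by rewrite leey.
  by split=> //; rewrite tcoef0 eqxx.
have lenk : (n <= k)%N.
  rewrite leqNgt; apply/negP => lt; have := zk.2.
  by rewrite (deriv1_low zn lt) eqxx.
rewrite (imult_param P (n := (d.*2 + k)%N)); last by rewrite hE; apply: ordtM.
rewrite -[(_ + 1)%E]/(((d.*2 + k)%N%:Z - (n.+1)%:Z + 1)%:E) lee_fin.
split; first by lia.
split=> [[E]|nz].
  have -> : n = k by lia.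
  by have := zk.2.
have -> : k = n; last by congr (_%:E); lia.
apply/eqP; rewrite eqn_leq lenk andbT leqNgt; apply/negP => lt.
by rewrite zk.1 ?eqxx in nz.
Qed.

(* The case of a branch contained in the axis y = 0: then y = e f gives 1 = e f_y
   on the branch, and the lemma is applied with h = f_y. *)
Lemma param_of_axis f phi d x h la : is_param f phi d ->
    coef2 x 0 0 = 0 -> ordt la d.*2 -> phi h = la * deriv1 (phi x) ->
    (exists e, e * phi h = 1) ->
  d = 0%N /\ imult f x = 1%:Z%:E.
Proof.
move=> P x0 lad hE [e ehE].
(* Since e [la] x'(t) = 1, both [la] and x'(t) are units: the order 2d of [la] is 0, and x(t) has
   order 1. *)
have := congr1 (fun s => tcoef s 0) ehE; rewrite hE !tcoefM_0 tcoef1.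
have [la0|la0] := eqVneq (tcoef la 0) 0.
  by move/eqP; rewrite la0 mul0r mulr0 eq_sym oner_eq0.
have [dx0|dx0] := eqVneq (tcoef (deriv1 (phi x)) 0) 0.
  by move/eqP; rewrite dx0 !mulr0 eq_sym oner_eq0.
move=> _; split.
  have la00 : ordt la 0 by [].
  by move/(ordt_uniq lad): la00; lia.
apply: (imult_param P); split=> [[|//] _|].
  by rewrite (param_coef0 P).
by rewrite -[X in X != _]mulr1n.
Qed.

Lemma gamma_tilde_irr_bound p f phi d : has_characteristic K p -> is_param f phi d ->
  (d.*2%:Z%:E <= gamma_tilde_irr f)%E /\
  (gamma_tilde_irr f = d.*2%:Z%:E <->
   neq0_mod p (imult f fps2X) \/ neq0_mod p (imult f fps2Y)).
Proof.
move=> charK P; have [la lad [Ey Ex]] := param_deriv P.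
have X00 : coef2 (fps2X : fps2 K) 0 0 = 0 by [].
have Y00 : coef2 (fps2Y : fps2 K) 0 0 = 0 by [].
have one : neq0_mod p 1%:Z%:E by exists 1%N => //; apply: char_ndvd1 charK.
rewrite /gamma_tilde_irr /convenient.
have [X0|/ordt_exists[[|m] Xm]] := eqVneq (phi fps2X) 0; last 2 first.
- by have := ordt_gt0 P X00 Xm.
- have [Y0|/ordt_exists[[|n] Yn]] := eqVneq (phi fps2Y) 0; last 2 first.
  + by have := ordt_gt0 P Y00 Yn.
  + rewrite (imult_param P Xm) (imult_param P Yn) !ltry /=.
    have lad' := ordtN lad.
    have [leA eqA] := imult_deriv_bound P Yn lad' Ex.
    have [leB eqB] := imult_deriv_bound P Xm lad Ey.
    have [le eq] := lee_min_eq leA leB; split=> //; rewrite eq eqA eqB.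
    rewrite !(char_dvdn _ charK).
    split=> [[E|E]|[[k [kE] E]|[k [kE] E]]].
    * by right; exists n.+1.
    * by left; exists m.+1.
    * by right; rewrite kE.
    * by left; rewrite kE.
  (* The branch lies on y = 0: the value 0 of a series that is not convenient equals 2d, and p does
     not divide i(f, x) = 1. *)
  + rewrite (imult_param_infty P Y0) ltxx andbF.
    have [h hE] := (param_ker P fps2Y).1 Y0.
    have [|d0 X1] := @param_of_axis f phi d fps2X _ la P X00 lad Ey.
      exists (phi h); have /(congr1 phi) := congr1 (@fps2_dy K) hE.
      by rewrite fps2_dyY fps2_dyM rmorph1 rmorphD !rmorphM /= (param_self P) mulr0 add0r.
    by rewrite d0 X1; split=> //; split=> // _; left.
- rewrite (imult_param_infty P X0) ltxx /=.
  have [h hE] := (param_ker P fps2X).1 X0.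
  have [|d0 Y1] := @param_of_axis f phi d fps2Y _ _ P Y00 (ordtN lad) Ex.
    exists (phi h); have /(congr1 phi) := congr1 (@fps2_dx K) hE.
    by rewrite fps2_dxX fps2_dxM rmorph1 rmorphD !rmorphM /= (param_self P) mulr0 add0r.
  by rewrite d0 Y1; split=> //; split=> // _; right.
Qed.

End IntersectionNumbers.

(** * Sums over the branches, and right equivalence *)

Section GammaTilde.
Variable K : closedFieldType.
Implicit Types (f g h : fps2 K) (s : seq (fps2 K)).

(** The default 0 stands for an infinite i(g, h), which does not occur between factors of a reduced
    series at different positions. *)
Definition imultn g h : nat := xget 0%N [set n | dimq setT (ideal2 g h) n].

Lemma imultnE g h n : dimq setT (ideal2 g h) n -> imultn g h = n.
Proof.
move=> dn; apply: xget_unique => // k dk.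
exact: dimq_uniq subspaceT (subspace_ideal2 g h) dk dn.
Qed.

Lemma imultnC g h : imultn g h = imultn h g.
Proof. by rewrite /imultn ideal2C. Qed.

Lemma ordt_imultn f (phi : {lrmorphism fps2 K -> fps1 K}) d g :
  is_param f phi d -> phi g != 0 -> ordt (phi g) (imultn f g).
Proof.
move=> P /ordt_exists[n gn].
by rewrite (imultnE (param_imult P gn)).
Qed.

Lemma param_choice : exists (phi : fps2 K -> {lrmorphism fps2 K -> fps1 K}) (D : fps2 K -> nat),
  forall g, irreducible_elt g -> is_param g (phi g) (D g).
Proof.
(* A total choice function needs some morphism as its value at series that are not irreducible; a
   smooth curve provides one. *)
have [phi0 _] := param_smooth (regular_smooth (fun=> 0 : K)).
have ex g : exists pd : {lrmorphism fps2 K -> fps1 K} * nat,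
    irreducible_elt g -> is_param g pd.1 pd.2.
  have [girr|ng] := pselect (irreducible_elt g).
    by have [phi [d P]] := param_exists girr; exists (phi, d).
  by exists (phi0, 0%N).
have [pd pdP] := choice ex.
by exists (fun g => (pd g).1), (fun g => (pd g).2).
Qed.

Section Family.
Variables (phi : fps2 K -> {lrmorphism fps2 K -> fps1 K}) (D : fps2 K -> nat).
Hypothesis phiP : forall g, irreducible_elt g -> is_param g (phi g) (D g).

(** Doubling d turns the sum of intersection numbers over unordered pairs into the sum over ordered
    pairs that occurs in [gamma_tilde]. *)
Lemma family_factors s :
    (forall g, g \in s -> irreducible_elt g) ->
    (forall i j, (i < size s)%N -> (j < size s)%N -> i != j -> phi s`_i s`_j != 0) ->
  exists2 d, is_param_family (\prod_(g <- s) g) (fun i : 'I_(size s) => phi s`_i) d &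
    d.*2 = (\sum_(i < size s) ((D (s`_i)%R).*2 + \sum_(j < size s | j != i) imultn (s`_i)%R (s`_j)%R))%N.
Proof.
elim: s => [|f s IH] sirr sne.
  exists 0%N; last by rewrite big_ord0.
  by rewrite big_nil; apply: family_unit; apply: unitr1.
have sirr' g : g \in s -> irreducible_elt g.
  by move=> gs; apply: sirr; rewrite inE gs orbT.
have [d Q dE] := IH sirr' (fun i j => sne i.+1 j.+1).
have P := phiP (sirr f (mem_head _ _)).
have fs (j : 'I_(size s)) : phi f s`_j != 0 by exact: (sne 0%N j.+1 isT (ltn_ord j) isT).
have sf (j : 'I_(size s)) : phi s`_j f != 0 by exact: (sne j.+1 0%N (ltn_ord j) isT isT).
have ord_prod : ordt (phi f (\prod_(g <- s) g)) (\sum_(j < size s) imultn f (s`_j)%R)%N.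
  rewrite (big_nth 0) big_mkord.
  apply: (big_ind2 (fun h n => ordt (phi f h) n)) => [|h n h' n' hn hn'|j _].
  - by rewrite rmorph1; apply: ordt1.
  - by rewrite rmorphM; apply: ordtM.
  - exact: ordt_imultn P (fs j).
exists (D f + d + \sum_(j < size s) imultn f (s`_j)%R)%N.
  rewrite big_cons.
  exact: (@family_cons K f (\prod_(g <- s) g) (size s)
    (fun i : 'I_(size s).+1 => phi (f :: s)`_i) _ _ _ P Q ord_prod sf).
rewrite !doubleD dE /= big_ord_recl /=.
have sum0 : (\sum_(j < (size s).+1 | j != ord0) imultn f ((f :: s)`_j)%R)%N =
    (\sum_(j < size s) imultn f (s`_j)%R)%N.
  by rewrite big_mkcond big_ord_recl /= add0n; apply: eq_bigr.
have sumS (i : 'I_(size s)) :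
    (\sum_(j < (size s).+1 | j != lift ord0 i) imultn (s`_i)%R ((f :: s)`_j)%R =
     imultn f (s`_i)%R + \sum_(j < size s | j != i) imultn (s`_i)%R (s`_j)%R)%N.
  rewrite big_mkcond big_ord_recl /= imultnC; congr (_ + _)%N.
  rewrite [RHS]big_mkcond; apply: eq_bigr => j _.
  by rewrite (inj_eq (@lift_inj _ ord0)).
(* Each intersection number of f with an element of s occurs twice, in the row of f and, by
   symmetry, in the row of that element. *)
rewrite sum0; under [in RHS]eq_bigr => i _ do rewrite sumS addnCA.
rewrite [in RHS]big_split /=.
set A := (\sum_(i < size s) imultn f (s`_i)%R)%N; set T := (X in (_ + X + _)%N).
by rewrite [X in (_ + (_ + X))%N](_ : _ = T) //; lia.
Qed.

End Family.

(** Otherwise the square of the i-th factor would divide f. *)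
Lemma reduced_factors f s : reduced f -> factorization f s ->
  forall i j, (i < size s)%N -> (j < size s)%N -> i != j ->
    ~ exists c, s`_j = c * s`_i.
Proof.
move=> [_ fred] [sirr [u uu fE]] i j lti ltj ij [c sjE].
apply: (fred s`_i (sirr _ (mem_nth _ lti))).
pose rest := \prod_(k < size s | (k != Ordinal lti) && (k != Ordinal ltj)) s`_k.
exists (u * c * rest); rewrite fE (big_nth 0) big_mkord (bigD1 (Ordinal lti)) //=.
rewrite (bigD1 (Ordinal ltj)) /=; last by rewrite eq_sym.
by rewrite -/rest [X in _ * (_ * (X * _))]sjE; ring.
Qed.

(** The integer c records that delta is finite. The bound holds branch by branch with equal
    intersection terms on both sides, so that equality of the sums forces equality on every
    branch. *)
Lemma gamma_tilde_bound p f : has_characteristic K p -> reduced f ->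
  exists c : int, [/\ (2 * delta f - (num_branches f)%:Z%:E + 1)%E = c%:E,
    (c%:E <= gamma_tilde f)%E & gamma_tilde f = c%:E <-> im_good p f].
Proof.
move=> charK fred; have [f0 _] := fred.
have fs := factors_factorization f0; have [sirr [u uu fE]] := fs.
have [phi [D phiP]] := param_choice.
rewrite /num_branches /gamma_tilde /im_good; set s := factors f in fs sirr fE *.
have irr_nth (i : 'I_(size s)) : irreducible_elt s`_i by apply/sirr/mem_nth.
have sne i j : (i < size s)%N -> (j < size s)%N -> i != j -> phi s`_i s`_j != 0.
  move=> lti ltj ij; apply/negP => /eqP.
  move/(param_ker (phiP _ (sirr _ (mem_nth _ lti)))).
  exact: reduced_factors fred fs _ _ lti ltj ij.
have [d Q dE] := family_factors phiP sirr sne.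
have := delta_family (family_mul_unit uu fE Q) => ->.
exists (d.*2%:Z - (size s)%:Z + 1).
pose I i := (\sum_(j < size s | j != i) imultn (s`_i)%R (s`_j)%R)%N.
have imE (i : 'I_(size s)) : (\sum_(j < size s | j != i) imult s`_i s`_j)%E = (I i)%:Z%:E.
  rewrite /I (big_morph Posz PoszD (erefl _)) -sumEFin; apply: eq_bigr => j ji.
  have P := phiP _ (irr_nth i).
  by rewrite (imult_param P (ordt_imultn P _)) // sne // eq_sym.
have bound i := leeD_eq (gamma_tilde_irr_bound charK (phiP _ (irr_nth i))).1 (lexx (I i)%:Z%:E).
have [le eq] := lee_sum_eq (fun i => (bound i).1).
have sumE : \sum_(i < size s) ((D s`_i).*2%:Z + (I i)%:Z) = d.*2%:Z.
  by rewrite dE (big_morph Posz PoszD (erefl _)).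
rewrite sumE in le eq; under eq_bigr do rewrite imE.
set G := (\sum_(i < size s) _)%E in le eq *.
have GE : (G - (size s)%:Z%:E + 1)%E = (d.*2%:Z - (size s)%:Z + 1)%:E <-> G = d.*2%:Z%:E.
  case: G {le eq} => [x||] //; split=> [[E]|[->] //]; congr (_%:E); lia.
split.
- by rewrite -[LHS]/((2 * d%:Z - (size s)%:Z + 1)%:E); congr (_%:E); lia.
- case: G le {eq GE} => [x||]; rewrite ?lee_fin ?leey // => le.
  have : (d.*2%:Z - (size s)%:Z + 1 <= x - (size s)%:Z + 1)%R by lia.
  by rewrite -lee_fin.
rewrite GE eq; split=> [H g|H i].
  move=> /(nthP 0)[i lti <-];
    apply/(gamma_tilde_irr_bound charK (phiP _ (irr_nth (Ordinal lti)))).2.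
  by case: ((bound (Ordinal lti)).2.1 (H (Ordinal lti))).
apply/(bound i).2; split=> //.
by apply/(gamma_tilde_irr_bound charK (phiP _ (irr_nth i))).2/H/mem_nth.
Qed.

Lemma reduced_equiv (Phi : {rmorphism fps2 K -> fps2 K}) g : bijective Phi ->
  reduced (Phi g) -> reduced g.
Proof.
move=> bij [f0 fred]; split=> [|q qirr [h gE]].
  by apply: contra f0 => /eqP->; rewrite rmorph0.
apply: (fred (Phi q) (irreducible_bij bij qirr)).
by exists (Phi h); rewrite gE rmorphM rmorphXn.
Qed.

Lemma num_branches_equiv (Phi : {rmorphism fps2 K -> fps2 K}) g : bijective Phi ->
  g != 0 -> num_branches (Phi g) = num_branches g.
Proof.
move=> bij g0; have [sirr [u uu gE]] := factors_factorization g0.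
have Pg0 : Phi g != 0.
  by apply: contra g0 => /eqP E; apply/eqP/(bij_inj bij); rewrite E rmorph0.
rewrite (num_branchesE (s := [seq Phi h | h <- factors g]) Pg0) ?size_map //.
split=> [h /mapP[h' h's ->]|]; first exact/irreducible_bij/sirr.
by exists (Phi u); rewrite ?rmorph_unit // {1}gE rmorphM rmorph_prod big_map.
Qed.

(** [is_param_family] involves no derivatives, so composing the parametrizations of [Phi g] with Phi
    gives a family for g with the same d. *)
Lemma delta_equiv (Phi : {lrmorphism fps2 K -> fps2 K}) g : bijective Phi ->
  reduced (Phi g) -> delta (Phi g) = delta g.
Proof.
move=> bij fred; have [Psi PsiK PhiK] := bij.
have [f0 _] := fred; have fs := factors_factorization f0; have [sirr [u uu fE]] := fs.
have [phi [D phiP]] := param_choice.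
have sne i j : (i < size (factors (Phi g)))%N -> (j < size (factors (Phi g)))%N ->
    i != j -> phi (factors (Phi g))`_i (factors (Phi g))`_j != 0.
  move=> lti ltj ij; apply/negP => /eqP.
  move/(param_ker (phiP _ (sirr _ (mem_nth _ lti)))).
  exact: reduced_factors fred fs _ _ lti ltj ij.
have [d Q dE] := family_factors phiP sirr sne.
have P := family_mul_unit uu fE Q; rewrite (delta_family P).
pose psi i : {lrmorphism fps2 K -> fps1 K} := phi (factors (Phi g))`_i \o Phi.
suff P' : is_param_family g (fun i : 'I_(size (factors (Phi g))) => psi i) d.
  by rewrite (delta_family P').
split.
- move=> a; rewrite (family_ker P (Phi a)); split=> [[c cE]|[c ->]].
    by exists (Psi c); apply: (bij_inj bij); rewrite cE rmorphM /= PhiK.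
  by exists (Phi c); rewrite rmorphM.
- have [b b0 bP] := family_conductor P.
  exists (Psi b) => [i|s]; first by rewrite /= PhiK.
  by have [a aE] := bP s; exists (Psi a) => i; rewrite /= !PhiK.
- rewrite (_ : im_family _ = im_family (fun i : 'I_(size (factors (Phi g))) => phi (factors (Phi g))`_i)).
    exact: family_dim P.
  apply/seteqP; split=> s [a aE]; first by exists (Phi a).
  by exists (Psi a) => i; rewrite /= PhiK.
Qed.

End GammaTilde.

(** Either some value is finite and the integers above c are well ordered, or all values are
    infinite and any of them is minimal. *)
Lemma bounded_below_min (T : Type) (F : T -> \bar int) (A : T -> Prop) (c : int) :
    (exists x, A x) -> (forall x, A x -> (c%:E <= F x)%E) ->
  exists2 x, A x & forall y, A y -> (F x <= F y)%E.
Proof.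
move=> [x0 Ax0] cF.
case: (pselect (exists x n, A x /\ F x = (c + n%:Z)%:E)) => [[x [n [Ax Fx]]]|nfin].
  pose P n := `[< exists2 x, A x & F x = (c + n%:Z)%:E >].
  have exP : exists n, P n by exists n; apply/asboolP; exists x.
  case: (ex_minnP exP) => m /asboolP[z Az Fz] min.
  exists z => // y Ay; have := cF y Ay; rewrite Fz.
  case Fy : (F y) => [v||]; rewrite ?leey //.
  rewrite !lee_fin => lecv; have : P `|v - c|%N.
    by apply/asboolP; exists y => //; rewrite Fy; congr (_%:E); lia.
  by move/min; lia.
exists x0 => // y Ay; have := cF y Ay; case Fy : (F y) => [v||]; rewrite ?leey //.
rewrite lee_fin => lecv; case: nfin; exists y, `|v - c|%N; split=> //.
by rewrite Fy; congr (_%:E); lia.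
Qed.

Theorem theorem2p14 (K : closedFieldType) (p : nat)
    (charK : has_characteristic K p) (f : fps2 K) (f_reduced : reduced f) :
  (2 * delta f - (num_branches f)%:Z%:E + 1 <= gamma f)%E /\
  (gamma f = (2 * delta f - (num_branches f)%:Z%:E + 1)%E <->
   right_im_good p f).
Proof.
have [c [cE _ _]] := gamma_tilde_bound charK f_reduced; rewrite cE.
(* The same c serves the whole right equivalence class, as delta and the number of branches are
   invariant. *)
have bound g : right_equiv f g ->
    (c%:E <= gamma_tilde g)%E /\ (gamma_tilde g = c%:E <-> im_good p g).
  move=> [Phi [bij fE]].
  have gred : reduced g by move: f_reduced; rewrite fE; apply: reduced_equiv bij.
  have [c' [cE' le eq]] := gamma_tilde_bound charK gred.
  suff -> : c = c' by [].
  apply: EFin_inj; rewrite -cE -cE' fE delta_equiv // -?fE //.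
  by rewrite fE (@num_branches_equiv _ Phi) //; case: gred.
have equiv_refl : right_equiv f f.
  by exists (idfun : {lrmorphism fps2 K -> fps2 K}); split=> //; exists idfun.
have [g fg gmin] := bounded_below_min (ex_intro _ f equiv_refl) (fun g fg => (bound g fg).1).
have gammaE : gamma f = gamma_tilde g.
  apply: xget_unique => [|m [[h fh ->] hmin]]; first by split=> //; exists g.
  by apply/le_anti; rewrite (hmin _ fg) (gmin _ fh).
rewrite gammaE; split; first exact: (bound g fg).1.
(* If gamma attains the bound, the minimizing g is itself good; conversely a good h attains the
   bound, which the minimum then cannot exceed. *)
split=> [/(bound g fg).2 good|[h fh good]]; first by exists g.
apply/le_anti; rewrite (bound g fg).1 andbT -((bound h fh).2.2 good).
exact: gmin.
Qed.
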